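(* Let $M$ and $N$ be $\mathrm{II}_1$ factors. Then $$\mathcal G(M*N)\leq\mathcal G(M)+\mathcal G(N)+\tfrac12.$$
   Context: For a $\mathrm{II}_1$ factor $M$ with its faithful normal trace $\tau$, $\tau(1)=1$, let $\mathcal P(M)$ be the collection of all finite sets of mutually orthogonal projections in $M$ which sum to $1$. For $x\in M$ and $P\in\mathcal P(M)$ put $\mathcal I(x;P)=\sum_{p,q\in P,\ pxq\neq 0}\tau(p)\tau(q)$. For a finite subset $X\subset M$ put $\mathcal I(X;P)=\sum_{x\in X}\mathcal I(x;P)$ and $\mathcal I(X)=\inf_{P\in\mathcal P(M)}\mathcal I(X;P)$. $W^*(X)$ denotes the von Neumann algebra generated by $X$ (not automatically assumed to contain the identity of $M$). The generator invariant is $\mathcal G(M)=\inf\{\mathcal I(X): X\subset M\text{ finite},\ W^*(X)=M\}$, with $\mathcal G(M)=\infty$ if $M$ is not finitely generated. $M*N$ is the von Neumann algebra free product taken with respect to the normalised traces; it carries the free product trace. *)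

(* Defs.v *)
From HB Require Import structures.
From mathcomp Require Import all_boot all_order all_algebra sesquilinear.
From mathcomp Require Import all_classical all_reals all_analysis complex.

Set Implicit Arguments.
Unset Strict Implicit.
Unset Printing Implicit Defensive.

Import Order.TTheory GRing.Theory Num.Theory.
Import numFieldNormedType.Exports.

Local Open Scope classical_set_scope.
Local Open Scope ring_scope.

(* The inner product is linear in its first argument. *)
Record hilbert (R : realType) := Hilbert {
  hspace :> completeNormedModType R[i];
  inner : {dot hspace for Num.conj};
  inner_norm : forall u : hspace, `|u| ^+ 2 = inner u u }.

Arguments inner {R} h.

Section Operators.
Context {R : realType} {H : hilbert R}.
Implicit Types (A B C p q x : H -> H) (M X P D : set (H -> H)).
Implicit Types (tau : (H -> H) -> R[i]).

Definition bounded_op : set (H -> H) :=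
  [set A | linear A /\ continuous A].

Definition adjoint A B : Prop :=
  forall u v, inner H (A u) v = inner H u (B v).

(* Over R[i], [z <= w] entails that [w - z] is real, so that [op_le 0 A] says
   that A is a positive operator. *)
Definition op_le A B : Prop :=
  forall u, inner H (A u) u <= inner H (B u) u.

Definition projection p : Prop := p \o p = p /\ adjoint p p.

(* A *-subalgebra of B(H) closed in the strong operator topology, that is, the
   topology of pointwise convergence on B(H).  It need not contain id. *)
Record von_neumann_algebra M : Prop := {
  vna_bounded : M `<=` bounded_op;
  vna_zero : M 0;
  vna_add : forall A B, M A -> M B -> M (A + B);
  vna_scale : forall (c : R[i]) A, M A -> M (c *: A);
  vna_mul : forall A B, M A -> M B -> M (A \o B);
  vna_adjoint : forall A, M A -> exists2 B, M B & adjoint A B;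
  vna_closed : closure (M : set {ptws H -> H}) `&` bounded_op `<=` M }.

Definition generated_vna X : set (H -> H) :=
  [set A | forall M, von_neumann_algebra M -> X `<=` M -> M A].

Definition op_ub M D : set (H -> H) :=
  [set A | M A /\ forall B, D B -> op_le B A].

Definition op_lub M D A : Prop :=
  op_ub M D A /\ forall B, op_ub M D B -> op_le A B.

Definition op_directed D : Prop :=
  D !=set0 /\
  forall B C, D B -> D C -> exists2 E, D E & op_le B E /\ op_le C E.

(* Only the values of tau on M matter. *)
Record faithful_normal_trace M tau : Prop := {
  tr_linear : forall (c : R[i]) A B, M A -> M B ->
    tau (c *: A + B) = c * tau A + tau B;
  tr_id : tau id = 1;
  tr_mulC : forall A B, M A -> M B -> tau (A \o B) = tau (B \o A);
  tr_ge0 : forall A B, M A -> adjoint A B -> 0 <= tau (B \o A);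
  tr_faithful : forall A B, M A -> adjoint A B -> tau (B \o A) = 0 -> A = 0;
  tr_normal : forall D A, D `<=` M -> (forall B, D B -> op_le 0 B) ->
    op_directed D -> op_lub M D A ->
    forall c, (forall B, D B -> tau B <= c) -> tau A <= c }.

(* [I(x; P)] *)
Definition cut_index tau x P : R :=
  \sum_(pq \in [set pq : (H -> H) * (H -> H) |
                 [/\ P pq.1, P pq.2 & pq.1 \o x \o pq.2 <> 0]])
    complex.Re (tau pq.1) * complex.Re (tau pq.2).

(* The members of [P(M)]. *)
Definition projection_partition M P : Prop :=
  [/\ finite_set P,
      P `<=` [set p | M p /\ projection p],
      forall p q, P p -> P q -> p <> q -> p \o q = 0 &
      \sum_(p \in P) p = id].

(* [I(X)] *)
Definition set_index M tau X : \bar R :=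
  ereal_inf [set (\sum_(x \in X) cut_index tau x P)%:E |
             P in projection_partition M].

Definition generator_index M tau : \bar R :=
  ereal_inf [set set_index M tau X | X in
             [set X | [/\ finite_set X, X `<=` M & generated_vna X = M]]].

(* Type II_1 in the sense of Murray and von Neumann. *)
Record type_II1_factor M : Prop := {
  factor_center : forall A, M A -> (forall B, M B -> A \o B = B \o A) ->
    exists c : R[i], A = c *: (id : H -> H);
  factor_finite : forall v w, M v -> adjoint v w -> w \o v = id -> v \o w = id;
  factor_diffuse : forall p, M p -> projection p -> p <> 0 ->
    exists q, [/\ M q, projection q, q \o p = q, q <> 0 & q <> p] }.

(* A word is a list of letters, each tagged with the algebra it comes from. *)
Definition free (A : bool -> set (H -> H)) tau : Prop :=
  forall w : seq (bool * (H -> H)), w != [::] ->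
    sorted (fun s t => s.1 != t.1) w ->
    (forall s, s \in w -> A s.1 s.2 /\ tau s.2 = 0) ->
    tau (foldr (fun s T => s.2 \o T) id w) = 0.

End Operators.

Record tracial_vna (R : realType) := TracialVna {
  vna_space : hilbert R;
  vna : set (vna_space -> vna_space);
  tr : (vna_space -> vna_space) -> R[i];
  vna_axiom : von_neumann_algebra vna;
  vna_id : vna id;
  tr_axiom : faithful_normal_trace vna tr }.

Arguments vna {R} t.
Arguments tr {R} t.

Definition II1_factor (R : realType) (M : tracial_vna R) : Prop :=
  type_II1_factor (vna M).

Definition generator_invariant (R : realType) (M : tracial_vna R) : \bar R :=
  generator_index (vna M) (tr M).

(* phi restricts to a trace-preserving *-isomorphism of M onto the von Neumann
   subalgebra M0 of L, with the same unit. *)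
Record tracial_iso (R : realType) (M L : tracial_vna R)
    (M0 : set (vna_space L -> vna_space L))
    (phi : (vna_space M -> vna_space M) -> (vna_space L -> vna_space L)) :
    Prop := {
  iso_sub : von_neumann_algebra M0 /\ M0 `<=` vna L;
  iso_bij : set_bij (vna M) M0 phi;
  iso_linear : forall (c : R[i]) A B, vna M A -> vna M B ->
    phi (c *: A + B) = c *: phi A + phi B;
  iso_mul : forall A B, vna M A -> vna M B -> phi (A \o B) = phi A \o phi B;
  iso_adjoint : forall A B, vna M A -> adjoint A B -> adjoint (phi A) (phi B);
  iso_id : phi id = id;
  iso_tr : forall A, vna M A -> tr L (phi A) = tr M A }.

(* L with its trace is the free product M * N: it is generated by free copies
   of M and N on which its trace restricts to the given traces.  This determines
   L up to trace-preserving *-isomorphism. *)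
Definition free_product (R : realType) (M N L : tracial_vna R) : Prop :=
  exists (M0 N0 : set (vna_space L -> vna_space L)) phi psi,
    [/\ tracial_iso (M := M) M0 phi,
        tracial_iso (M := N) N0 psi,
        free (fun b => if b then M0 else N0) (tr L) &
        generated_vna (M0 `|` N0) = vna L].

(* Main.v *)
(* Split the identity of M into projections p_i and that of N into projections q_i,
   refining near-optimal partitions, with equal traces tau(p_i) = tau(q_i) <= e; this
   is possible because M and N are diffuse.  In M * N the operator p_i + q_i - 1 is
   injective: an x with p x = x = (1 - q) x would have a coefficient of
   constant modulus along infinitely many orthonormal alternating words, against
   Bessel's inequality.  Hence its polar part s_i is a symmetry exchanging p_i and q_i,
   and u = sum_i s_i q_i is a unitary with u q_i u^* = p_i.  Generators X of M and Y of
   N give generators of M * N by taking X, u Y u^* and the upper triangular part, with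
   respect to (p_i), of h = sum_i i q_i: they generate M, hence the p_i, hence h, its
   spectral projections q_i, the symmetries s_i, u and finally N.  The first two sets
   cost no more than X and Y, and a triangular matrix costs at most (1 + e) / 2.
   That the copy of M is generated by the copy of X requires normality of the
   isomorphism; it is obtained from Kaplansky's resolvent argument, along sequences,
   since the trace provides a countable separating family of vectors. *)

From HB Require Import structures.
Require Import Defs.
From mathcomp Require Import all_boot all_order all_algebra.
From mathcomp Require Import all_classical all_reals all_analysis.
From mathcomp Require Import sesquilinear complex ring lra.

Set Implicit Arguments.
Unset Strict Implicit.
Unset Printing Implicit Defensive.

Import Order.TTheory GRing.Theory Num.Theory.
Import numFieldNormedType.Exports.

Local Open Scope classical_set_scope.
Local Open Scope ring_scope.
Local Open Scope complex_scope.

(** * Real inner product and strong convergence *)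

(** The 1/2 is the cost of a self-adjoint operator coded by its upper triangle: with t_i = tau(p_i),
    the pairs i <= j weigh (1 + sum_i t_i^2) / 2, and small t_i push this to 1/2. One partition has
    to serve all generators at once. This is why N enters as u Y u^*: p_i u y u^* p_j = s_i (q_i y
    q_j) s_j has the zero pattern of y relative to (q_i). Undoing the conjugation requires u, so u
    must be reachable from M and the triangle alone; hence each s_i is made of strong limits of
    polynomials in p_i and q_i. In the injectivity argument the traces of p and r = 1 - q add up to
    1. The centred projections P and Q then have the same squared 2-norm s = tau(p) tau(r), the
    words (P Q)^n are orthogonal of 2-norm s^n, and an x fixed by p and r makes (P Q)^n act on x x^*
    as exactly s^n. Transport of generators is delicate because strong approximations are unbounded,
    so an isomorphism does not visibly respect them, and because the adjoint is not strongly
    continuous. Order and resolvents are algebraic, hence preserved. *)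

Section RealInner.
Context {R : realType} {H : hilbert R}.
Implicit Types u v w : H.

(** Estimates are carried out over [R]; [inner_ext] recovers the complex inner product by testing
    multiples of the second argument. *)
Definition ip u v : R := complex.Re (inner H u v).
Definition sq u : R := ip u u.

Lemma ReD (x y : R[i]) : complex.Re (x + y) = complex.Re x + complex.Re y.
Proof. by case: x y => [a b] [c d]. Qed.

Lemma ReN (x : R[i]) : complex.Re (- x) = - complex.Re x.
Proof. by case: x. Qed.

Lemma ReM_real (t : R) (x : R[i]) : complex.Re (t%:C * x) = t * complex.Re x.
Proof. by case: x => a b /=; rewrite mul0r subr0. Qed.

Lemma Re_ge0 (x : R[i]) : 0 <= x -> 0 <= complex.Re x.
Proof. by case: x => a b; rewrite lecE => /andP[]. Qed.

Lemma gt0_real_complex (x : R[i]) :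
  0 < x -> x = (complex.Re x)%:C /\ 0 < complex.Re x.
Proof. by case: x => a b; rewrite ltcE /= => /andP[/eqP -> ?]. Qed.

Lemma innerDl u v w : inner H (u + v) w = inner H u w + inner H v w.
Proof. exact: linearDl. Qed.

Lemma innerDr u v w : inner H u (v + w) = inner H u v + inner H u w.
Proof. exact: linearDr. Qed.

Lemma innerZl c u v : inner H (c *: u) v = c * inner H u v.
Proof. exact: linearZl_LR. Qed.

Lemma innerC u v : inner H u v = (inner H v u)^*.
Proof. by rewrite hermC /= expr0 mul1r. Qed.

Lemma ipC u v : ip u v = ip v u.
Proof. by rewrite /ip innerC; case: (inner H v u). Qed.

Lemma ipDl u v w : ip (u + v) w = ip u w + ip v w.
Proof. by rewrite /ip innerDl ReD. Qed.

Lemma ipDr u v w : ip u (v + w) = ip u v + ip u w.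
Proof. by rewrite !(ipC u) ipDl. Qed.

Lemma ipZl (t : R) u v : ip (t%:C *: u) v = t * ip u v.
Proof. by rewrite /ip innerZl ReM_real. Qed.

Lemma ipZr (t : R) u v : ip u (t%:C *: v) = t * ip u v.
Proof. by rewrite !(ipC u) ipZl. Qed.

Lemma ipNl u v : ip (- u) v = - ip u v.
Proof. by rewrite /ip linearNl ReN. Qed.

Lemma ipNr u v : ip u (- v) = - ip u v.
Proof. by rewrite !(ipC u) ipNl. Qed.

Lemma ipBl u v w : ip (u - v) w = ip u w - ip v w.
Proof. by rewrite ipDl ipNl. Qed.

Lemma ipBr u v w : ip u (v - w) = ip u v - ip u w.
Proof. by rewrite ipDr ipNr. Qed.

Lemma ip0l u : ip 0 u = 0.
Proof. by rewrite /ip linear0l. Qed.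

Lemma ip0r u : ip u 0 = 0.
Proof. by rewrite ipC ip0l. Qed.

Lemma sqE u : inner H u u = (sq u)%:C.
Proof.
have: 0 <= inner H u u by apply: dnorm_ge0.
rewrite /sq /ip; case: (inner H u u) => a b; rewrite lecE /= => /andP[/eqP -> _].
by [].
Qed.

Lemma sq_ge0 u : 0 <= sq u.
Proof. by apply/Re_ge0/dnorm_ge0. Qed.

Lemma sq_norm u : `|u| ^+ 2 = (sq u)%:C.
Proof. by rewrite inner_norm sqE. Qed.

Lemma sq_eq0 u : sq u = 0 -> u = 0.
Proof.
move=> u0; have := sq_norm u; rewrite u0 => /eqP.
by rewrite expf_eq0 /= normr_eq0 => /eqP.
Qed.

Lemma sq0 : sq 0 = 0. Proof. exact: ip0l. Qed.

Lemma sqD u v : sq (u + v) = sq u + ip u v *+ 2 + sq v.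
Proof. by rewrite /sq ipDl !ipDr (ipC v u) mulr2n !addrA. Qed.

Lemma sqB u v : sq (u - v) = sq u - ip u v *+ 2 + sq v.
Proof. by rewrite sqD {2}/sq ipNl !ipNr opprK mulNrn. Qed.

Lemma sqBC u v : sq (u - v) = sq (v - u).
Proof. by rewrite !sqB ipC; ring. Qed.

Lemma sqZ (t : R) u : sq (t%:C *: u) = t ^+ 2 * sq u.
Proof. by rewrite /sq ipZl ipZr mulrA. Qed.

Lemma sqD_le u v : sq (u + v) <= sq u *+ 2 + sq v *+ 2.
Proof. have := sq_ge0 (u - v); rewrite sqB sqD; lra. Qed.

Lemma real_quad_disc (a b c : R) : 0 <= a ->
  (forall t : R, 0 <= a * t ^+ 2 + b *+ 2 * t + c) -> b ^+ 2 <= a * c.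
Proof.
move=> a0 h; have [a00|an0] := eqVneq a 0.
  rewrite a00 mul0r; have [->|bn0] := eqVneq b 0; first by rewrite expr0n.
  (* For [a = 0] the form is affine, and this choice of [t] gives it the value -1. *)
  have := h (- (c + 1) / (b *+ 2)).
  rewrite a00 mul0r add0r mulrC divfK ?mulrn_eq0 //.
  lra.
have {an0}a_gt0 : 0 < a by rewrite lt_def an0 a0.
have := h (- b / a).
have -> : a * (- b / a) ^+ 2 + b *+ 2 * (- b / a) + c = (a * c - b ^+ 2) / a.
  by field; rewrite gt_eqF.
by rewrite pmulr_lge0 ?invr_gt0// subr_ge0.
Qed.

Lemma ip_le_half u v : ip u v *+ 2 <= sq u + sq v.
Proof. have := sq_ge0 (u - v); rewrite sqB; lra. Qed.

Lemma ip_ext u v : (forall w, ip u w = ip v w) -> u = v.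
Proof.
move=> h; apply/eqP; rewrite -subr_eq0; apply/eqP/sq_eq0.
by rewrite /sq ipBl h subrr.
Qed.

Lemma ImE u v : complex.Im (inner H u v) = ip u ('i%C *: v).
Proof.
rewrite /ip linearZr_LR /=; case: (inner H u v) => a b /=.
by rewrite mul0r mulN1r sub0r opprK.
Qed.

Lemma inner_ext u v u' v' :
  (forall c : R[i], ip u (c *: v) = ip u' (c *: v')) ->
  inner H u v = inner H u' v'.
Proof.
move=> h; apply/eqP; rewrite eq_complex; apply/andP; split; apply/eqP.
  by have := h 1; rewrite !scale1r.
by rewrite !ImE h.
Qed.

End RealInner.

Section Convergence.
Context {R : realType} {H : hilbert R}.
Implicit Types (u v w : H) (x y : nat -> H).

(** Norm convergence in terms of real squared norms, since the norm of [H] takes its values in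
    [R[i]]. *)
Definition vcvg x u : Prop := sq (x n - u) @[n --> \oo] --> (0 : R).

Lemma cvg0P (f : nat -> R) : (forall n, 0 <= f n) ->
  (f n @[n --> \oo] --> (0 : R) <->
   forall e : R, 0 < e -> exists N, forall n, (N <= n)%N -> f n < e).
Proof.
move=> f0; split=> [/cvgrPdist_lt h e /h [N _ hN]|h].
  exists N => n /hN /=; rewrite sub0r normrN ger0_norm //.
apply/cvgrPdist_lt => e /h [N hN]; exists N => // n /= /hN.
by rewrite sub0r normrN ger0_norm.
Qed.

Lemma cvg0_le (f g : nat -> R) : (forall n, 0 <= f n <= g n) ->
  g n @[n --> \oo] --> (0 : R) -> f n @[n --> \oo] --> (0 : R).
Proof.
move=> fg g0; apply: (@squeeze_cvgr _ _ _ _ (fun=> 0) g) => //.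
  by near=> n.
exact: cvg_cst.
Unshelve. all: by end_near. Qed.

Lemma vcvg_norm x u : vcvg x u <-> x n @[n --> \oo] --> u.
Proof.
split=> [/cvg0P h|/cvgrPdist_lt h].
  apply/cvgrPdist_lt => e e0.
  have [eR Re0] := gt0_real_complex e0.
  have [|N hN] := h (fun n => sq_ge0 _) (complex.Re e ^+ 2); first by rewrite exprn_gt0.
  exists N => // n /= /hN hn; rewrite distrC.
  rewrite -(@ltr_pXn2r _ 2) ?nnegrE //; last exact: ltW.
  by rewrite sq_norm [X in _ < X ^+ 2]eR -rmorphXn /= ltcR.
apply/cvg0P => [n|e e0]; first exact: sq_ge0.
have [|N _ hN] := h (Num.sqrt e)%:C; first by rewrite ltcR sqrtr_gt0.
exists N => n /hN /=; rewrite distrC.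
rewrite -(@ltr_pXn2r _ 2) ?nnegrE //; last by rewrite lecR sqrtr_ge0.
by rewrite sq_norm -rmorphXn /= sqr_sqrtr ?ltcR // ltW.
Qed.

Lemma vcvgD x y u v : vcvg x u -> vcvg y v -> vcvg (fun n => x n + y n) (u + v).
Proof. by move=> /vcvg_norm xu /vcvg_norm yv; apply/vcvg_norm; exact: (cvgD xu yv). Qed.

Lemma vcvgN x u : vcvg x u -> vcvg (fun n => - x n) (- u).
Proof. by move=> /vcvg_norm xu; apply/vcvg_norm; exact: (cvgN xu). Qed.

Lemma vcvgB x y u v : vcvg x u -> vcvg y v -> vcvg (fun n => x n - y n) (u - v).
Proof. by move=> xu yv; exact: vcvgD xu (vcvgN yv). Qed.

Lemma vcvgZ c x u : vcvg x u -> vcvg (fun n => c *: x n) (c *: u).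
Proof. by move=> /vcvg_norm xu; apply/vcvg_norm; exact: (cvgZl_tmp xu). Qed.

Lemma vcvg_cst u : vcvg (fun=> u) u.
Proof. by apply/vcvg_norm; exact: cvg_cst. Qed.

Lemma vcvg_unique x u v : vcvg x u -> vcvg x v -> u = v.
Proof. by move=> /vcvg_norm xu /vcvg_norm xv; exact: cvg_unique xu xv. Qed.

Lemma vcvgS x u : vcvg x u -> vcvg (fun n => x n.+1) u.
Proof. by move=> /vcvg_norm xu; apply/vcvg_norm; rewrite cvg_shiftS. Qed.

Lemma cvg_ip x y u v : vcvg x u -> vcvg y v ->
  ip (x n) (y n) @[n --> \oo] --> ip u v.
Proof.
move=> xu yv.
have polar a b : ip a b = (sq (a + b) - sq (a - b)) / 4.
  by rewrite sqD sqB; field.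
have sqc z w : vcvg z w -> sq (z n) @[n --> \oo] --> sq w.
  move=> /cvg0P zw; apply/cvgrPdist_lt => e e0.
  have w1 : 0 < sq w + 1 by rewrite ltr_wpDl ?sq_ge0.
  (* Weight for the inequality 2 |<w, d>| <= t |w|^2 + |d|^2 / t: it makes t (|w|^2 + 1) equal to e
     / 2. *)
  pose t := e / 2 / (sq w + 1).
  have t0 : 0 < t by rewrite !divr_gt0.
  have tw : t * sq w + t = e / 2 by rewrite /t; field; rewrite gt_eqF.
  have t1 : 0 < 1 + t^-1 by rewrite addr_gt0 ?invr_gt0.
  have [|N hN] := zw (fun n => sq_ge0 _) (e / 2 / (1 + t^-1)); first by rewrite !divr_gt0.
  exists N => // n /= /hN; rewrite ltr_pdivlMr // => hn.
  move: hn; set d := z n - w => hn.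
  have -> : z n = w + d by rewrite addrC subrK.
  rewrite sqD.
  have h1 := ip_le_half w (t^-1%:C *: d).
  have h2 := ip_le_half w (- t^-1%:C *: d).
  have tK : t * t^-1 = 1 by rewrite divff ?gt_eqF.
  have e1 : t * (ip w (t^-1%:C *: d) *+ 2) = ip w d *+ 2.
    by rewrite ipZr -mulrnAr mulrA tK mul1r.
  have e2 : t * (ip w (- t^-1%:C *: d) *+ 2) = - (ip w d *+ 2).
    by rewrite scaleNr ipNr mulNrn mulrN e1.
  have e3 : t * sq (t^-1%:C *: d) = t^-1 * sq d.
    by rewrite sqZ expr2 !mulrA tK mul1r.
  have e4 : t * sq (- t^-1%:C *: d) = t^-1 * sq d.
    by rewrite scaleNr /sq ipNl ipNr opprK e3.
  move: h1; rewrite -(ler_pM2l t0) e1 mulrDr e3 => h1.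
  move: h2; rewrite -(ler_pM2l t0) e2 mulrDr e4 => h2.
  have d0 := sq_ge0 d.
  move: hn.
  rewrite mulrDr mulr1 (mulrC (sq d)).
  move: (t^-1 * sq d) (t * sq w) tw h1 h2 => a b tw h1 h2 hn.
  rewrite ltr_norml; apply/andP; split; lra.
rewrite polar; under eq_fun do rewrite polar.
apply: cvgM; last exact: cvg_cst.
by apply: cvgB; apply: sqc; [exact: vcvgD|exact: vcvgB].
Qed.

Lemma cvg_sq x u : vcvg x u -> sq (x n) @[n --> \oo] --> sq u.
Proof. by move=> xu; exact: cvg_ip. Qed.

Lemma vcvg_complete x :
  (forall e : R, 0 < e -> exists N, forall m n, (N <= m)%N -> (N <= n)%N ->
     sq (x m - x n) < e) ->
  exists u, vcvg x u.
Proof.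
move=> h; suff /cvg_ex[u xu] : cvg (x n @[n --> \oo]) by exists u; apply/vcvg_norm.
apply/cauchy_cvgP/cauchy_exP => e e0.
have [eR Re0] := gt0_real_complex e0.
have [|N hN] := h (complex.Re e ^+ 2); first by rewrite exprn_gt0.
exists (x N); exists N => // n /= /hN hn; rewrite -ball_normE /=.
rewrite -(@ltr_pXn2r _ 2) ?nnegrE //; last exact: ltW.
by rewrite distrC sq_norm [X in _ < X ^+ 2]eR -rmorphXn /= ltcR hn.
Qed.

(** Designed for monotone sequences of operators, where [c] is a monotone bounded sequence of values
    of a quadratic form. *)
Lemma vcvg_complete_real x (c : nat -> R) :
  (forall m n, (m <= n)%N -> sq (x n - x m) <= c n - c m) ->
  cvg (c n @[n --> \oo]) -> exists u, vcvg x u.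
Proof.
move=> h /cvg_ex[/= l /cvgrPdist_lt cl]; apply: vcvg_complete => e e0.
have [|N _ hN] := cl (e / 2); first by rewrite divr_gt0.
have key m n : (N <= m)%N -> (m <= n)%N -> sq (x n - x m) < e.
  move=> Nm mn; apply: le_lt_trans (h _ _ mn) _.
  have /= := hN m Nm; have /= := hN n (leq_trans Nm mn).
  rewrite !ltr_norml => /andP[? ?] /andP[? ?]; lra.
exists N => m n Nm Nn; case: (leqP m n) => [mn|/ltnW nm].
  by rewrite sqBC key.
exact: key.
Qed.

End Convergence.

Section StrongClosure.
Context {R : realType} {H : hilbert R}.
Implicit Types (A T : H -> H) (M : set (H -> H)).

Lemma bounded_op_bound A : bounded_op A ->
  exists2 c : R, 0 <= c & forall u, sq (A u) <= c * sq u.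
Proof.
move=> [linA cA].
pose fA := HB.pack A (GRing.isLinear.Build _ _ _ _ A linA) : {linear H -> H}.
have /linear_bounded_continuous/linear_boundedP := cA : continuous fA.
move=> /pinfty_ex_gt0[r r0 hr].
have [rR _] := gt0_real_complex r0.
exists (complex.Re r ^+ 2) => [|u]; first exact: sqr_ge0.
have ru0 : 0 <= r * `|u| by rewrite mulr_ge0 // ltW.
have : `|A u| ^+ 2 <= (r * `|u|) ^+ 2 by rewrite ler_pXn2r ?nnegrE //; exact: hr.
by rewrite exprMn !sq_norm rR -rmorphXn -rmorphM /= lecR.
Qed.

Lemma bound_bounded_op A (c : R) : linear A ->
  (forall u, sq (A u) <= c * sq u) -> bounded_op A.
Proof.
move=> linA hA; split=> //.
pose fA := HB.pack A (GRing.isLinear.Build _ _ _ _ A linA) : {linear H -> H}.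
suff : continuous fA by [].
apply/linear_bounded_continuous/linear_boundedP.
pose c' := Num.sqrt (Num.max c 0).
have h u : `|fA u| <= c'%:C * `|u|.
  have c0 : 0 <= c'%:C by rewrite lecR sqrtr_ge0.
  rewrite -(@ler_pXn2r _ 2) ?nnegrE ?mulr_ge0 //.
  rewrite exprMn !sq_norm -rmorphXn -rmorphM /= lecR sqr_sqrtr; last first.
    by rewrite le_max lexx orbT.
  apply: le_trans (hA u) _; apply: ler_wpM2r; first exact: sq_ge0.
  by rewrite le_max lexx.
exists c'%:C; split; first by rewrite complex_real.
move=> r /ltW cr u; apply: le_trans (h u) _; exact: ler_wpM2r.
Qed.

(** A strong neighbourhood constrains finitely many vectors only; this is why approximations are
    always sought on a list. *)
Lemma closure_approx M T (s : seq H) (e : R) :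
  closure (M : set {ptws H -> H}) T -> 0 < e ->
  exists2 A, M A & forall v, v \in s -> sq (A v - T v) < e.
Proof.
move=> cT e0.
have cv : {ptws, nbhs (T : {ptws H -> H}) --> T} by exact: cvg_id.
have U v : nbhs (T : {ptws H -> H}) [set A : H -> H | sq (A v - T v) < e].
  have cvv := proj1 (pointwise_cvgP T (nbhs_filter (T : {ptws H -> H}))) cv v.
  have := proj1 (@cvgrPdist_lt R[i] H _ _ _ (fun g : H -> H => g v) (T v)) cvv (Num.sqrt e)%:C.
  rewrite ltcR sqrtr_gt0 => /(_ (nbhs_filter (T : {ptws H -> H})) e0); apply: filterS => A /=.
  rewrite distrC -(@ltr_pXn2r _ 2) ?nnegrE //; last by rewrite lecR sqrtr_ge0.
  by rewrite sq_norm -rmorphXn /= sqr_sqrtr ?ltcR // ltW.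
have : nbhs (T : {ptws H -> H}) [set A : H -> H | forall v, v \in s -> sq (A v - T v) < e].
  have FT := nbhs_filter (T : {ptws H -> H}).
  elim: s => [|v s IH]; first by apply: (@filterS _ _ FT _ _ _ (@filterT _ _ FT)) => A _ v.
  apply: (@filterS _ _ FT _ _ _ (@filterI _ _ FT _ _ (U v) IH)) => A [/= h1 h2] w.
  by rewrite inE => /predU1P[->|/h2].
by move=> /cT [A [MA hA]]; exists A.
Qed.

Lemma seq_closure M T (A : nat -> H -> H) :
  (forall n, M (A n)) -> (forall u, vcvg (A ^~ u) (T u)) ->
  closure (M : set {ptws H -> H}) T.
Proof.
move=> MA AT B /= nB.
have : {ptws, (A n @[n --> \oo]) --> T}.
  apply: (proj2 (pointwise_cvgP T (fmap_filter _ _))) => v.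
  exact: (proj1 (vcvg_norm _ _) (AT v)).
move=> /(_ B nB) [N _ hN]; exists (A N); split=> //.
exact: (hN N (leqnn N)).
Qed.

End StrongClosure.

(** * The star ring of bounded operators *)

Section Adjoint.
Context {R : realType} {H : hilbert R}.
Implicit Types (A B : H -> H).

Lemma adjoint_sym A B : adjoint A B -> adjoint B A.
Proof. by move=> h u v; rewrite innerC -h -innerC. Qed.

(** An adjoint is demanded along with boundedness so that [star] is total on [op]; members of a von
    Neumann algebra have one by [vna_adjoint]. *)
Definition admissible A : Prop :=
  bounded_op A /\ exists2 B, bounded_op B & adjoint A B.

Lemma bounded_opD A B : bounded_op A -> bounded_op B -> bounded_op (A + B).
Proof.
move=> bA bB; have [c c0 hA] := bounded_op_bound bA.
have [d d0 hB] := bounded_op_bound bB.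
apply: (@bound_bounded_op _ _ _ (c *+ 2 + d *+ 2)) => [k u v|u].
  rewrite !fctE (proj1 bA) (proj1 bB) scalerDr; exact: addrACA.
rewrite fctE; apply: le_trans (sqD_le _ _) _; have := hA u; have := hB u; lra.
Qed.

Lemma bounded_opM A B : bounded_op A -> bounded_op B -> bounded_op (A \o B).
Proof.
move=> [lA cA] [lB cB]; split; first by move=> k u v; rewrite /= lB lA.
by move=> u; apply: continuous_comp; [exact: cB|exact: cA].
Qed.

Lemma bounded_opZ (c : R[i]) A : bounded_op A -> bounded_op (c *: A).
Proof.
move=> [lA cA]; split.
  move=> k u v; rewrite !fctE lA scalerDr !scalerA; congr (_ + _).
  by rewrite mulrC.
by move=> u; apply: cvgZl_tmp; exact: cA.
Qed.

Lemma bounded_op1 : bounded_op (id : H -> H).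
Proof. by split=> // u; exact: cvg_id. Qed.

Lemma admissibleD A B : admissible A -> admissible B -> admissible (A + B).
Proof.
move=> [bA [A' bA' hA]] [bB [B' bB' hB]]; split; first exact: bounded_opD.
exists (A' + B'); first exact: bounded_opD.
by move=> u v; rewrite !fctE innerDl innerDr hA hB.
Qed.

Lemma admissibleM A B : admissible A -> admissible B -> admissible (A \o B).
Proof.
move=> [bA [A' bA' hA]] [bB [B' bB' hB]]; split; first exact: bounded_opM.
exists (B' \o A'); first exact: bounded_opM.
by move=> u v /=; rewrite hA hB.
Qed.

Lemma admissibleZ (c : R[i]) A : admissible A -> admissible (c *: A).
Proof.
move=> [bA [A' bA' hA]]; split; first exact: bounded_opZ.
exists (Num.conj c *: A'); first exact: bounded_opZ.
move=> u v; rewrite !fctE innerZl hA linearZr_LR /=.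
by rewrite conjCK.
Qed.

Lemma admissible1 : admissible (id : H -> H).
Proof. by split; [exact: bounded_op1|exists id => //; exact: bounded_op1]. Qed.

Lemma admissible0 : admissible (0 : H -> H).
Proof.
have -> : (0 : H -> H) = 0 *: (id : H -> H).
  by apply/funext => u; rewrite !fctE scale0r.
exact/admissibleZ/admissible1.
Qed.

Lemma admissibleN A : admissible A -> admissible (- A).
Proof.
move=> hA; have -> : - A = -1 *: A by apply/funext => u; rewrite !fctE scaleN1r.
exact: admissibleZ.
Qed.

End Adjoint.

(** Bundled operators form a ring and a module whose product unfolds to composition, so algebraic
    rewriting applies while membership in sets of functions is kept through the coercion. *)
Record op (R : realType) (H : hilbert R) := Op {
  opf :> H -> H;
  op_admissible : admissible opf }.

Section OpRing.
Context {R : realType} {H : hilbert R}.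
Local Notation op := (op H).
Implicit Types a b c : op.

Lemma op_ext a b : (forall u, a u = b u) -> a = b.
Proof.
case: a b => [A hA] [B hB] /= /funext AB; case: B / AB hB => hB.
by congr Op; exact: Prop_irrelevance.
Qed.

Lemma opf_inj a b : opf a = opf b -> a = b.
Proof. by move=> ab; apply: op_ext => u; rewrite ab. Qed.

Definition op_add a b : op := Op (admissibleD (op_admissible a) (op_admissible b)).
Definition op_opp a : op := Op (admissibleN (op_admissible a)).
Definition op_zero : op := Op admissible0.
Definition op_one : op := Op admissible1.
Definition op_mul a b : op := Op (admissibleM (op_admissible a) (op_admissible b)).
Definition op_scale (k : R[i]) a : op := Op (admissibleZ k (op_admissible a)).

HB.instance Definition _ := gen_eqMixin op.
HB.instance Definition _ := gen_choiceMixin op.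

Lemma op_linear a : linear a.
Proof. by case: a => A [[]]. Qed.

HB.instance Definition _ a := GRing.isLinear.Build R[i] H H *:%R a (@op_linear a).

Let addA : associative op_add.
Proof. by move=> a b c; apply: op_ext => u; exact: addrA. Qed.
Let addC : commutative op_add.
Proof. by move=> a b; apply: op_ext => u; exact: addrC. Qed.
Let add0 : left_id op_zero op_add.
Proof. by move=> a; apply: op_ext => u; exact: add0r. Qed.
Let addN : left_inverse op_zero op_opp op_add.
Proof. by move=> a; apply: op_ext => u; exact: addNr. Qed.

HB.instance Definition _ := GRing.isZmodule.Build op addA addC add0 addN.

Let mulA : associative op_mul.
Proof. by move=> a b c; apply: op_ext. Qed.
Let mul1 : left_id op_one op_mul.
Proof. by move=> a; apply: op_ext. Qed.
Let mulx1 : right_id op_one op_mul.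
Proof. by move=> a; apply: op_ext. Qed.
Let mulDl : left_distributive op_mul op_add.
Proof. by move=> a b c; apply: op_ext. Qed.
Let mulDr : right_distributive op_mul op_add.
Proof. by move=> a b c; apply: op_ext => u; exact: (linearD a). Qed.

HB.instance Definition _ :=
  GRing.Zmodule_isPzRing.Build op mulA mul1 mulx1 mulDl mulDr.

Let scaleA (k l : R[i]) a : op_scale k (op_scale l a) = op_scale (k * l) a.
Proof. by apply: op_ext => u; exact: scalerA. Qed.
Let scale1 : left_id 1 op_scale.
Proof. by move=> a; apply: op_ext => u; exact: scale1r. Qed.
Let scaleDr : right_distributive op_scale +%R.
Proof. by move=> k a b; apply: op_ext => u; exact: scalerDr. Qed.
Let scaleDl a : {morph op_scale^~ a : k l / k + l}.
Proof. by move=> k l; apply: op_ext => u; exact: scalerDl. Qed.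

HB.instance Definition _ :=
  GRing.Zmodule_isLmodule.Build R[i] op scaleA scale1 scaleDr scaleDl.

Lemma op_scalerAl (k : R[i]) (a b : op) : k *: (a * b) = k *: a * b.
Proof. by apply: op_ext. Qed.
Lemma op_scalerAr (k : R[i]) (a b : op) : k *: (a * b) = a * (k *: b).
Proof. by apply: op_ext => u; apply/esym; exact: (linearZ_LR a k (b u)). Qed.

Lemma opDE a b u : (a + b) u = a u + b u. Proof. by []. Qed.
Lemma opNE a u : (- a) u = - a u. Proof. by []. Qed.
Lemma opBE a b u : (a - b) u = a u - b u. Proof. by []. Qed.
Lemma opME a b u : (a * b) u = a (b u). Proof. by []. Qed.
Lemma opZE (k : R[i]) a u : (k *: a) u = k *: a u. Proof. by []. Qed.
Lemma op1E u : (1 : op) u = u. Proof. by []. Qed.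
Lemma op0E u : (0 : op) u = 0. Proof. by []. Qed.
Definition opE := (opDE, opNE, opME, opZE, op1E, op0E).

Lemma op_sumE (I : Type) (r : seq I) (P : pred I) (F : I -> op) u :
  (\sum_(i <- r | P i) F i) u = \sum_(i <- r | P i) F i u.
Proof. by elim/big_rec2: _ => // i x y _ <-. Qed.

Lemma star_subproof a : exists b : op, adjoint a b.
Proof.
case: a => A [bA [B bB h]] /=.
have aB : admissible B by split=> //; exists A => //; exact: adjoint_sym.
by exists (Op aB).
Qed.

Definition star a : op := sval (cid (star_subproof a)).

Lemma star_adjoint a : adjoint a (star a).
Proof. exact: svalP (cid (star_subproof a)). Qed.

Lemma star_ip a u v : ip (a u) v = ip u (star a v).
Proof. by rewrite /ip star_adjoint. Qed.

Lemma star_unique a b : (forall u v, ip (a u) v = ip u (b v)) -> star a = b.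
Proof.
move=> h; apply: op_ext => v; apply: ip_ext => w.
by rewrite ipC -star_ip h ipC.
Qed.

Lemma adjoint_star a b : adjoint a b -> star a = b.
Proof. by move=> h; apply: star_unique => u v; rewrite /ip h. Qed.

Lemma starK a : star (star a) = a.
Proof. by apply: star_unique => u v; rewrite ipC -star_ip ipC. Qed.

Lemma starD a b : star (a + b) = star a + star b.
Proof. by apply: star_unique => u v; rewrite !opE ipDl ipDr !star_ip. Qed.

Lemma starN a : star (- a) = - star a.
Proof. by apply: star_unique => u v; rewrite !opE ipNl ipNr !star_ip. Qed.

Lemma starB a b : star (a - b) = star a - star b.
Proof. by rewrite starD starN. Qed.

Lemma star0 : star 0 = 0.
Proof. by apply: star_unique => u v; rewrite !opE ip0l ip0r. Qed.

Lemma star1 : star 1 = 1.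
Proof. exact: star_unique. Qed.

Lemma starM a b : star (a * b) = star b * star a.
Proof. by apply: star_unique => u v; rewrite !opE !star_ip. Qed.

Lemma starZ (t : R) a : star (t%:C *: a) = t%:C *: star a.
Proof. by apply: star_unique => u v; rewrite !opE ipZl ipZr star_ip. Qed.

Lemma starZi a : star ('i%C *: a) = - 'i%C *: star a.
Proof.
apply: adjoint_star => u v; rewrite !opE innerZl linearZr_LR /= star_adjoint.
by congr (_ * _); apply/eqP; rewrite eq_complex /= oppr0 opprK !eqxx.
Qed.

Lemma starX a n : star (a ^+ n) = star a ^+ n.
Proof.
elim: n => [|n IH]; first by rewrite !expr0 star1.
by rewrite exprS starM IH -exprSr.
Qed.

Lemma star_sum (I : Type) (r : seq I) (P : pred I) (F : I -> op) :
  star (\sum_(i <- r | P i) F i) = \sum_(i <- r | P i) star (F i).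
Proof. by elim/big_rec2: _ => [|i x y _ <-]; rewrite ?star0 ?starD. Qed.

Lemma op_bound a : exists2 c : R, 0 <= c & forall u, sq (a u) <= c * sq u.
Proof. by apply: bounded_op_bound; case: a => A []. Qed.

Lemma op_vcvg a x u : vcvg x u -> vcvg (fun n => a (x n)) (a u).
Proof.
have [c c0 hc] := op_bound a => xu.
apply: (@cvg0_le R _ (fun n => c * sq (x n - u))) => [n|].
  by rewrite sq_ge0 -linearB hc.
rewrite -[X in _ --> X](mulr0 c); apply: cvgM => //; exact: cvg_cst.
Qed.

End OpRing.

(** * Positive operators *)

Reserved Notation "t %:O" (left associativity, at level 1, format "t %:O").

(* Testing against vectors turns an identity between real linear combinations of
   operators into one between real numbers. *)
Ltac op_linear_identity :=
  let u := fresh "u" in let v := fresh "v" in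
  apply: op_ext => u; apply: ip_ext => v;
  rewrite ?(opDE, opNE, opZE, op1E, op0E, ipDl, ipNl, ipZl, ip0l); first [ring | field].

Ltac op_expand :=
  rewrite ?(mulrDl, mulrDr, mulrN, mulNr, scalerDr, scalerN, mulrA, mul1r, mulr1,
            mul0r, mulr0, expr2) -?(op_scalerAl, op_scalerAr).

Section Positive.
Context {R : realType} {H : hilbert R}.
Local Notation op := (op H).
Local Notation "t %:O" := (t%:C *: (1 : op)) (format "t %:O").
Implicit Types a b c d x y : op.

(** Self-adjointness is a separate clause because [ip] sees only the real part of the form. *)
Definition pos a : Prop := star a = a /\ forall u, 0 <= ip (a u) u.

Lemma pos_herm a : pos a -> star a = a. Proof. by case. Qed.

Lemma ip_herm a u v : star a = a -> ip (a u) v = ip u (a v).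
Proof. by move=> h; rewrite star_ip h. Qed.

Lemma pos0 : pos 0.
Proof. by split=> [|u]; rewrite ?star0 ?opE ?ip0l. Qed.

Lemma pos1 : pos 1.
Proof. by split=> [|u]; [exact: star1|exact: sq_ge0]. Qed.

Lemma posD a b : pos a -> pos b -> pos (a + b).
Proof.
move=> [ha pa] [hb pb]; split=> [|u]; first by rewrite starD ha hb.
by rewrite opE ipDl addr_ge0.
Qed.

Lemma posZ (t : R) a : 0 <= t -> pos a -> pos (t%:C *: a).
Proof.
move=> t0 [ha pa]; split=> [|u]; first by rewrite starZ ha.
by rewrite opE ipZl mulr_ge0.
Qed.

Lemma pos_sum (I : Type) (r : seq I) (P : pred I) (F : I -> op) :
  (forall i, P i -> pos (F i)) -> pos (\sum_(i <- r | P i) F i).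
Proof. by move=> h; apply: (big_ind pos); [exact: pos0|exact: posD|]. Qed.

Lemma pos_conj a b : pos a -> pos (star b * a * b).
Proof.
move=> [ha pa]; split=> [|u]; first by rewrite !starM starK ha mulrA.
by rewrite !opE star_ip starK.
Qed.

Lemma pos_sandwich a b : star b = b -> pos a -> pos (b * a * b).
Proof. by move=> hb pa; rewrite -{1}hb; exact: pos_conj. Qed.

Lemma pos_star_mul b : pos (star b * b).
Proof. by rewrite -[star b]mulr1; apply/pos_conj/pos1. Qed.

Lemma pos_sqr b : star b = b -> pos (b * b).
Proof. by move=> hb; rewrite -{1}hb; exact: pos_star_mul. Qed.

Lemma pos_le_trans b a c : pos (b - a) -> pos (c - b) -> pos (c - a).
Proof. by move=> ab bc; have := posD ab bc; rewrite addrC subrKA. Qed.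

(** With m = n / 2 rounded down, a^n is the sandwich of 1 or a between two copies of the
    self-adjoint a^m. *)
Lemma posX a n : pos a -> pos (a ^+ n).
Proof.
move=> pa; have ha := pos_herm pa.
rewrite -[n]odd_double_half; move: n./2 => m; rewrite -addnn exprD exprD.
have hX : star (a ^+ m) = a ^+ m by rewrite starX ha.
case: (odd n); rewrite ?expr1 ?expr0 ?mul1r.
  have -> : a * (a ^+ m * a ^+ m) = a ^+ m * a * a ^+ m.
    by rewrite mulrA -exprS exprSr.
  exact: pos_sandwich.
exact: pos_sqr.
Qed.

(* [(t - d) d = (d (t - d) d + (t - d) d (t - d)) / t] *)
Lemma posXB (t : R) d n : 0 < t -> pos d -> pos (t%:O - d) ->
  pos (d ^+ n * (t%:O - d)).
Proof.
move=> t0 pd pt; set e := t%:O - d.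
have dtE : d + e = t%:O by rewrite /e addrC subrK.
have de : d * e = e * d.
  by rewrite /e mulrBr mulrBl -op_scalerAr -op_scalerAl mul1r mulr1.
have hd := pos_herm pd; have he := pos_herm pt.
have pde : pos (d * e).
  have -> : d * e = t^-1%:C *: (d * e * d + e * d * e).
    have -> : e * d * e = d * e * e by rewrite de.
    rewrite -mulrDr dtE -op_scalerAr mulr1 scalerA -rmorphM /=.
    by rewrite mulVf ?gt_eqF // scale1r.
  apply: posZ; first by rewrite invr_ge0 ltW.
  by apply: posD; apply: pos_sandwich.
have dXe m : d ^+ m * e = e * d ^+ m.
  by elim: m => [|m IH]; rewrite ?mulr1 ?mul1r // exprS -mulrA IH mulrA de mulrA.
rewrite -[n]odd_double_half; move: n./2 => m; rewrite -addnn exprD exprD.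
have hX : star (d ^+ m) = d ^+ m by rewrite starX hd.
case: (odd n); rewrite ?expr1 ?expr0 ?mul1r.
  have -> : d * (d ^+ m * d ^+ m) * e = d ^+ m * (d * e) * d ^+ m.
    by rewrite -!mulrA dXe !mulrA -exprS exprSr.
  exact: pos_sandwich.
rewrite -mulrA dXe mulrA; exact: pos_sandwich.
Qed.

Lemma pos_eq0 a : pos a -> pos (- a) -> a = 0.
Proof.
move=> [ha pa] [_ na]; have a0 u : ip (a u) u = 0.
  by apply/eqP; rewrite eq_le pa andbT; have := na u; rewrite opE ipNl oppr_ge0.
apply: op_ext => u; apply: ip_ext => v; rewrite ip0l.
have := a0 (u + v); rewrite linearD ipDl !ipDr !a0 (ip_herm v u ha) (ipC v).
lra.
Qed.

(** The form is nonnegative at t u + v for every real t, so its discriminant in t is not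
    positive. *)
Lemma pos_cauchy_schwarz a u v : pos a ->
  ip (a u) v ^+ 2 <= ip (a u) u * ip (a v) v.
Proof.
move=> [ha pa]; apply: real_quad_disc (pa u) _ => t.
have := pa (t%:C *: u + v).
rewrite linearD linearZ_LR ipDl !ipDr !ipZl !ipZr (ip_herm v u ha) (ipC v); lra.
Qed.

(** Cauchy-Schwarz with v = a u gives |a u|^4 <= <a u, u> <a (a u), a u> <= <a u, u> t |a u|^2; then
    divide by |a u|^2. *)
Lemma pos_bound (t : R) a u : 0 <= t -> pos a -> pos (t%:O - a) ->
  sq (a u) <= t * ip (a u) u.
Proof.
move=> t0 pa [_ at_]; have := pos_cauchy_schwarz u (a u) pa.
have := at_ (a u); rewrite opBE ipBl opZE ipZl op1E -/(sq (a u)) => h1 h2.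
have [s0|sn0] := eqVneq (sq (a u)) 0; first by rewrite s0 mulr_ge0 ?(proj2 pa).
have sp : 0 < sq (a u) by rewrite lt_def sn0 sq_ge0.
rewrite -(ler_pM2r sp); apply: le_trans (_ : _ <= ip (a u) u * (t * sq (a u))) _.
  rewrite -expr2; apply: le_trans h2 _; apply: ler_wpM2l; first exact: (proj2 pa).
  by move: h1; rewrite subr_ge0.
by rewrite le_eqVlt; apply/orP; left; apply/eqP; ring.
Qed.

Lemma pos_kernel a u : pos a -> ip (a u) u = 0 -> a u = 0.
Proof.
move=> pa a0; apply: sq_eq0; apply/eqP.
rewrite -sqrf_eq0 eq_le sqr_ge0 andbT.
by have := pos_cauchy_schwarz u (a u) pa; rewrite a0 mul0r.
Qed.

Lemma herm_le_scalar a : star a = a -> exists2 t : R, 0 < t & pos (t%:O - a).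
Proof.
move=> ha; have [c c0 hc] := op_bound a; exists (c + 1); first lra.
split=> [|u]; first by rewrite starB ha starZ star1.
rewrite opBE ipBl opZE ipZl op1E -/(sq u).
have := ip_le_half (a u) u; have := hc u; have := sq_ge0 u; nra.
Qed.

Lemma pos_le_pow1 a : pos a -> pos (1 - a) -> pos (1 - a * a).
Proof.
move=> pa p1; apply: (@pos_le_trans a) => //.
have := @posXB 1 a 1 ltr01 pa; rewrite scale1r expr1 => /(_ p1).
by rewrite mulrBr mulr1.
Qed.

Definition scvg (a : nat -> op) b : Prop := forall u, vcvg (fun n => a n u) (b u).

Lemma scvg_unique (a : nat -> op) b c : scvg a b -> scvg a c -> b = c.
Proof. by move=> ab ac; apply: op_ext => u; exact: vcvg_unique (ab u) (ac u). Qed.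

Lemma scvg_cst a : scvg (fun=> a) a.
Proof. by move=> u; exact: vcvg_cst. Qed.

Lemma scvgD (a c : nat -> op) b d : scvg a b -> scvg c d ->
  scvg (fun n => a n + c n) (b + d).
Proof. by move=> ab cd u; exact: vcvgD. Qed.

Lemma scvgB (a c : nat -> op) b d : scvg a b -> scvg c d ->
  scvg (fun n => a n - c n) (b - d).
Proof. by move=> ab cd u; exact: vcvgB. Qed.

Lemma scvgZ (k : R[i]) (a : nat -> op) b : scvg a b ->
  scvg (fun n => k *: a n) (k *: b).
Proof. by move=> ab u; exact: vcvgZ. Qed.

Lemma scvgMl x (a : nat -> op) b : scvg a b -> scvg (fun n => x * a n) (x * b).
Proof. by move=> ab u; exact: op_vcvg. Qed.

Lemma scvgMr x (a : nat -> op) b : scvg a b -> scvg (fun n => a n * x) (b * x).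
Proof. by move=> ab u; exact: ab. Qed.

Lemma scvgS (a : nat -> op) b : scvg a b -> scvg (fun n => a n.+1) b.
Proof. by move=> ab u; apply: (@vcvgS _ _ (fun n => a n u)). Qed.

(** Multiplication is jointly strongly continuous only on bounded sets of left factors: split a_n
    c_n - b d as a_n (c_n - d) + (a_n - b) d. *)
Lemma scvgM (t : R) (a c : nat -> op) b d : (forall n u, sq (a n u) <= t * sq u) ->
  scvg a b -> scvg c d -> scvg (fun n => a n * c n) (b * d).
Proof.
move=> ta ab cd u.
have h : vcvg (fun n => a n (c n u - d u)) 0.
  apply: (@cvg0_le R _ (fun n => t * sq (c n u - d u))) => [n|].
    by rewrite sq_ge0 subr0 ta.
  rewrite -[X in _ --> X](mulr0 t); apply: cvgM; [exact: cvg_cst|exact: cd].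
have := vcvgD h (ab (d u)); rewrite add0r.
by congr vcvg; apply/funext => n; rewrite linearB subrK.
Qed.

Lemma cvg_le_cst (f : nat -> R) l t : f n @[n --> \oo] --> l ->
  (forall n, f n <= t) -> l <= t.
Proof.
move=> fl ft; rewrite -(cvg_lim (@Rhausdorff R) fl).
by apply: limr_le; [apply/cvg_ex; exists l|near=> n].
Unshelve. all: by end_near. Qed.

Lemma cvg_ge_cst (f : nat -> R) l t : f n @[n --> \oo] --> l ->
  (forall n, t <= f n) -> t <= l.
Proof.
move=> fl ft; rewrite -(cvg_lim (@Rhausdorff R) fl).
by apply: limr_ge; [apply/cvg_ex; exists l|near=> n].
Unshelve. all: by end_near. Qed.

Lemma scvg_herm (a : nat -> op) b : scvg a b -> (forall n, star (a n) = a n) ->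
  star b = b.
Proof.
move=> ab ha; apply: star_unique => u v.
have h1 := cvg_ip (ab u) (vcvg_cst v); have h2 := cvg_ip (vcvg_cst u) (ab v).
move: h1; under eq_fun do rewrite (ip_herm _ _ (ha _)).
by move=> h1; exact: (cvg_unique (@Rhausdorff R) h1 h2).
Qed.

Lemma scvg_pos (a : nat -> op) b : scvg a b -> (forall n, pos (a n)) -> pos b.
Proof.
move=> ab pa; split=> [|u]; first by apply: scvg_herm ab _ => n; case: (pa n).
by apply: (cvg_ge_cst (cvg_ip (ab u) (vcvg_cst u))) => n; case: (pa n).
Qed.

(** The uniform bound passes to the limit, and self-adjointness makes the limit its own adjoint. *)
Lemma pointwise_limit_op (t : R) (a : nat -> op) :
  (forall n, star (a n) = a n) -> (forall n u, sq (a n u) <= t * sq u) ->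
  (forall u, exists v, vcvg (fun n => a n u) v) -> exists b, scvg a b.
Proof.
move=> ha ta lim; pose B u := sval (cid (lim u)).
have aB u : vcvg (fun n => a n u) (B u) by exact: svalP (cid (lim u)).
have linB : linear B.
  move=> k u v; apply: vcvg_unique (aB _) _.
  have := vcvgD (vcvgZ k (aB u)) (aB v); congr vcvg.
  by apply/funext => n; rewrite linearP.
have bB : bounded_op B.
  by apply: (bound_bounded_op linB) => u; apply: (cvg_le_cst (cvg_sq (aB u))).
have hB : adjoint B B.
  move=> u v; apply: inner_ext => k.
  have -> : k *: B v = B (k *: v).
    have := linB k v 0; rewrite !addr0.
    have -> : B 0 = 0 by apply: sq_eq0; apply/eqP; rewrite eq_le sq_ge0 andbT;
      apply: (cvg_le_cst (cvg_sq (aB 0))) => n; rewrite linear0 sq0.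
    by rewrite addr0.
  have h1 := cvg_ip (aB u) (vcvg_cst (k *: v)).
  have h2 := cvg_ip (vcvg_cst u) (aB (k *: v)).
  move: h1; under eq_fun do rewrite (ip_herm _ _ (ha _)).
  by move=> h1; exact: (cvg_unique (@Rhausdorff R) h1 h2).
have aB' : admissible B by split=> //; exists B.
by exists (Op aB').
Qed.

(** For m <= n, [pos_bound] dominates |(a_n - a_m) u|^2 by K times the increment of <a_n u, u>, a
    bounded monotone real sequence. *)
Lemma vigier (t : R) (a : nat -> op) :
  (forall n, star (a n) = a n) -> (forall n, pos (a n.+1 - a n)) ->
  (forall n, pos (t%:O - a n)) -> exists b, scvg a b.
Proof.
move=> ha inc ub.
have mono m n : (m <= n)%N -> pos (a n - a m).
  move=> /subnK <-; elim: (n - m)%N => [|k IH]; first by rewrite subrr; exact: pos0.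
  by apply: pos_le_trans IH _; rewrite addSn.
have [s s0 hs] : exists2 s : R, 0 < s & pos (s%:O + a 0%N).
  have [|s s0 hs] := @herm_le_scalar (- a 0%N); first by rewrite starN ha.
  by exists s => //; move: hs; rewrite opprK.
(* Since a_0 >= -s, every difference a_n - a_m with m <= n is at most t + s; the maximum with 0
   meets the sign condition of [pos_bound]. *)
pose K := Num.max (t + s) 0.
have K0 : 0 <= K by rewrite le_max lexx orbT.
have dK m n : (m <= n)%N -> pos (K%:O - (a n - a m)).
  move=> mn; have -> : K%:O - (a n - a m) =
    (t%:O - a n) + ((s%:O + a 0%N) + (a m - a 0%N)
     + (K - (t + s))%:O) :> op.
    by op_linear_identity.
  apply: posD => //; apply: posD; first by apply: posD => //; exact: mono.
  by apply: posZ; [rewrite subr_ge0 le_max lexx|exact: pos1].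
have est m n u : (m <= n)%N ->
    sq (a n u - a m u) <= K * ip (a n u) u - K * ip (a m u) u.
  move=> mn; have := pos_bound u K0 (mono _ _ mn) (dK _ _ mn).
  by rewrite opBE ipBl mulrBr.
have [c c0 hc] := op_bound (a 0%N).
apply: (@pointwise_limit_op (K ^+ 2 *+ 2 + c *+ 2)) => // [n u|u].
  have -> : a n u = (a n u - a 0%N u) + a 0%N u by rewrite subrK.
  apply: le_trans (sqD_le _ _) _; have h0 := hc u.
  have h1 := est _ _ u (leq0n n); have [_ /(_ u)] := dK _ _ (leq0n n).
  rewrite opBE ipBl opZE op1E ipZl opBE ipBl -/(sq u) => h2; nra.
apply: (vcvg_complete_real (fun m n => @est m n u)).
apply: nondecreasing_is_cvgn.
  apply/nondecreasing_seqP => n; apply: ler_wpM2l => //.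
  by have [_ /(_ u)] := inc n; rewrite opBE ipBl subr_ge0.
exists (K * (t * sq u)) => _ [n _ <-]; apply: ler_wpM2l => //.
by have [_ /(_ u)] := ub n; rewrite opBE ipBl opZE ipZl subr_ge0.
Qed.

Lemma incr_le_lim (a : nat -> op) b n : scvg a b ->
  (forall n, pos (a n.+1 - a n)) -> pos (b - a n).
Proof.
move=> ab inc.
have h : scvg (fun k => a (k + n)%N - a n) (b - a n).
  apply: scvgB (scvg_cst _) => u.
  have /vcvg_norm := ab u; rewrite -(cvg_shiftn n) => h.
  exact/vcvg_norm.
apply: scvg_pos h _ => k; elim: k => [|k IH]; first by rewrite add0n subrr; exact: pos0.
by apply: pos_le_trans IH _; rewrite addSn.
Qed.

End Positive.

(** * Resolvents, kernel projections, square roots *)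

Section VonNeumann.
Context {R : realType} {H : hilbert R}.
Local Notation op := (op H).
Local Notation "t %:O" := (t%:C *: (1 : op)).
Implicit Types (a b c d x y : op) (B : set (H -> H)).

Lemma vna_op B A : von_neumann_algebra B -> B A -> exists a : op, opf a = A.
Proof.
move=> vB BA; have [A' BA' h] := vna_adjoint vB BA.
have aA : admissible A.
  by split; [exact: vna_bounded vB _ BA|exists A' => //; exact: vna_bounded vB _ BA'].
by exists (Op aA).
Qed.

Section Membership.
Variable B : set (H -> H).
Hypothesis vB : von_neumann_algebra B.

Lemma mem0 : B (0 : op). Proof. exact: vna_zero. Qed.

Lemma memD a b : B a -> B b -> B (a + b).
Proof. exact: (vna_add vB). Qed.

Lemma memZ (k : R[i]) a : B a -> B (k *: a).
Proof. exact: (vna_scale vB). Qed.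

Lemma memM a b : B a -> B b -> B (a * b).
Proof. exact: (vna_mul vB). Qed.

Lemma memN a : B a -> B (- a).
Proof. by rewrite -scaleN1r; exact: memZ. Qed.

Lemma memB a b : B a -> B b -> B (a - b).
Proof. by move=> Ba Bb; apply: memD => //; exact: memN. Qed.

Lemma mem_star a : B a -> B (star a).
Proof.
move=> Ba; have [A' BA' h] := vna_adjoint vB Ba.
have [a' aE] := vna_op vB BA'; rewrite -aE in h BA'.
by rewrite (adjoint_star h).
Qed.

Lemma mem_sum (I : Type) (r : seq I) (P : pred I) (F : I -> op) :
  (forall i, P i -> B (F i)) -> B (\sum_(i <- r | P i) F i : op).
Proof. by move=> h; apply: (big_ind (fun a : op => B a)); [exact: mem0|exact: memD|]. Qed.

Lemma memX a n : B (1 : op) -> B a -> B (a ^+ n).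
Proof.
move=> B1 Ba; elim: n => [|n IH]; first by rewrite expr0.
by rewrite exprS; exact: memM.
Qed.

Lemma mem_scvg (a : nat -> op) b : (forall n, B (a n)) -> scvg a b -> B b.
Proof.
move=> Ba ab; apply: (vna_closed vB); split; last by case: (op_admissible b).
exact: (seq_closure (A := fun n => opf (a n)) Ba ab).
Qed.

End Membership.

Lemma generated_vna_sub X B : von_neumann_algebra B -> X `<=` B ->
  generated_vna X `<=` B.
Proof. by move=> vB XB A; exact. Qed.

(** Neumann series: for 0 <= a <= c and k = 1 / (1 + c), the operator d = k (c - a) satisfies 0 <= d
    <= th < 1 and 1 - d = k (1 + a), so the inverse is k times the sum of the d^i. The implication
    stands under the existential so that [res] is a total function. The clause on [y * r] serves
    algebras that may lack the unit. *)
Lemma inverse_exists a : exists r, pos a ->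
  [/\ (1 + a) * r = 1, pos r, pos (1 - r) &
      forall B y, von_neumann_algebra B -> B a -> B y -> B (y * r)].
Proof.
have [pa|npa] := pselect (pos a); last by exists 0.
have ha := pos_herm pa.
have [c c0 hc] := herm_le_scalar ha.
have c1 : 0 < 1 + c by rewrite addr_gt0.
pose th := c / (1 + c); pose k := (1 + c)^-1.
have th0 : 0 < th by rewrite divr_gt0.
have k0 : 0 < k by rewrite invr_gt0.
have kc : k + k * c = 1 by rewrite /k; field; rewrite gt_eqF.
have thE : th = k * c by rewrite /th /k mulrC.
have th1 : th < 1 by rewrite thE -kc; lra.
clearbody th k.
pose d : op := k%:C *: (c%:O - a).
have pd : pos d by apply: posZ => //; exact: ltW.
have hd := pos_herm pd.
have d1 : 1 - d = k%:C *: (1 + a).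
  rewrite /d; apply: op_ext => u; apply: ip_ext => v.
  rewrite !(opDE, opNE, opZE, op1E, ipDl, ipNl, ipZl).
  have e : ip u v = (k + k * c) * ip u v by rewrite kc mul1r.
  by rewrite {1}e; ring.
have pthd : pos (th%:O - d).
  have -> : th%:O - d = k%:C *: a by rewrite thE /d; op_linear_identity.
  by apply: posZ => //; exact: ltW.
pose S n : op := \sum_(i < n) d ^+ i.
have SS n : S n.+1 = S n + d ^+ n by rewrite /S big_ord_recr.
have hS n : star (S n) = S n.
  by rewrite /S star_sum; apply: eq_bigr => i _; rewrite starX hd.
have Sd n : S n * (1 - d) = 1 - d ^+ n.
  elim: n => [|n IH]; first by rewrite /S big_ord0 mul0r expr0 subrr.
  by rewrite SS mulrDl IH mulrBr mulr1 -exprSr addrA subrK.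
have ubS n : pos ((1 - th)^-1%:O - S n).
  have th1' : 0 < 1 - th by rewrite subr_gt0.
  have -> : (1 - th)^-1%:O - S n = (1 - th)^-1%:C *: (1 - (1 - th)%:C *: S n).
    rewrite scalerBr scalerA -rmorphM /= mulVf ?gt_eqF // scale1r //.
  apply: posZ; first by rewrite invr_ge0 ltW.
  (* From the telescoping identity 1 = d^n + S_n (1 - d); the right-hand side is visibly positive,
     which bounds the partial sums by 1 / (1 - th). *)
  have -> : 1 - (1 - th)%:C *: S n = d ^+ n + \sum_(i < n) d ^+ i * (th%:O - d).
    rewrite -mulr_suml -/(S n).
    have e1 : 1 = d ^+ n + S n * (1 - d) by rewrite Sd addrC subrK.
    rewrite [X in X - _]e1.
    by op_expand; op_linear_identity.
  by apply: posD; [exact: posX|apply: pos_sum => i _; exact: posXB].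
have [s Ss] : exists s, scvg S s.
  by apply: (vigier hS _ ubS) => n; rewrite SS addrC addKr; exact: posX.
have d0 : scvg (fun n => d ^+ n) 0.
  have := scvgB (scvgS Ss) Ss; rewrite subrr.
  by congr scvg; apply/funext => n; rewrite SS addrC addKr.
have sd : s * (1 - d) = 1.
  apply: scvg_unique (scvgMr _ Ss) _.
  have := scvgB (scvg_cst 1) d0; rewrite subr0.
  by congr scvg; apply/funext => n; rewrite Sd.
have hs : star s = s by apply: scvg_herm Ss _.
have ps : pos s by apply: scvg_pos Ss _ => n; apply: pos_sum => i _; exact: posX.
pose r := k%:C *: s.
have ra : r * (1 + a) = 1 by rewrite /r -op_scalerAl op_scalerAr -d1.
have hr : star r = r by rewrite /r starZ hs.
have ar : (1 + a) * r = 1.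
  by rewrite -[LHS]starK starM hr starD star1 ha ra star1.
have pr : pos r by apply: posZ => //; exact: ltW.
exists r => _; split=> //.
  have -> : 1 - r = r * (a + a * a) * r.
    have -> : a + a * a = a * (1 + a) by rewrite mulrDr mulr1.
    rewrite -!mulrA ar mulr1 -{1}ra mulrDr mulr1 addrC addKr //.
  by apply: pos_sandwich => //; apply: posD => //; exact: pos_sqr.
move=> B y vB Ba By; rewrite /r -op_scalerAr; apply: memZ => //.
apply: (mem_scvg vB (a := fun n => y * S n)); last exact: scvgMl.
move=> n; rewrite /S mulr_sumr; apply: mem_sum => // i _.
elim: (i : nat) => [|m IH]; first by rewrite mulr1.
rewrite exprSr mulrA /d -op_scalerAr mulrBr -op_scalerAr mulr1.
by apply: memZ => //; apply: memB => //; [exact: memZ|exact: memM].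
Qed.

(* [(1 + a)^-1] for positive [a]; junk otherwise. *)
Definition res a : op := sval (cid (inverse_exists a)).

Section Resolvent.
Variable a : op.
Hypothesis pa : pos a.

Lemma res_pos : pos (res a).
Proof. by have [] := svalP (cid (inverse_exists a)) pa. Qed.

Lemma mul_res : (1 + a) * res a = 1.
Proof. by have [] := svalP (cid (inverse_exists a)) pa. Qed.

Lemma res_mul : res a * (1 + a) = 1.
Proof.
rewrite -[LHS]starK starM (pos_herm res_pos) starD star1 (pos_herm pa).
by rewrite mul_res star1.
Qed.

Lemma res_le1 : pos (1 - res a).
Proof. by have [] := svalP (cid (inverse_exists a)) pa. Qed.

Lemma mem_mul_res B y : von_neumann_algebra B -> B a -> B y -> B (y * res a).
Proof. by have [_ _ _] := svalP (cid (inverse_exists a)) pa; exact. Qed.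

Lemma mem_res B : von_neumann_algebra B -> B (1 : op) -> B a -> B (res a).
Proof. by move=> vB B1 Ba; rewrite -[res a]mul1r; exact: mem_mul_res. Qed.

Lemma res_unique x : (1 + a) * x = 1 -> x = res a.
Proof. by move=> h; rewrite -[x]mul1r -res_mul -mulrA h mulr1. Qed.

Lemma mul_resE : a * res a = 1 - res a.
Proof. by rewrite -{1}mul_res mulrDl mul1r addrC addKr. Qed.

Lemma res_comm x : x * a = a * x -> x * res a = res a * x.
Proof.
move=> xa; have h : x * (1 + a) = (1 + a) * x by rewrite mulrDr mulrDl mulr1 mul1r xa.
by rewrite -[LHS]mul1r -res_mul -!mulrA [(1 + a) * _]mulrA -h -mulrA mul_res mulr1.
Qed.

End Resolvent.

(** With x = res a and y = res b, x - y = (x - y)(1 + a)(x - y) + y (b - a) y, a sum of two positive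
    sandwiches. *)
Lemma res_antitone a b : pos a -> pos (b - a) -> pos (res a - res b).
Proof.
move=> pa pab; have pb : pos b by have := posD pa pab; rewrite addrC subrK.
have ha := pos_herm (res_pos pa); have hb := pos_herm (res_pos pb).
have -> : res a - res b =
    (res a - res b) * (1 + a) * (res a - res b) + res b * (b - a) * res b.
  have -> : b - a = (1 + b) - (1 + a) by rewrite opprD addrACA subrr add0r.
  have e1 : (res a - res b) * (1 + a) = 1 - res b * (1 + a).
    by rewrite mulrBl res_mul.
  have e2 : res b * ((1 + b) - (1 + a)) = 1 - res b * (1 + a).
    by rewrite mulrBr res_mul.
  by rewrite e1 e2 -mulrDr subrK mulrBl mul1r -mulrA mul_res // mulr1.
apply: posD; apply: pos_sandwich => //; first by rewrite starB ha hb.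
by apply: posD => //; exact: pos1.
Qed.

(** For t >= c the operator e = 1 - c / t lies between 0 and 1, and its powers decrease strongly to
    the projection onto the vectors fixed by e, that is, onto the kernel of c. *)
Lemma kernel_projection_exists c : exists k, pos c ->
  [/\ star k = k, c * k = 0, forall u, c u = 0 -> k u = u &
      forall B, von_neumann_algebra B -> B (1 : op) -> B c -> B k].
Proof.
have [pc|npc] := pselect (pos c); last by exists 0.
have [t t0 ht] := herm_le_scalar (pos_herm pc).
pose e : op := 1 - t^-1%:C *: c.
have ti0 : 0 <= t^-1 by rewrite invr_ge0 ltW.
have pe : pos e.
  have -> : e = t^-1%:C *: (t%:O - c).
    by rewrite /e scalerBr scalerA -rmorphM /= mulVf ?gt_eqF // scale1r.
  exact: posZ.
have p1e : pos (1%:O - e).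
  rewrite /e; have -> : 1%:O - (1 - t^-1%:C *: c) = t^-1%:C *: c by op_linear_identity.
  exact: posZ.
have he := pos_herm pe.
have dec n : pos (e ^+ n - e ^+ n.+1).
  have := posXB n ltr01 pe p1e; rewrite scale1r mulrBr mulr1 -exprSr; exact.
pose S n : op := 1 - e ^+ n.
have [s Ss] : exists s, scvg S s.
  apply: (@vigier _ _ 1 S) => n.
  - by rewrite /S starB star1 starX he.
  - by have -> : S n.+1 - S n = e ^+ n - e ^+ n.+1 by rewrite /S; op_linear_identity.
  - by rewrite /S scale1r opprB addrC subrK; exact: posX.
have ek : scvg (fun n => e ^+ n) (1 - s).
  have := scvgB (scvg_cst 1) Ss.
  by congr scvg; apply/funext => n; rewrite /S opprB addrC subrK.
exists (1 - s) => _; split.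
- by apply: scvg_herm ek _ => n; rewrite starX he.
- have h : e * (1 - s) = 1 - s.
    apply: scvg_unique (scvgMl e ek) _.
    have := scvgS ek; congr scvg; apply/funext => n; exact: exprS.
  have : (1 - e) * (1 - s) = 0 by rewrite mulrBl mul1r h subrr.
  have -> : 1 - e = t^-1%:C *: c by rewrite /e; op_linear_identity.
  rewrite -op_scalerAl => /(congr1 (fun x => t%:C *: x)).
  by rewrite scaler0 scalerA -rmorphM /= divff ?gt_eqF // scale1r.
- move=> u cu; apply: vcvg_unique (ek u) _.
  have -> : (fun n => (e ^+ n) u) = (fun=> u); last exact: vcvg_cst.
  apply/funext => n; elim: n => [|n IH] //.
  by rewrite exprSr opME /e opBE opZE cu scaler0 subr0.
- move=> B vB B1 Bc; apply: (mem_scvg vB _ ek) => n; apply: memX => //.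
  by apply: memB => //; exact: memZ.
Qed.

(* The projection onto the kernel of a positive [c]; junk otherwise. *)
Definition kerp c : op := sval (cid (kernel_projection_exists c)).

Section KernelProjection.
Variable c : op.
Hypothesis pc : pos c.

Lemma kerp_herm : star (kerp c) = kerp c.
Proof. by have [] := svalP (cid (kernel_projection_exists c)) pc. Qed.

Lemma mul_kerp : c * kerp c = 0.
Proof. by have [] := svalP (cid (kernel_projection_exists c)) pc. Qed.

Lemma kerp_fix u : c u = 0 -> kerp c u = u.
Proof. by have [_ _] := svalP (cid (kernel_projection_exists c)) pc; move=> + _; exact. Qed.

Lemma mem_kerp B : von_neumann_algebra B -> B (1 : op) -> B c -> B (kerp c).
Proof. by have [_ _ _] := svalP (cid (kernel_projection_exists c)) pc; exact. Qed.

Lemma kerp_mulE x : c * x = 0 -> kerp c * x = x.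
Proof.
move=> cx; apply: op_ext => u; rewrite opME; apply: kerp_fix.
by rewrite -opME cx.
Qed.

Lemma kerp_idem : kerp c * kerp c = kerp c.
Proof. by apply: kerp_mulE; exact: mul_kerp. Qed.

End KernelProjection.

End VonNeumann.

(** * Square roots and the polar part of a self-adjoint operator *)

Section SquareRoot.
Context {R : realType} {H : hilbert R}.
Local Notation op := (op H).
Local Notation "t %:O" := (t%:C *: (1 : op)).
Implicit Types (a b c d x y z : op) (B : set (H -> H)).

(** Polynomials in [x] with nonnegative coefficients. Unlike general positive operators they are
    closed under products, so the iterates below and their increments stay positive. *)
Inductive pos_cone x : op -> Prop :=
| pos_cone0 : pos_cone x 0
| pos_coneS (t : R) n z :
    0 <= t -> pos_cone x z -> pos_cone x (t%:C *: x ^+ n + z).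

Lemma pos_cone_pos x z : pos x -> pos_cone x z -> pos z.
Proof.
move=> px; elim=> [|t n z' t0 _ IH]; first exact: pos0.
by apply: posD => //; apply: posZ => //; exact: posX.
Qed.

Lemma pos_coneD x z z' : pos_cone x z -> pos_cone x z' -> pos_cone x (z + z').
Proof.
move=> hz hz'; elim: hz => [|t n w t0 _ IH]; first by rewrite add0r.
by rewrite -addrA; exact: pos_coneS.
Qed.

Lemma pos_coneM x z z' : pos_cone x z -> pos_cone x z' -> pos_cone x (z * z').
Proof.
move=> hz hz'; elim: hz => [|t n w t0 _ IH]; first by rewrite mul0r; exact: pos_cone0.
rewrite mulrDl; apply: pos_coneD => //.
elim: hz' => [|s m w' s0 _ IH']; first by rewrite mulr0; exact: pos_cone0.
rewrite mulrDr; apply: pos_coneD => //.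
rewrite -op_scalerAl -op_scalerAr scalerA -rmorphM -exprD -[X in pos_cone _ X]addr0.
by apply: pos_coneS; [exact: mulr_ge0|exact: pos_cone0].
Qed.

Lemma pos_coneZ x (t : R) z : 0 <= t -> pos_cone x z -> pos_cone x (t%:C *: z).
Proof.
move=> t0 hz; rewrite -[z]mul1r op_scalerAl; apply: pos_coneM => //.
rewrite -(expr0 x) -[X in pos_cone _ X]addr0.
by apply: pos_coneS => //; exact: pos_cone0.
Qed.

Lemma pos_contraction a u : pos a -> pos (1 - a) -> sq (a u) <= 1 * sq u.
Proof.
move=> pa p1; have := @pos_bound _ _ 1 a u ler01 pa; rewrite scale1r => /(_ p1).
by move=> /le_trans; apply; rewrite !mul1r; have [_ /(_ u)] := p1;
  rewrite opBE ipBl op1E subr_ge0.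
Qed.

(* The iteration [y := (x + y ^ 2) / 2] increases to [1 - sqrt (1 - x)]. *)
Lemma contraction_sqrt_exists x : pos x -> pos (1 - x) -> exists y,
  [/\ y = 2^-1%:C *: (x + y * y), pos (1 - y),
      forall z, z * x = x * z -> z * y = y * z &
      forall B, von_neumann_algebra B -> B x -> B y].
Proof.
move=> px p1x; pose y := fix y n : op :=
  if n is n'.+1 then 2^-1%:C *: (x + y n' * y n') else 0.
have h0 : 0 <= 2^-1 :> R by rewrite invr_ge0.
have cy n : pos_cone x (y n) /\ pos_cone x (y n.+1 - y n).
  elim: n => [|n [IH1 IH2]].
    have cx : pos_cone x (2^-1%:C *: (x ^+ 1 + 0)).
      apply: pos_coneZ => //; rewrite -(scale1r (x ^+ 1)) -(rmorph1 (real_complex R)).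
      by apply: pos_coneS => //; exact: pos_cone0.
    by split; [exact: pos_cone0|rewrite /= mulr0 subr0].
  have cyS : pos_cone x (y n.+1) by rewrite -[y n.+1](subrK (y n)); exact: pos_coneD.
  split=> //.
  have -> : y n.+2 - y n.+1 =
      2^-1%:C *: ((y n.+1 - y n) * y n.+1 + y n * (y n.+1 - y n)).
    change (2^-1%:C *: (x + y n.+1 * y n.+1) - 2^-1%:C *: (x + y n * y n) =
      2^-1%:C *: ((y n.+1 - y n) * y n.+1 + y n * (y n.+1 - y n))).
    by move: (y n.+1) (y n) => v w; op_expand; op_linear_identity.
  by apply: pos_coneZ => //; apply: pos_coneD; apply: pos_coneM.
have py n : pos (y n) by apply: pos_cone_pos px _; case: (cy n).
have p1y n : pos (1 - y n).
  elim: n => [|n IH]; first by rewrite subr0; exact: pos1.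
  have -> : 1 - y n.+1 = 2^-1%:C *: ((1 - x) + (1 - y n * y n)).
    by rewrite /=; op_linear_identity.
  by apply: posZ => //; apply: posD => //; exact: pos_le_pow1.
have [s ys] : exists s, scvg y s.
  apply: (@vigier _ _ 1 y) => n; first exact: pos_herm.
    by apply: pos_cone_pos px _; case: (cy n).
  by rewrite scale1r.
exists s; split.
- apply: scvg_unique (scvgS ys) _.
  apply: scvgZ; apply: scvgD; first exact: scvg_cst.
  by apply: (@scvgM _ _ 1) => // n u; exact: pos_contraction.
- by apply: scvg_pos (scvgB (scvg_cst 1) ys) _.
- move=> z zx; apply: scvg_unique (scvgMl z ys) _.
  have := scvgMr z ys; congr scvg; apply/funext => n.
  elim: n => [|n IH]; first by rewrite mulr0 mul0r.
  rewrite /= -op_scalerAl -op_scalerAr mulrDl mulrDr zx.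
  by rewrite -mulrA IH mulrA IH mulrA.
- move=> B vB Bx; apply: (mem_scvg vB _ ys); elim=> [|n IH]; first exact: mem0.
  by apply: memZ => //; apply: memD => //; exact: memM.
Qed.

(** Rescaling by t >= a reduces to x = 1 - a / t; the fixed-point equation of [y] says (1 - y)^2 = 1
    - x = a / t. *)
Lemma sqrt_exists a : exists s, pos a ->
  [/\ pos s, s * s = a, forall z, z * a = a * z -> z * s = s * z &
      forall B, von_neumann_algebra B -> B (1 : op) -> B a -> B s].
Proof.
have [pa|npa] := pselect (pos a); last by exists 0.
have [t t0 ht] := herm_le_scalar (pos_herm pa).
have ti0 : 0 <= t^-1 by rewrite invr_ge0 ltW.
pose x : op := 1 - t^-1%:C *: a.
have tx : x = t^-1%:C *: (t%:O - a).
  by rewrite scalerBr scalerA -rmorphM /= mulVf ?gt_eqF // scale1r.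
have px : pos x by rewrite tx; exact: posZ.
have p1x : pos (1 - x).
  by rewrite /x opprB addrC subrK; exact: posZ.
have [y [yE p1y commy memy]] := contraction_sqrt_exists px p1x.
exists ((Num.sqrt t)%:C *: (1 - y)) => _; split.
- by apply: posZ => //; exact: sqrtr_ge0.
- rewrite -op_scalerAl -op_scalerAr scalerA -rmorphM /= -expr2 sqr_sqrtr ?ltW //.
  have -> : (1 - y) * (1 - y) = 1 - x.
    have yy : y * y = 2%:C *: y - x.
      rewrite {3}yE scalerA -rmorphM /= divff ?pnatr_eq0 // scale1r.
      by rewrite addrC addKr.
    by op_expand; rewrite yy; op_linear_identity.
  rewrite /x opprB addrC subrK scalerA -rmorphM /= divff ?gt_eqF //.
  by rewrite scale1r.
- move=> z za; rewrite -op_scalerAl -op_scalerAr mulrBl mulrBr commy ?mul1r ?mulr1 //.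
  by rewrite /x mulrBl mulrBr mulr1 mul1r -op_scalerAl -op_scalerAr za.
- move=> B vB B1 Ba; apply: memZ => //; apply: memB => //; apply: memy => //.
  by apply: memB => //; exact: memZ.
Qed.

(* The positive square root of a positive operator; junk otherwise. *)
Definition sqrto a : op := sval (cid (sqrt_exists a)).

Section Sqrto.
Variable a : op.
Hypothesis pa : pos a.

Lemma sqrto_pos : pos (sqrto a).
Proof. by have [] := svalP (cid (sqrt_exists a)) pa. Qed.

Lemma sqrtoK : sqrto a * sqrto a = a.
Proof. by have [] := svalP (cid (sqrt_exists a)) pa. Qed.

Lemma sqrto_comm z : z * a = a * z -> z * sqrto a = sqrto a * z.
Proof. by have [_ _ h _] := svalP (cid (sqrt_exists a)) pa; exact: h. Qed.

Lemma mem_sqrto B : von_neumann_algebra B -> B (1 : op) -> B a -> B (sqrto a).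
Proof. by have [_ _ _] := svalP (cid (sqrt_exists a)) pa; exact. Qed.

End Sqrto.

Lemma star_mul_eq0 x : star x * x = 0 -> x = 0.
Proof.
move=> h; apply: op_ext => u; apply: sq_eq0.
by rewrite /sq star_ip -opME h op0E ip0r.
Qed.

Lemma herm_sqr_mul_eq0 c x : star c = c -> c * c * x = 0 -> c * x = 0.
Proof.
move=> hc h; apply: star_mul_eq0; rewrite starM hc -mulrA [c * (c * x)]mulrA h.
by rewrite mulr0.
Qed.

(** A self-adjoint c has the kernel of the positive operator c^2. If x commutes with c it preserves
    that kernel, so k x k = x k; taking adjoints yields commutation with k. *)
Lemma herm_kernel_projection c : star c = c ->
  let k := kerp (c * c) in
  [/\ star k = k, c * k = 0, k * k = k,
      forall x, c * x = 0 -> k * x = x &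
      forall x, star x = x -> x * c = c * x -> x * k = k * x].
Proof.
move=> hc k; have pcc := pos_sqr hc.
have hk : star k = k := kerp_herm pcc.
have ck : c * k = 0 by apply: herm_sqr_mul_eq0 => //; exact: mul_kerp.
have kE x : c * x = 0 -> k * x = x.
  by move=> cx; apply: kerp_mulE => //; rewrite -mulrA cx mulr0.
split=> //; first exact: kE.
move=> x hx xc.
have h : k * (x * k) = x * k by apply: kE; rewrite mulrA -xc -mulrA ck mulr0.
by have := congr1 star h; rewrite !starM hk hx -mulrA h.
Qed.

(* With [m = |b|], [s] is [1] on the kernel of [m - b] and [-1] on that of [m + b]. *)
Lemma polar_symmetry b (V : set (H -> H)) :
  von_neumann_algebra V -> V (1 : op) -> V b -> star b = b ->
  (forall x, V x -> b * x = 0 -> x = 0) ->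
  exists s : op, [/\ star s = s, s * s = 1,
    forall p q : op, V p -> V q -> b * p = q * b -> b * q = p * b -> s * p = q * s &
    forall B, von_neumann_algebra B -> B (1 : op) -> B b -> B s].
Proof.
move=> vV V1 Vb hb injb.
have pbb := pos_sqr hb.
pose m := sqrto (b * b).
have mm : m * m = b * b := sqrtoK pbb.
have hm : star m = m := pos_herm (sqrto_pos pbb).
have mb : m * b = b * m by apply/esym/sqrto_comm; rewrite // mulrA.
have memm B : von_neumann_algebra B -> B (1 : op) -> B b -> B m.
  by move=> vB B1 Bb; apply: mem_sqrto => //; exact: memM.
(* The cancellation laws for [b] and [m] apply to members of [V] only, so each operator cancelled
   below is first placed in [V]. *)
have injm x : V x -> m * x = 0 -> x = 0.
  move=> Vx mx; apply: (injb) => //; apply: (injb); first exact: memM.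
  by rewrite mulrA -mm -mulrA mx mulr0.
have hcm : star (m - b) = m - b by rewrite starB hm hb.
have hcp : star (m + b) = m + b by rewrite starD hm hb.
have [] := herm_kernel_projection hcm; set k := kerp _ => hk ck kk kE kC.
have [] := herm_kernel_projection hcp; set l := kerp _ => hl cl ll lE lC.
have memk B : von_neumann_algebra B -> B (1 : op) -> B b -> B k.
  move=> vB B1 Bb; apply: mem_kerp => //; first exact: pos_sqr.
  by apply: memM => //; apply: memB => //; exact: memm.
have meml B : von_neumann_algebra B -> B (1 : op) -> B b -> B l.
  move=> vB B1 Bb; apply: mem_kerp => //; first exact: pos_sqr.
  by apply: memM => //; apply: memD => //; exact: memm.
have mk : m * k = b * k by apply/eqP; rewrite -subr_eq0 -mulrBl ck.
have ml : m * l = - (b * l) by apply/eqP; rewrite -addr_eq0 -mulrDl cl.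
have lm : l * m = - (l * b).
  by have := congr1 star ml; rewrite starN !starM hl hm hb.
have mlC : m * l = l * m.
  by apply: lC => //; rewrite mulrDr mulrDl mb.
(* Where m = b and m = -b both apply, l m k equals its own negative; injectivity of m then gives l k
   = 0. *)
have lk : l * k = 0.
  have e1 : l * m * k = l * b * k by rewrite -!mulrA mk.
  have e2 : l * m * k = - (l * b * k) by rewrite lm mulNr.
  apply: (injm); first by apply: memM => //; [exact: meml|exact: memk].
  rewrite mulrA mlC.
  have /eqP : l * m * k + l * m * k = 0 by rewrite {1}e1 e2 subrr.
  rewrite -mulr2n -scaler_nat scaler_eq0 pnatr_eq0 => /eqP.
  by [].
have kl : k * l = 0 by have := congr1 star lk; rewrite starM star0 hk hl.
have cc : (m - b) * (m + b) = 0.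
  by rewrite mulrDr !mulrBl mm mb addrA subrK subrr.
have cc' : (m + b) * (m - b) = 0.
  by rewrite mulrBr !mulrDl mm mb opprD addrA addrK subrr.
(* The complement y of k + l annihilates both m + b and m - b, hence m. *)
have kl1 : k + l = 1.
  apply/esym/eqP; rewrite -subr_eq0; apply/eqP.
  set y := 1 - (k + l).
  have hy : star y = y by rewrite /y starB star1 starD hk hl.
  have lcp : l * (m + b) = 0 by rewrite -[LHS]starK starM hl hcp cl star0.
  have kcm : k * (m - b) = 0 by rewrite -[LHS]starK starM hk hcm ck star0.
  have ycp : y * (m + b) = 0.
    by rewrite /y mulrBl mul1r mulrDl (kE _ cc) lcp addr0 subrr.
  have ycm : y * (m - b) = 0.
    by rewrite /y mulrBl mul1r mulrDl (lE _ cc') kcm add0r subrr.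
  apply: (injm).
    by apply: memB => //; apply: memD => //; [exact: memk|exact: meml].
  have ym : y * m = 0.
    have /eqP : y * m + y * m = 0.
      have mm2 : m + m = (m + b) + (m - b) by rewrite addrACA subrr addr0.
      by rewrite -mulrDr mm2 mulrDr ycp ycm addr0.
    by rewrite -mulr2n -scaler_nat scaler_eq0 pnatr_eq0 => /eqP.
  by rewrite -[LHS]starK starM hy hm ym star0.
have ms : m * (k - l) = b by rewrite mulrBr mk ml opprK -mulrDr kl1 mulr1.
exists (k - l); split.
- by rewrite starB hk hl.
- by rewrite mulrBr !mulrBl kk ll kl lk subr0 sub0r opprK.
- move=> p q Vp Vq bp bq.
  (* The two intertwining relations make p commute with b^2, hence with its square root m; then m (s
     p - q s) = b p - q b = 0. *)
  have mp : m * p = p * m.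
    by apply/esym/sqrto_comm => //; rewrite mulrA -bq -!mulrA bp.
  have mq : m * q = q * m.
    by apply/esym/sqrto_comm => //; rewrite mulrA -bp -!mulrA bq.
  apply/eqP; rewrite -subr_eq0; apply/eqP; apply: (injm).
    have Vs : V (k - l) by apply: memB => //; [exact: memk|exact: meml].
    by apply: memB => //; exact: memM.
  by rewrite mulrBr !mulrA ms mq -mulrA ms bp subrr.
- by move=> B vB B1 Bb; apply: memB => //; [exact: memk|exact: meml].
Qed.

End SquareRoot.

(** * Projections and traces *)

Section Projections.
Context {R : realType} {H : hilbert R}.
Local Notation op := (op H).
Implicit Types (a b c e p q s x : op).

Definition proj p : Prop := star p = p /\ p * p = p.

Lemma proj_pos p : proj p -> pos p.
Proof. by move=> [hp pp]; rewrite -pp -{1}hp; exact: pos_star_mul. Qed.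

Lemma proj_zero : proj 0. Proof. by split; rewrite ?star0 ?mulr0. Qed.

Lemma proj_one : proj 1. Proof. by split; rewrite ?star1 ?mulr1. Qed.

(* [s * e = e] expresses [e <= s] for projections. *)
Lemma sub_projC e s : proj e -> proj s -> s * e = e -> e * s = e.
Proof. by move=> [he _] [hs _] se; have := congr1 star se; rewrite starM he hs. Qed.

Lemma projB e s : proj e -> proj s -> s * e = e -> proj (s - e).
Proof.
move=> pe ps se; have es := sub_projC pe ps se.
case: pe ps => [he ee] [hs ss]; split; first by rewrite starB hs he.
by rewrite mulrBr !mulrBl ss se es ee subrr subr0.
Qed.

Lemma projD e s : proj e -> proj s -> e * s = 0 -> proj (e + s).
Proof.
move=> [he ee] [hs ss] es; have se : s * e = 0.
  by have := congr1 star es; rewrite starM he hs star0.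
by split; rewrite ?starD ?he ?hs // mulrDr !mulrDl ee ss es se addr0 add0r.
Qed.

Lemma proj_pos_sub e s : proj e -> proj s -> s * e = e -> pos (s - e).
Proof. by move=> pe ps se; exact/proj_pos/projB. Qed.

(** Compressing e <= s by 1 - s gives (1 - s) e (1 - s) <= 0. *)
Lemma pos_sub_proj e s : proj e -> proj s -> pos (s - e) -> s * e = e.
Proof.
move=> [he ee] [hs ss] pse.
have p1s : pos (1 - s) by apply: proj_pos; split;
  rewrite ?starB ?star1 ?hs // mulrBr mulr1 mulrBl mul1r ss subrr subr0.
have h1s : star (1 - s) = 1 - s by case: p1s.
have z : (1 - s) * e * (1 - s) = 0.
  apply: pos_eq0; first by apply: pos_sandwich => //; exact: proj_pos.
  have ts : (1 - s) * s = 0 by rewrite mulrBl mul1r ss subrr.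
  by have := pos_sandwich h1s pse; rewrite [(1 - s) * (s - e)]mulrBr ts sub0r mulNr.
have : e * (1 - s) = 0.
  by apply: star_mul_eq0; rewrite starM he h1s mulrA -[_ * e * e]mulrA ee.
by move=> /(congr1 star); rewrite starM he h1s star0 mulrBl mul1r => /eqP;
  rewrite subr_eq0 => /eqP.
Qed.

Lemma proj_contraction p u : proj p -> sq (p u) <= 1 * sq u.
Proof.
move=> pp; apply: pos_contraction; first exact: proj_pos.
by apply: proj_pos_sub => //; [exact: proj_one|rewrite mul1r].
Qed.

Lemma pos_add_mul_eq0 a b x : pos a -> pos b -> (a + b) * x = 0 -> a * x = 0.
Proof.
move=> pa pb abx; apply: op_ext => u; rewrite opME; apply: pos_kernel => //.
have : ip ((a + b) (x u)) (x u) = 0 by rewrite -opME abx op0E ip0l.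
rewrite opDE ipDl => /eqP; rewrite paddr_eq0 ?(proj2 pa) ?(proj2 pb) //.
by case/andP => /eqP.
Qed.

(** The range projection of a positive operator; for projections e and e', the support of e + e'
    serves as their join. *)
Definition supp c : op := 1 - kerp c.

Section Support.
Variable c : op.
Hypothesis pc : pos c.

Lemma kerp_proj : proj (kerp c).
Proof. by split; [exact: kerp_herm|exact: kerp_idem]. Qed.

Lemma supp_proj : proj (supp c).
Proof. by apply: projB; [exact: kerp_proj|exact: proj_one|rewrite mul1r]. Qed.

Lemma supp_kill u : c u = 0 -> supp c u = 0.
Proof. by move=> cu; rewrite opBE op1E kerp_fix ?subrr. Qed.

Lemma supp_eq0 : supp c = 0 -> c = 0.
Proof.
move=> /eqP; rewrite subr_eq0 => /eqP k1.
by rewrite -[c]mulr1 k1 mul_kerp.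
Qed.

Lemma mem_supp B : von_neumann_algebra B -> B (1 : op) -> B c -> B (supp c).
Proof. by move=> vB B1 Bc; apply: memB => //; exact: mem_kerp. Qed.

End Support.

Lemma supp_addl a b : pos a -> pos b -> supp (a + b) * a = a.
Proof.
move=> pa pb; have pab := posD pa pb.
have ak : a * kerp (a + b) = 0 by apply: pos_add_mul_eq0 pa pb _; exact: mul_kerp.
have := congr1 star ak; rewrite starM star0 (kerp_herm pab) (pos_herm pa) => ka.
by rewrite /supp mulrBl mul1r ka subr0.
Qed.

Lemma scvg_proj (e : nat -> op) b : (forall n, proj (e n)) -> scvg e b -> proj b.
Proof.
move=> pe eb; split; first by apply: scvg_herm eb _ => n; case: (pe n).
apply: scvg_unique (scvgM (t := 1) _ eb eb) _.
  by move=> n u; exact: proj_contraction.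
by move: (eb); congr scvg; apply/funext => n; case: (pe n).
Qed.

Lemma proj_vigier (e : nat -> op) : (forall n, proj (e n)) ->
  (forall n, e n.+1 * e n = e n) -> exists b, [/\ scvg e b, proj b &
    forall n, b * e n = e n].
Proof.
move=> pe inc.
have [b eb] : exists b, scvg e b.
  apply: (@vigier _ _ 1 e) => n; first by case: (pe n).
    exact: proj_pos_sub.
  by rewrite scale1r; apply: proj_pos_sub => //; [exact: proj_one|rewrite mul1r].
have pb := scvg_proj pe eb; exists b; split=> // n.
apply: pos_sub_proj => //; apply: incr_le_lim eb _ => k; exact: proj_pos_sub.
Qed.

End Projections.

Lemma sup_seq (R : realType) (E : set R) (t : R) : E !=set0 -> ubound E t ->
  exists s, ubound E s /\ forall n : nat, exists2 x, E x & s - n.+1%:R^-1 < x.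
Proof.
move=> E0 Et; have hE : has_sup E by split=> //; exists t.
exists (sup E); split; first exact: sup_upper_bound.
by move=> n; apply: sup_adherent => //; rewrite invr_gt0.
Qed.

Lemma le_natSinv (R : realType) (x y : R) :
  (forall n : nat, x <= y + n.+1%:R^-1) -> x <= y.
Proof.
move=> h; apply/ler_addgt0Pr => e e0.
have [N _ hN] := near_infty_natSinv_lt (PosNum e0).
by apply: le_trans (h N) _; rewrite lerD2l ltW // (hN N (leqnn N)).
Qed.

(** * Consequences of a faithful normal trace *)

Section Trace.
Context {R : realType} {H : hilbert R}.
Local Notation op := (op H).
Implicit Types (a b c e p q s x : op).
Variables (M : set (H -> H)) (tau : (H -> H) -> R[i]).
Hypotheses (vM : von_neumann_algebra M) (M1 : M (1 : op)).
Hypothesis tM : faithful_normal_trace M tau.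

Definition trR a : R := complex.Re (tau a).

Lemma tauP (k : R[i]) a b : M a -> M b -> tau (k *: a + b) = k * tau a + tau b.
Proof. exact: (tr_linear tM). Qed.

Lemma tau0 : tau (0 : op) = 0.
Proof.
have := tauP 1 (mem0 vM) (mem0 vM); rewrite scale1r mul1r addr0 => h.
by apply: (addrI (tau (0 : op))); rewrite -h addr0.
Qed.

Lemma tauD a b : M a -> M b -> tau (a + b) = tau a + tau b.
Proof. by move=> Ma Mb; have := tauP 1 Ma Mb; rewrite scale1r mul1r. Qed.

Lemma tauZ (k : R[i]) a : M a -> tau (k *: a) = k * tau a.
Proof.
by move=> Ma; rewrite -[k *: a]addr0 tauP ?tau0 ?addr0 //; exact: mem0.
Qed.

Lemma tauN a : M a -> tau (- a) = - tau a.
Proof. by move=> Ma; rewrite -scaleN1r tauZ // mulN1r. Qed.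

Lemma tauB a b : M a -> M b -> tau (a - b) = tau a - tau b.
Proof. by move=> Ma Mb; rewrite tauD ?tauN //; exact: memN. Qed.

Lemma tauC a b : M a -> M b -> tau (a * b) = tau (b * a).
Proof. exact: (tr_mulC tM). Qed.

Lemma tau1 : tau (1 : op) = 1.
Proof. exact: (tr_id tM). Qed.

Lemma tau_pos a : M a -> pos a -> 0 <= tau a.
Proof.
move=> Ma pa; have := sqrto_pos pa; have := sqrtoK pa.
have Ms := mem_sqrto pa vM M1 Ma; move: (sqrto a) Ms => s Ms <- ps.
apply: (tr_ge0 tM (A := s)) => //.
by rewrite -{2}(pos_herm ps); exact: star_adjoint.
Qed.

Lemma tauE a : M a -> pos a -> tau a = (trR a)%:C.
Proof.
move=> Ma pa; have := tau_pos Ma pa; rewrite /trR.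
by case: (tau a) => x y; rewrite lecE /= => /andP[/eqP -> _].
Qed.

Lemma trR_ge0 a : M a -> pos a -> 0 <= trR a.
Proof. by move=> Ma pa; exact/Re_ge0/tau_pos. Qed.

Lemma tau_star_mul_eq0 a : M a -> tau (star a * a) = 0 -> a = 0.
Proof.
move=> Ma h; apply: opf_inj; apply: (tr_faithful tM Ma (@star_adjoint _ _ a)).
exact: h.
Qed.

Lemma trR_eq0 a : M a -> pos a -> trR a = 0 -> a = 0.
Proof.
move=> Ma pa a0; have Ms := mem_sqrto pa vM M1 Ma.
have : tau (star (sqrto a) * sqrto a) = 0.
  by rewrite (pos_herm (sqrto_pos pa)) sqrtoK // tauE // a0.
by move=> /(tau_star_mul_eq0 Ms) s0; rewrite -(sqrtoK pa) s0 mulr0.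
Qed.

Lemma trRD a b : M a -> M b -> trR (a + b) = trR a + trR b.
Proof. by move=> Ma Mb; rewrite /trR tauD // ReD. Qed.

Lemma trRB a b : M a -> M b -> trR (a - b) = trR a - trR b.
Proof. by move=> Ma Mb; rewrite /trR tauB // ReD ReN. Qed.

Lemma trR1 : trR 1 = 1.
Proof. by rewrite /trR tau1. Qed.

Lemma trR0 : trR 0 = 0.
Proof. by rewrite /trR tau0. Qed.

Lemma trR_sum (I : Type) (r : seq I) (P : pred I) (F : I -> op) :
  (forall i, P i -> M (F i)) ->
  trR (\sum_(i <- r | P i) F i) = \sum_(i <- r | P i) trR (F i).
Proof.
move=> MF; suff [] : M (\sum_(i <- r | P i) F i : op) /\
  trR (\sum_(i <- r | P i) F i) = \sum_(i <- r | P i) trR (F i) by [].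
elim/big_rec2: _ => [|i x y Pi [Mx <-]]; first by split; [exact: mem0|exact: trR0].
by split; [apply: memD => //; exact: MF|rewrite trRD //; exact: MF].
Qed.

Lemma trR_le a b : M a -> M b -> pos (b - a) -> trR a <= trR b.
Proof.
by move=> Ma Mb pab; rewrite -subr_ge0 -trRB //; apply: trR_ge0 => //; exact: memB.
Qed.

Lemma herm_inner_real a u : star a = a -> inner H (a u) u = (ip (a u) u)%:C.
Proof.
move=> ha; apply/eqP; rewrite eq_complex /= eqxx /=.
have : inner H (a u) u = (inner H (a u) u)^*.
  by rewrite -innerC star_adjoint ha.
case: (inner H (a u) u) => x y [/eqP]; rewrite -addr_eq0 -mulr2n mulrn_eq0 /=.
by [].
Qed.

Lemma pos_op_le a b : star a = a -> pos (b - a) -> op_le a b.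
Proof.
move=> ha [hba pba] u; have hb : star b = b.
  by move: hba; rewrite starB ha => /addIr.
rewrite !herm_inner_real // lecR -subr_ge0 -ipBl; exact: pba.
Qed.

Lemma trR_normal (a : nat -> op) b (t : R) : (forall n, M (a n)) ->
  (forall n, pos (a n)) -> (forall n, pos (a n.+1 - a n)) -> scvg a b ->
  (forall n, trR (a n) <= t) -> trR b <= t.
Proof.
move=> Ma pa inc ab tat; have Mb := mem_scvg vM Ma ab.
have pb := scvg_pos ab pa.
have mono m n : (m <= n)%N -> pos (a n - a m).
  move=> /subnK <-; elim: (n - m)%N => [|k IH]; first by rewrite subrr; exact: pos0.
  by apply: pos_le_trans IH _; rewrite addSn.
suff : tau b <= t%:C by rewrite tauE // lecR.
apply: (tr_normal tM (D := [set A : H -> H | exists n, A = opf (a n)])).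
- by move=> _ [n ->].
- move=> _ [n ->]; apply: (@pos_op_le 0); first exact: star0.
  by rewrite subr0.
- split; first by exists (a 0%N); exists 0%N.
  move=> _ _ [m ->] [n ->]; exists (a (maxn m n)); first by exists (maxn m n).
  by split; apply: pos_op_le; rewrite ?(pos_herm (pa _)) //; apply: mono;
    rewrite ?leq_maxl ?leq_maxr.
- split.
    split=> // _ [n ->]; apply: pos_op_le; first exact: pos_herm.
    exact: incr_le_lim.
  move=> B [MB ub] u; have [b' bE] := vna_op vM MB; rewrite -bE in ub *.
  have h n : inner H (a n u) u <= inner H (b' u) u by apply: ub; exists n.
  rewrite (herm_inner_real _ (pos_herm pb)).
  (* An upper bound in [M] is not assumed self-adjoint, but comparison in [R[i]] with a real number
     forces its form to be real. *)
  have : inner H (b' u) u = (ip (b' u) u)%:C.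
    have := h 0%N; rewrite (herm_inner_real _ (pos_herm (pa _))) /ip.
    by case: (inner H (b' u) u) => x y; rewrite lecE /= => /andP[/eqP -> _].
  move=> bE'; rewrite bE' lecR.
  apply: (cvg_le_cst (cvg_ip (ab u) (vcvg_cst u))) => n.
  by have := h n; rewrite bE' (herm_inner_real _ (pos_herm (pa _))) lecR.
- by move=> _ [n ->]; rewrite tauE // lecR.
Qed.

Lemma proj_trR_eq e s : M e -> M s -> proj e -> proj s -> s * e = e ->
  trR s <= trR e -> s = e.
Proof.
move=> Me Ms pe ps se ts; apply/eqP; rewrite -subr_eq0; apply/eqP.
have pse := proj_pos_sub pe ps se; have Mse := memB vM Ms Me.
apply: trR_eq0 => //; apply/eqP; rewrite eq_le trR_ge0 // andbT trRB //.
by rewrite subr_le0.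
Qed.

Lemma proj_trR_le e s : M e -> M s -> proj e -> proj s -> s * e = e ->
  trR e <= trR s.
Proof. by move=> Me Ms pe ps se; apply: trR_le => //; exact: proj_pos_sub. Qed.

Lemma proj_trR_le1 e : M e -> proj e -> trR e <= 1.
Proof.
by move=> Me pe; rewrite -trR1; apply: proj_trR_le => //; [exact: proj_one|rewrite mul1r].
Qed.

(* A maximal one is the supremum of a sequence whose traces approach the supremum. *)
Lemma maximal_killing_projection (F : nat -> H) : exists e,
  [/\ M e, proj e, forall i, e (F i) = 0 &
      forall e', M e' -> proj e' -> (forall i, e' (F i) = 0) -> e * e' = e'].
Proof.
pose K e := [/\ M e, proj e & forall i, e (F i) = 0].
have K0 : K 0 by split; [exact: mem0|exact: proj_zero|].
have [t [ubt tn]] : exists z : R, ubound [set trR e | e in K] z /\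
    forall n : nat, exists2 y : R, [set trR e | e in K] y & z - n.+1%:R^-1 < y.
  apply: (@sup_seq _ _ 1); first by exists (trR 0); exists 0.
  by move=> _ [e [Me pe _] <-]; exact: proj_trR_le1.
have {}tn (n : nat) : exists e, K e /\ t - n.+1%:R^-1 < trR e.
  by have [_ [e Ke <-] h] := tn n; exists e.
have [f fP] := choice tn.
have KS e e' : K e -> K e' -> K (supp (e + e')).
  move=> [Me pe eF] [Me' pe' e'F].
  have pee : pos (e + e') by apply: posD; exact: proj_pos.
  split; first by apply: mem_supp => //; exact: memD.
    exact: supp_proj.
  by move=> i; apply: supp_kill => //; rewrite opDE eF e'F addr0.
pose g := fix g n := if n is n'.+1 then supp (g n' + f n') else 0.
have Kg n : K (g n) by elim: n => [|n IH] //=; apply: KS => //; case: (fP n).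
have pg n : proj (g n) by case: (Kg n).
have [b [gb pb bg]] : exists b, [/\ scvg g b, proj b & forall n, b * g n = g n].
  apply: proj_vigier => // n /=; apply: supp_addl; first exact: proj_pos.
  by have [[_ pf _] _] := fP n; exact: proj_pos.
have Mb : M b by apply: (mem_scvg vM _ gb) => n; case: (Kg n).
have Kb : K b.
  split=> // i; apply: vcvg_unique (gb (F i)) _.
  rewrite (_ : (fun n => _) = (fun=> 0)); first exact: vcvg_cst.
  by apply/funext => n; case: (Kg n).
have tb : t <= trR b.
  apply: le_natSinv => n; have [[Mf pf _] /ltW h] := fP n.
  rewrite -lerBlDr; apply: le_trans h _.
  have [Mg pgS _] := Kg n.+1.
  apply: (@le_trans _ _ (trR (g n.+1))); last exact: proj_trR_le.
  apply: proj_trR_le => //=; rewrite addrC; apply: supp_addl; exact: proj_pos.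
exists b; case: (Kb) => _ _ bF; split=> // e' Me' pe' e'F.
have Ks : K (supp (b + e')) by exact: KS.
have sb : supp (b + e') = b.
  case: (Ks) => Ms ps _; apply: proj_trR_eq => //.
    by apply: supp_addl; exact: proj_pos.
  by apply: le_trans tb; apply: ubt; exists (supp (b + e')).
by rewrite -sb addrC; apply: supp_addl; exact: proj_pos.
Qed.

(* Minimize, over sequences [F], the trace of the largest projection killing [F]. *)
Lemma separating_sequence : exists F : nat -> H,
  forall a, M a -> (forall i, a (F i) = 0) -> a = 0.
Proof.
have [e eP] := choice maximal_killing_projection.
have [t [ubt tn]] : exists z : R, ubound [set - trR (e F) | F in setT] z /\
    forall n : nat, exists2 y : R, [set - trR (e F) | F in setT] y & z - n.+1%:R^-1 < y.
  apply: (@sup_seq _ _ 0); first by exists (- trR (e (fun=> 0))); exists (fun=> 0).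
  move=> _ [F _ <-]; have [Me pe _ _] := eP F; rewrite oppr_le0.
  by apply: trR_ge0 => //; exact: proj_pos.
have {}tn (n : nat) : exists F, t - n.+1%:R^-1 < - trR (e F).
  by have [_ [F _ <-] h] := tn n; exists F.
have [F hF] := choice tn.
(* All the sequences [F n] are merged into one, so [e G] lies below every [e (F n)] and its trace is
   minimal. *)
pose G (i : nat) : H := if unpickle i is Some (n, m) then F n m else 0.
have [MG pG eG _] := eP G.
have tG : trR (e G) <= - t.
  apply: le_natSinv => n; have [MF pF _ maxF] := eP (F n).
  have : trR (e G) <= trR (e (F n)).
    apply: proj_trR_le => //; apply: maxF => // m.
    by have := eG (pickle (n, m)); rewrite /G pickleK.
  move: (hF n); move: (n.+1%:R^-1) => y; lra.
have eG0 : e G = 0.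
  (* Prepending an arbitrary u to G can only shrink the largest killing projection, yet its trace is
     already minimal; so e G = e G' kills u. *)
  apply: op_ext => u; pose G' i := if i is i'.+1 then G i' else u.
  have [MG' pG' eG' _] := eP G'.
  have [_ _ _ maxG] := eP G.
  have sub : e G * e G' = e G' by apply: maxG => // i; exact: (eG' i.+1).
  rewrite (proj_trR_eq MG' MG pG' pG sub) ?(eG' 0%N) //.
  apply: le_trans tG _; have : - trR (e G') <= t by apply: ubt; exists G'.
  lra.
exists G => a Ma aG.
have pa := pos_star_mul a.
have Maa : M (star a * a) by apply: memM => //; exact: mem_star.
have [_ _ _ maxG] := eP G.
apply: star_mul_eq0; apply: supp_eq0 => //.
rewrite -(maxG (supp (star a * a))) ?eG0 ?mul0r //; first exact: mem_supp.
  exact: supp_proj.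
by move=> i; apply: supp_kill => //; rewrite opME aG linear0.
Qed.

End Trace.

(** * Subprojections of prescribed trace *)

Section Diffuse.
Context {R : realType} {H : hilbert R}.
Local Notation op := (op H).
Implicit Types (a b c e p q r s : op).

Lemma projectionP p : projection p <-> proj p.
Proof.
split=> [[pp ap]|[hp pp]].
  by split; [exact: adjoint_star|apply: opf_inj].
split; first by have := congr1 (@opf _ _) pp.
by rewrite -{2}hp; exact: star_adjoint.
Qed.

Variables (M : set (H -> H)) (tau : (H -> H) -> R[i]).
Hypotheses (vM : von_neumann_algebra M) (M1 : M (1 : op)).
Hypothesis tM : faithful_normal_trace M tau.
Hypothesis fM : type_II1_factor M.
Local Notation tr := (trR tau).

Lemma diffuse p : M p -> proj p -> p <> 0 ->
  exists q, [/\ M q, proj q, p * q = q, q <> 0 & q <> p].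
Proof.
move=> Mp pp p0.
have [|q [Mq pq qp q0 qnp]] := factor_diffuse fM Mp (proj2 (projectionP p) pp).
  by move=> h; apply: p0; exact: opf_inj.
have [q' qE] := vna_op vM Mq; rewrite -qE in Mq pq qp q0 qnp.
have pq' := proj1 (projectionP q') pq; exists q'; split=> //.
- have h : q' * p = q' by apply: opf_inj.
  by have := congr1 star h; rewrite starM (proj1 pp) (proj1 pq').
- by move=> h; apply: q0; rewrite h.
- by move=> h; apply: qnp; rewrite h.
Qed.

(** Of a proper nonzero subprojection r of q and its complement q - r, one has at most half the
    trace of q; iterate. *)
Lemma small_subprojection (t : R) p : M p -> proj p -> p <> 0 -> 0 < t ->
  exists q, [/\ M q, proj q, p * q = q, q <> 0 & tr q < t].
Proof.
move=> Mp pp p0 t0.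
have half (n : nat) : exists q,
    [/\ M q, proj q, p * q = q, q <> 0 & tr q <= tr p * 2^-1 ^+ n].
  elim: n => [|n [q [Mq pq qp q0 tq]]].
    by exists p; split=> //; [case: pp|rewrite expr0 mulr1].
  have [r [Mr pr rq r0 rnq]] := diffuse Mq pq q0.
  have pqr := projB pr pq rq; have Mqr := memB vM Mq Mr.
  have pr' : p * r = r by rewrite -rq mulrA qp.
  have tqr : tr (q - r) = tr q - tr r by rewrite (trRB vM tM).
  have e : tr p * 2^-1 ^+ n.+1 = (tr p * 2^-1 ^+ n) / 2 by rewrite exprSr mulrA.
  have [h|h] := leP (tr r) (tr q / 2).
    by exists r; split=> //; rewrite e; lra.
  exists (q - r); split=> //.
  - by rewrite mulrBr qp pr'.
  - by move=> /eqP; rewrite subr_eq0 => /eqP h'; exact: rnq.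
  - by rewrite e tqr; lra.
have : (fun n => tr p * 2^-1 ^+ n) @ \oo --> tr p * 0.
  apply: cvgM; first exact: cvg_cst.
  by apply: cvg_expr; rewrite ger0_norm ?invr_ge0 // invf_lt1 // ltr1n.
rewrite mulr0 => /cvgrPdist_lt /(_ t t0) [N _ hN].
have [q [Mq pq qp q0 tq]] := half N; exists q; split=> //.
apply: le_lt_trans tq _; have := hN N (leqnn N).
by rewrite /= sub0r normrN; apply: le_lt_trans; exact: ler_norm.
Qed.

(* Greedy exhaustion: each step gains at least half of what is possible. *)
Lemma subprojection_of_trace (t : R) p : M p -> proj p -> 0 <= t <= tr p ->
  exists q, [/\ M q, proj q, p * q = q & tr q = t].
Proof.
move=> Mp pp /andP[t0 tp].
pose G q := [/\ M q, proj q, p * q = q & tr q <= t].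
have G0 : G 0 by split; [exact: mem0|exact: proj_zero|rewrite mulr0|rewrite (trR0 vM tM)].
have step q : exists q', G q -> [/\ G q', q' * q = q & forall r,
    M r -> proj r -> (p - q) * r = r -> tr q + tr r <= t ->
    tr r <= (tr q' - tr q) *+ 2].
  have [Gq|nGq] := pselect (G q); last by exists 0.
  have [Mq pq qp tq] := Gq.
  pose A r := [/\ M r, proj r, (p - q) * r = r & tr q + tr r <= t].
  have A0 : A 0.
    by split; [exact: mem0|exact: proj_zero|rewrite mulr0|rewrite (trR0 vM tM) addr0].
  have [S [ubS nS]] : exists z : R, ubound [set tr r | r in A] z /\
      forall n : nat, exists2 y : R, [set tr r | r in A] y & z - n.+1%:R^-1 < y.
    apply: (@sup_seq _ _ 1); first by exists (tr 0); exists 0.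
    by move=> _ [r [Mr pr _ _] <-]; exact: (proj_trR_le1 vM M1 tM).
  have good r : A r -> G (q + r) /\ (q + r) * q = q.
    move=> [Mr pr pqr tr_]; have qr : q * r = 0.
      by case: pq => _ qq; rewrite -pqr mulrA mulrBr (sub_projC _ _ qp) ?qq ?subrr ?mul0r //;
        split=> //; case: (Gq) => _ [].
    have rq : r * q = 0.
      by have := congr1 star qr; rewrite starM star0 (proj1 pr) (proj1 pq).
    have pr' : p * r = r by rewrite -[RHS]pqr mulrBl qr subr0.
    split; last by case: pq => _ qq; rewrite mulrDl qq rq addr0.
    split; [exact: memD|exact: projD|by rewrite mulrDr qp pr'|].
    by rewrite (trRD tM).
  have [S0|Sp] := leP S 0.
    exists q => _; split=> //; first by case: pq.
    move=> r Mr pr h1 h2; rewrite subrr mul0rn.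
    by apply: le_trans S0; apply: ubS; exists r.
  (* This precision makes the trace of the chosen r exceed S / 2, so that no competitor has more
     than twice the trace gained. *)
  have [n hn] : exists n : nat, n.+1%:R^-1 < S / 2.
    have S2 : 0 < S / 2 by rewrite divr_gt0.
    have [N _ hN] := near_infty_natSinv_lt (PosNum S2).
    by exists N; exact: (hN N (leqnn N)).
  have [_ [r Ar <-] hr] := nS n.
  have [Gr hr'] := good r Ar.
  exists (q + r) => _; split=> // r' Mr' pr' h1 h2.
  have : tr r' <= S by apply: ubS; exists r'.
  have [Mr _ _ _] := Ar; rewrite (trRD tM) // addrAC subrr add0r.
  move: hr hn; move: (n.+1%:R^-1) => y; lra.
have [nx nxP] := choice step.
pose Q n := iter n nx 0.
have GQ n : G (Q n) by elim: n => [|n IH] //=; have [] := nxP _ IH.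
have incQ n : Q n.+1 * Q n = Q n by have [] := nxP _ (GQ n).
have pQ n : proj (Q n) by case: (GQ n).
have MQ n : M (Q n) by case: (GQ n).
have [b [Qb pb bQ]] := proj_vigier pQ incQ.
have Mb := mem_scvg vM MQ Qb.
have pb' : p * b = b.
  apply: scvg_unique (scvgMl p Qb) _; move: (Qb); congr scvg.
  by apply/funext => n; case: (GQ n).
have tb : tr b <= t.
  apply: (trR_normal vM M1 tM MQ _ _ Qb) => n; first exact: proj_pos.
    exact: proj_pos_sub.
  by case: (GQ n).
exists b; split=> //; apply/eqP; rewrite eq_le tb /= leNgt; apply/negP => bt.
have pb0 : p - b <> 0.
  by move=> /eqP; rewrite subr_eq0 => /eqP h; move: tp; rewrite h leNgt bt.
(* If the limit b misses the trace t, a fixed nonzero r under p - b fits at every stage. Each step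
   then gains at least half its trace, which is eventually incompatible with the bound t. *)
have [|r [Mr pr rpb r0 rt]] :=
  small_subprojection (memB vM Mp Mb) (projB pb pp pb') pb0 (_ : 0 < t - tr b).
  by rewrite subr_gt0.
have tr_gt0 : 0 < tr r.
  rewrite lt_def (trR_ge0 vM M1 tM) //; last exact: proj_pos.
  by rewrite andbT; apply/eqP => h; apply: r0; apply: (trR_eq0 vM M1 tM) => //; exact: proj_pos.
have br : b * r = 0.
  by rewrite -rpb mulrA mulrBr (sub_projC pb pp pb') (proj2 pb) subrr mul0r.
have prr : p * r = r by rewrite -[RHS]rpb mulrBl br subr0.
have gain n : tr r *+ n <= tr (Q n) *+ 2.
  elim: n => [|n IH]; first by rewrite mulr0n mulrn_wge0 // (trR_ge0 vM M1 tM) // ; exact: proj_pos.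
  have [_ _ h] := nxP _ (GQ n).
  have Qr : Q n * r = 0.
    by rewrite -(sub_projC (pQ n) pb (bQ n)) -mulrA br mulr0.
  have hQ : tr (Q n) <= tr b by apply: (proj_trR_le vM M1 tM).
  have := h r Mr pr; rewrite mulrBl Qr subr0 => /(_ prr).
  rewrite mulrSr -[nx (Q n)]/(Q n.+1) => h'.
  have {}h' := h' (ltac:(lra) : tr (Q n) + tr r <= t).
  lra.
have tr0 : 0 <= t *+ 2 / tr r by rewrite divr_ge0 ?mulrn_wge0 // ltW.
have := archi_boundP tr0; move: (Num.bound _) => n.
rewrite ltr_pdivrMr // mulr_natl => hn.
have := gain n; have [_ _ _ tQ] := GQ n; lra.
Qed.

End Diffuse.

(** * Refining and matching partitions *)

Section Partitions.
Context {R : realType} {H : hilbert R}.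
Local Notation op := (op H).
Implicit Types (p q : op).

Lemma pos_sum_eq0 (I : finType) (P : pred I) (F : I -> op) i :
  (forall j, P j -> pos (F j)) -> \sum_(j | P j) F j = 0 -> P i -> F i = 0.
Proof.
move=> pF F0 Pi; apply: pos_eq0; first exact: pF.
move: F0; rewrite (bigD1 i) //= => /eqP; rewrite addrC addr_eq0 => /eqP <-.
by apply: pos_sum => j /andP[Pj _]; exact: pF.
Qed.

(** Compressing 1 - F_j by F_j gives 0, and this is a sum of the positive operators F_j F_k F_j over
    k != j. Orthogonality is thus recovered from the sum alone and need not be carried through
    refinements. *)
Lemma proj_sum1_orthogonal (I : finType) (F : I -> op) i j :
  (forall k, proj (F k)) -> \sum_k F k = 1 -> i != j -> F i * F j = 0.
Proof.
move=> pF F1 ij.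
have hF k : star (F k) = F k by case: (pF k).
have FF k : F k * F k = F k by case: (pF k).
have S0 : \sum_(k | k != j) F j * F k * F j = 0.
  rewrite -mulr_suml -mulr_sumr.
  have -> : \sum_(k | k != j) F k = 1 - F j.
    by rewrite -F1 [in RHS](bigD1 j) //= addrAC subrr add0r.
  by rewrite mulrBr mulr1 FF subrr mul0r.
have z : F j * F i * F j = 0.
  apply: (pos_sum_eq0 (P := fun k => k != j) (F := fun k => F j * F k * F j)) ij => //.
  by move=> k _; apply: pos_sandwich => //; exact: proj_pos.
by apply: star_mul_eq0; rewrite starM !hF mulrA -[F j * F i * F i]mulrA FF.
Qed.

Variables (M : set (H -> H)) (tau : (H -> H) -> R[i]).
Hypotheses (vM : von_neumann_algebra M) (M1 : M (1 : op)).
Hypothesis tM : faithful_normal_trace M tau.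
Hypothesis fM : type_II1_factor M.
Local Notation tr := (trR tau).

Lemma proj_list_tr0 (s : seq op) : (forall p, p \in s -> M p /\ proj p) ->
  \sum_(p <- s) tr p = 0 -> \sum_(p <- s) p = 0.
Proof.
elim: s => [|p s IH] hs; first by rewrite !big_nil.
have [Mp pp] := hs p (mem_head _ _).
have hs' q : q \in s -> M q /\ proj q.
  by move=> qs; apply: hs; rewrite inE qs orbT.
rewrite !big_cons => /eqP; rewrite paddr_eq0; last first.
- by rewrite big_seq sumr_ge0 // => q /hs'[Mq pq]; apply: (trR_ge0 vM M1 tM) => //; exact: proj_pos.
- by apply: (trR_ge0 vM M1 tM) => //; exact: proj_pos.
move=> /andP[/eqP p0 /eqP /(IH hs') ->]; rewrite addr0.
by apply: (trR_eq0 vM M1 tM) => //; exact: proj_pos.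
Qed.

Lemma split_projection (e : R) p : 0 < e -> M p -> proj p ->
  exists s : seq op, (forall q, q \in s -> [/\ M q, proj q, p * q = q & tr q <= e])
    /\ \sum_(q <- s) q = p.
Proof.
move=> e0; have [n hn] : exists n : nat, tr p <= e *+ n.
  have [h|h] := leP (tr p) 0; first by exists 0%N; rewrite mulr0n.
  have := archi_boundP (divr_ge0 (ltW h) (ltW e0)); move: (Num.bound _) => n.
  by rewrite ltr_pdivrMr // mulr_natl => /ltW; exists n.
elim: n p hn => [|n IH] p hn Mp pp.
  exists [::]; split=> //; rewrite big_nil; apply/esym.
  apply: (trR_eq0 vM M1 tM) => //; first exact: proj_pos.
  by apply/eqP; rewrite eq_le hn (trR_ge0 vM M1 tM) //; exact: proj_pos.
have [h|h] := leP (tr p) e.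
  exists [:: p]; split; last by rewrite big_seq1.
  by move=> q; rewrite inE => /eqP ->; split=> //; case: pp.
have [|q [Mq pq pqq tq]] := @subprojection_of_trace _ _ M tau vM M1 tM fM e p Mp pp.
  by rewrite !ltW.
have [|||s [hs ss]] := IH (p - q).
- by rewrite (trRB vM tM) // tq; move: hn; rewrite mulrS; lra.
- exact: memB.
- exact: projB.
exists (q :: s); split; last by rewrite big_cons ss addrC subrK.
move=> r; rewrite inE => /predU1P[->|/hs[Mr pr rE tr_]]; first by rewrite tq.
by split=> //; rewrite -[in LHS]rE mulrA mulrBr pqq (proj2 pp).
Qed.

Lemma refine_small (e : R) (s : seq op) : 0 < e ->
  (forall p, p \in s -> M p /\ proj p) ->
  exists s' : seq op, (forall q, q \in s' -> [/\ M q, proj q, tr q <= e &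
      exists2 p, p \in s & p * q = q])
    /\ \sum_(q <- s') q = \sum_(p <- s) p.
Proof.
move=> e0; elim: s => [|p s IH] hs; first by exists [::]; rewrite !big_nil.
have [Mp pp] := hs p (mem_head _ _).
have [q qs|s1 [h1 e1]] := IH; first by apply: hs; rewrite inE qs orbT.
have [s2 [h2 e2]] := split_projection e0 Mp pp.
exists (s2 ++ s1); split; last by rewrite big_cat big_cons e1 e2.
move=> q; rewrite mem_cat => /orP[/h2[? ? ? ?]|/h1[? ? ? [p' p's ?]]].
  by split=> //; exists p; rewrite ?mem_head.
by split=> //; exists p' => //; rewrite inE p's orbT.
Qed.

End Partitions.

Section Matching.
Context {R : realType} {H K : hilbert R}.
Variables (M : set (H -> H)) (tau : (H -> H) -> R[i]).
Variables (N : set (K -> K)) (sigma : (K -> K) -> R[i]).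
Hypotheses (vM : von_neumann_algebra M) (M1 : M (1 : op H)).
Hypotheses (vN : von_neumann_algebra N) (N1 : N (1 : op K)).
Hypotheses (tM : faithful_normal_trace M tau) (tN : faithful_normal_trace N sigma).
Hypotheses (fM : type_II1_factor M) (fN : type_II1_factor N).

Implicit Types (n : nat) (ps : seq (op H)) (qs : seq (op K)) (p : op H) (q : op K).

Definition matched (ps : seq (op H)) (qs : seq (op K)) (x : op H * op K) : Prop :=
  [/\ M x.1 /\ proj x.1, N x.2 /\ proj x.2, trR tau x.1 = trR sigma x.2,
      exists2 p, p \in ps & p * x.1 = x.1 & exists2 q, q \in qs & q * x.2 = x.2].

(** Compare the two heads, cut from the one of larger trace a piece of the smaller trace, and put
    the remainder back: one list loses an entry at each step. When a list runs out, the other has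
    total trace 0, so its sum is 0 by faithfulness. *)
Lemma match_projections n ps qs : (size ps + size qs <= n)%N ->
  (forall p, p \in ps -> M p /\ proj p) -> (forall q, q \in qs -> N q /\ proj q) ->
  \sum_(p <- ps) trR tau p = \sum_(q <- qs) trR sigma q ->
  exists s : seq (op H * op K), [/\ forall x, x \in s -> matched ps qs x,
    \sum_(x <- s) x.1 = \sum_(p <- ps) p & \sum_(x <- s) x.2 = \sum_(q <- qs) q].
Proof.
elim: n ps qs => [|n IH] [|p ps] [|q qs] //= hn hps hqs e.
- by exists [::]; rewrite !big_nil.
- by exists [::]; rewrite !big_nil.
- exists [::]; rewrite !big_nil; split=> //; apply/esym.
  by apply: (proj_list_tr0 vN N1 tN) => //; rewrite -e big_nil.
- exists [::]; rewrite !big_nil; split=> //; apply/esym.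
  by apply: (proj_list_tr0 vM M1 tM) => //; rewrite e big_nil.
have [Mp pp] := hps p (mem_head _ _); have [Nq pq] := hqs q (mem_head _ _).
have tp0 : 0 <= trR tau p by apply: (trR_ge0 vM M1 tM) => //; exact: proj_pos.
have tq0 : 0 <= trR sigma q by apply: (trR_ge0 vN N1 tN) => //; exact: proj_pos.
have hps' r : r \in ps -> M r /\ proj r by move=> h; apply: hps; rewrite inE h orbT.
have hqs' r : r \in qs -> N r /\ proj r by move=> h; apply: hqs; rewrite inE h orbT.
move: e; rewrite !big_cons => e.
have [h|/ltW h] := leP (trR tau p) (trR sigma q).
  have [|q1 [Nq1 pq1 qq1 tq1]] :=
    @subprojection_of_trace _ _ N sigma vN N1 tN fN (trR tau p) q Nq pq.
    by rewrite tp0.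
  have [||||s [hs s1 s2]] := IH ps (q - q1 :: qs).
  - by move: hn; rewrite /= addSn.
  - by [].
  - move=> r; rewrite inE => /predU1P[->|]; last exact: hqs'.
    by split; [exact: memB|exact: projB].
  - by rewrite big_cons (trRB vN tN) // tq1; move: e; lra.
  exists ((p, q1) :: s); rewrite !big_cons s1 s2 big_cons; split=> //; last first.
    by rewrite addrA [q1 + _]addrC subrK.
  move=> x; rewrite inE => /predU1P[->|/hs[? ? ? [p' ? ?] [q' hq' q'x]]].
    split=> //=; first by exists p; rewrite ?mem_head //; case: pp.
    by exists q; rewrite ?mem_head.
  split=> //; first by exists p' => //; rewrite inE; apply/orP; right.
  move: hq'; rewrite inE => /predU1P[q'E|hq']; last by exists q' => //; rewrite inE hq' orbT.
  exists q; first exact: mem_head.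
  by rewrite -[in LHS]q'x q'E mulrA mulrBr qq1 (proj2 pq) -q'E.
have [|p1 [Mp1 pp1 pp1E tp1]] :=
  @subprojection_of_trace _ _ M tau vM M1 tM fM (trR sigma q) p Mp pp.
  by rewrite tq0.
have [||||s [hs s1 s2]] := IH (p - p1 :: ps) qs.
- by move: hn; rewrite /= addnS.
- move=> r; rewrite inE => /predU1P[->|]; last exact: hps'.
  by split; [exact: memB|exact: projB].
- by [].
- by rewrite big_cons (trRB vM tM) // tp1; move: e; lra.
exists ((p1, q) :: s); rewrite !big_cons s1 s2 big_cons; split=> //; last first.
  by rewrite addrA [p1 + _]addrC subrK.
move=> x; rewrite inE => /predU1P[->|/hs[? ? ? [p' hp' p'x] [q' ? ?]]].
  split=> //=; first by exists p; rewrite ?mem_head.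
  by exists q; rewrite ?mem_head //; case: pq.
split=> //; last by exists q' => //; rewrite inE; apply/orP; right.
move: hp'; rewrite inE => /predU1P[p'E|hp']; last by exists p' => //; rewrite inE hp' orbT.
exists p; first exact: mem_head.
by rewrite -[in LHS]p'x p'E mulrA mulrBr pp1E (proj2 pp) -p'E.
Qed.

Lemma common_refinement (e : R) ps qs : 0 < e ->
  (forall p, p \in ps -> M p /\ proj p) -> (forall q, q \in qs -> N q /\ proj q) ->
  \sum_(p <- ps) p = 1 -> \sum_(q <- qs) q = 1 ->
  exists s : seq (op H * op K), [/\
    forall x, x \in s -> [/\ matched ps qs x, x.1 <> 0, x.2 <> 0 & trR tau x.1 <= e],
    \sum_(x <- s) x.1 = 1 & \sum_(x <- s) x.2 = 1].
Proof.
move=> e0 hps hqs p1 q1.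
(* Making one side fine is enough, since every matched pair has equal traces and lies below a piece
   of [ps']. *)
have [ps' [hps' ep]] := refine_small vM M1 tM fM e0 hps.
have hps1 p : p \in ps' -> M p /\ proj p by case/hps'.
have [|s [hs s1 s2]] := match_projections (leqnn _) hps1 hqs.
  transitivity (1 : R).
    rewrite -(trR1 tM) -p1 -ep big_seq [in RHS]big_seq (trR_sum vM tM) // => p.
    by case/hps1.
  by rewrite -(trR1 tN) -q1 [in RHS]big_seq big_seq (trR_sum vN tN) // => q /hqs[].
have z x : x \in s -> (x.1 = 0 <-> x.2 = 0).
  move=> /hs[[M1x p1x] [N2x p2x] t12 _ _]; split=> h.
    apply: (trR_eq0 vN N1 tN) => //; first exact: proj_pos.
    by rewrite -t12 h (trR0 vM tM).
  apply: (trR_eq0 vM M1 tM) => //; first exact: proj_pos.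
  by rewrite t12 h (trR0 vN tN).
(* Null pairs are dropped: distinct indices must give distinct projections once the family is turned
   into a set. *)
exists [seq x <- s | x.1 != 0]; split.
- move=> x; rewrite mem_filter => /andP[/eqP x0 xs].
  have [h1 h2 h3 [p ps'p pE] h5] := hs x xs.
  have [Mp pp tp [p' p's p'E]] := hps' p ps'p.
  split=> //; last 1 first.
  + apply: le_trans tp; case: h1 => ? ?.
    exact: (proj_trR_le vM M1 tM).
  + split=> //; exists p' => //.
    by rewrite -[in LHS]pE mulrA p'E.
  + by move=> /(proj2 (z x xs)).
- rewrite big_filter big_mkcond -p1 -ep -s1 /=.
  by apply: eq_bigr => x _; case: eqP => [->|].
- rewrite big_filter big_mkcond -q1 -s2 /= big_seq [in RHS]big_seq.
  apply: eq_bigr => x xs; case: eqP => // x0.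
  by rewrite (proj1 (z x xs) x0).
Qed.

End Matching.

(** * Free projections *)

Section FreeProjections.
Context {R : realType} {H : hilbert R}.
Local Notation op := (op H).
Local Notation "t %:O" := (t%:C *: (1 : op)).
Implicit Types (a b p q r x : op).
Variables (L : set (H -> H)) (tau : (H -> H) -> R[i]).
Hypotheses (vL : von_neumann_algebra L) (L1 : L (1 : op)).
Hypothesis tL : faithful_normal_trace L tau.
Local Notation tr := (trR tau).

Fixpoint alternating_word (x : bool -> op) (b : bool) n : seq (bool * (H -> H)) :=
  if n is n'.+1 then (b, opf (x b)) :: alternating_word x (~~ b) n' else [::].

Fixpoint alternating_prod (x : bool -> op) (b : bool) n : op :=
  if n is n'.+1 then x b * alternating_prod x (~~ b) n' else 1.

Lemma alternating_prodE (x : bool -> op) (b : bool) n :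
  foldr (fun s T => s.2 \o T) id (alternating_word x b n) = alternating_prod x b n.
Proof. by elim: n b => [|n IH] b //=; rewrite IH. Qed.

Lemma alternating_prod_double (x : bool -> op) (b : bool) n :
  alternating_prod x b n.*2 = (x b * x (~~ b)) ^+ n.
Proof.
elim: n => [|n IH]; first by rewrite expr0.
by rewrite doubleS exprS -IH /= negbK mulrA.
Qed.

Lemma tr_alternating_prod (A : bool -> set (H -> H)) (x : bool -> op) (b : bool) n :
  Defs.free A tau -> (forall c, A c (x c) /\ tau (x c) = 0) ->
  tr (alternating_prod x b n.+1) = 0.
Proof.
move=> fA hx; rewrite /trR -alternating_prodE fA //.
  rewrite /=; elim: n b => [|n IH] b //=.
  by rewrite IH; case: b.
move=> s; elim: n.+1 b => [|m IH] b //=.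
by rewrite inE => /predU1P[->|/IH].
Qed.

Lemma trRZ (t : R) a : L a -> tr (t%:C *: a) = t * tr a.
Proof. by move=> La; rewrite /trR (tauZ vL tL) // ReM_real. Qed.

Lemma mem_scalar (t : R) : L (t%:O : op).
Proof. exact: memZ. Qed.

Section Bessel.
Variables (A : bool -> set (H -> H)) (p r : op).
Hypotheses (vA : forall c, von_neumann_algebra (A c)) (A1 : forall c, A c (1 : op)).
Hypothesis AL : forall c, A c `<=` L.
Hypothesis fA : Defs.free A tau.
Hypotheses (Ap : A true p) (Ar : A false r) (pp : proj p) (pr : proj r).
Hypothesis tpr : tr p + tr r = 1.

Let c := tr p.
Let d := tr r.
(** As c + d = 1, this is the squared 2-norm of both centred projections P and Q. *)
Let s := c * d.
Let P : op := p - c%:O.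
Let Q : op := r - d%:O.

Let dE : d = 1 - c. Proof. by rewrite -tpr addrC addKr. Qed.

Let Lp : L p. Proof. exact: AL Ap. Qed.
Let Lr : L r. Proof. exact: AL Ar. Qed.
Let LP : L P. Proof. by apply: memB => //; exact: mem_scalar. Qed.
Let LQ : L Q. Proof. by apply: memB => //; exact: mem_scalar. Qed.

Let PP : P * P = (1 - c *+ 2)%:C *: P + s%:O.
Proof.
rewrite /P /s dE mulrBl !mulrBr -!op_scalerAr -!op_scalerAl !mulr1 !mul1r (proj2 pp).
by op_linear_identity.
Qed.

Let QQ : Q * Q = (1 - d *+ 2)%:C *: Q + s%:O.
Proof.
have cE : c = 1 - d by rewrite dE subKr.
rewrite /Q /s cE mulrBl !mulrBr -!op_scalerAr -!op_scalerAl !mulr1 !mul1r (proj2 pr).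
by op_linear_identity.
Qed.

Let X (b : bool) := if b then P else Q.

Let X0 (b : bool) : A b (X b) /\ tau (X b) = 0.
Proof.
have h a : L a -> pos a -> tau (a - (tr a)%:O) = 0.
  move=> La pa; rewrite (tauB vL tL) //; last exact: mem_scalar.
  by rewrite (tauZ vL tL) // (tau1 tL) mulr1 (tauE vL L1 tL) // subrr.
case: b; split; try by apply: h => //; exact: proj_pos.
  by apply: (memB (vA true)) => //; apply: (memZ (vA true)); exact: (A1 true).
by apply: (memB (vA false)) => //; apply: (memZ (vA false)); exact: (A1 false).
Qed.

Let trPQ n : tr ((P * Q) ^+ n.+1) = 0.
Proof.
by rewrite -(alternating_prod_double X true) doubleS; apply: tr_alternating_prod fA X0.
Qed.

Let trQP n : tr ((Q * P) ^+ n.+1) = 0.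
Proof.
by rewrite -(alternating_prod_double X false) doubleS; apply: tr_alternating_prod fA X0.
Qed.

Let trQPQ n : tr (Q * (P * Q) ^+ n) = 0.
Proof.
rewrite -(alternating_prod_double X true) -[Q]/(X (~~ true)).
exact: (@tr_alternating_prod A X false n.*2 fA X0).
Qed.

Let w n : op := (P * Q) ^+ n.
Let w' n : op := (Q * P) ^+ n.

Let hP : star P = P. Proof. by rewrite /P starB starZ star1 (proj1 pp). Qed.
Let hQ : star Q = Q. Proof. by rewrite /Q starB starZ star1 (proj1 pr). Qed.

Let star_w n : star (w n) = w' n.
Proof. by rewrite /w starX starM hP hQ. Qed.

Let Lw n : L (w n). Proof. by apply: memX => //; exact: memM. Qed.
Let Lw' n : L (w' n). Proof. by apply: memX => //; exact: memM. Qed.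

Let w'Q n : w' n * Q = Q * w n.
Proof.
elim: n => [|n IH]; first by rewrite mul1r mulr1.
by rewrite /w' exprSr !mulrA -/(w' n) IH /w [in RHS]exprSr !mulrA.
Qed.

(** Reducing the inner P P and then the inner Q Q leaves two alternating words Q (P Q)^k, which have
    trace 0 by freeness, and s^2 times the shorter product. *)
Let gram_step m n : tr (w' m.+1 * w n.+1) = s ^+ 2 * tr (w' m * w n).
Proof.
have e1 : w' m * Q * P * Q * w n = Q * w (m + n).+1.
  by rewrite w'Q -!mulrA /w -addnS exprD exprS !mulrA.
have e2 : w' m * Q * w n = Q * w (m + n).
  by rewrite w'Q -mulrA /w exprD.
have -> : w' m.+1 * w n.+1 = (1 - c *+ 2)%:C *: (Q * w (m + n).+1)
    + (s * (1 - d *+ 2))%:C *: (Q * w (m + n)) + (s ^+ 2)%:C *: (w' m * w n).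
  have -> : w' m.+1 * w n.+1 = w' m * Q * (P * P) * (Q * w n).
    by rewrite /w' /w exprSr exprS !mulrA.
  rewrite PP mulrDr mulrDl -!op_scalerAr -!op_scalerAl mulr1.
  have -> : w' m * Q * P * (Q * w n) = w' m * Q * P * Q * w n by rewrite !mulrA.
  rewrite e1.
  have -> : w' m * Q * (Q * w n) = w' m * (Q * Q) * w n by rewrite !mulrA.
  rewrite QQ mulrDr mulrDl -!op_scalerAr -!op_scalerAl mulr1 e2.
  by move: (Q * _) (Q * _) (w' m * w n) => x y z; op_linear_identity.
have LQw k : L (Q * w k) by exact: memM.
have Lww : L (w' m * w n) by exact: memM.
rewrite !(trRD tL) ?trRZ //; try by [apply: memZ|apply: memD => //; apply: memZ].
by rewrite !trQPQ !mulr0 !add0r.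
Qed.

Let gram m n : tr (w' m * w n) = if m == n then s ^+ n * s ^+ n else 0.
Proof.
elim: m n => [|m IH] [|n].
- by rewrite mulr1 mulr1 (trR1 tL).
- by rewrite mul1r trPQ.
- by rewrite mulr1 trQP.
- by rewrite gram_step IH eqSS; case: eqP; rewrite ?mulr0 // !exprS => _; ring.
Qed.

(* Bessel's inequality: [x x^*] has the same coefficient along each of the infinitely
   many orthonormal words [s ^- n *: (P Q) ^+ n]. *)
Lemma free_projections_meet0 x : L x -> p * x = x -> r * x = x -> x = 0.
Proof.
move=> Lx px rx.
have [c0|cn0] := eqVneq c 0.
  have p0 : p = 0 by apply: (trR_eq0 vL L1 tL) => //; exact: proj_pos.
  by rewrite -px p0 mul0r.
have [d0|dn0] := eqVneq d 0.
  have r0 : r = 0 by apply: (trR_eq0 vL L1 tL) => //; exact: proj_pos.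
  by rewrite -rx r0 mul0r.
have sn0 : s != 0 by rewrite mulf_neq0.
pose Y : op := x * star x.
have LY : L Y by apply: memM => //; exact: mem_star.
have hY : star Y = Y by rewrite /Y starM starK.
have pY : p * Y = Y by rewrite /Y mulrA px.
have rY : r * Y = Y by rewrite /Y mulrA rx.
have PY : P * Y = d%:C *: Y.
  by rewrite /P dE mulrBl pY -op_scalerAl mul1r; op_linear_identity.
have QY : Q * Y = c%:C *: Y.
  have cE : c = 1 - d by rewrite dE subKr.
  by rewrite /Q cE mulrBl rY -op_scalerAl mul1r; op_linear_identity.
have wY n : w n * Y = (s ^+ n)%:C *: Y.
  elim: n => [|n IH]; first by rewrite mul1r expr0 scale1r.
  rewrite /w exprSr -!mulrA QY -op_scalerAr PY scalerA -op_scalerAr -/(w n) IH.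
  by rewrite scalerA -!rmorphM /= exprS.
have w'Y n : w' n * Y = (s ^+ n)%:C *: Y.
  elim: n => [|n IH]; first by rewrite mul1r expr0 scale1r.
  rewrite /w' exprSr -!mulrA PY -op_scalerAr QY scalerA -op_scalerAr -/(w' n) IH.
  by rewrite scalerA -!rmorphM /= exprS [d * c]mulrC.
pose t := tr Y.
pose v n : op := \sum_(i < n) (s ^- i)%:C *: w i.
pose v' n : op := \sum_(i < n) (s ^- i)%:C *: w' i.
have star_v n : star (v n) = v' n.
  by rewrite /v star_sum; apply: eq_bigr => i _; rewrite starZ star_w.
have Lv n : L (v n) by apply: mem_sum => // i _; exact: memZ.
have Lv' n : L (v' n) by apply: mem_sum => // i _; exact: memZ.
have vY n : tr (v n * Y) = n%:R * t.
  rewrite /v mulr_suml (trR_sum vL tL) => [|i _]; last first.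
    by apply: memM => //; exact: memZ.
  rewrite (eq_bigr (fun=> t)) ?sumr_const ?card_ord ?mulr_natl // => i _.
  rewrite -op_scalerAl wY scalerA -rmorphM /= mulVf ?expf_neq0 //.
  by rewrite scale1r.
have v'Y n : tr (v' n * Y) = n%:R * t.
  rewrite /v' mulr_suml (trR_sum vL tL) => [|i _]; last first.
    by apply: memM => //; exact: memZ.
  rewrite (eq_bigr (fun=> t)) ?sumr_const ?card_ord ?mulr_natl // => i _.
  rewrite -op_scalerAl w'Y scalerA -rmorphM /= mulVf ?expf_neq0 //.
  by rewrite scale1r.
have vv n : tr (v' n * v n) = n%:R.
  have wv k m : tr (w' k * v m) = \sum_(i < m) (s ^- i) * (if k == i then s ^+ i * s ^+ i else 0).
    rewrite /v mulr_sumr (trR_sum vL tL) => [|i _]; last by apply: memM => //; exact: memZ.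
    apply: eq_bigr => i _; rewrite -op_scalerAr trRZ ?gram //; exact: memM.
  rewrite {1}/v' mulr_suml (trR_sum vL tL) => [|i _]; last first.
    by apply: memM => //; exact: memZ.
  rewrite (eq_bigr (fun=> 1)) ?sumr_const ?card_ord // => i _.
  rewrite -op_scalerAl trRZ; last exact: memM.
  rewrite wv (bigD1 i) //= eqxx big1 ?addr0 => [|j /negbTE ji]; last first.
    by rewrite -[(i : nat) == j]/(i == j) eq_sym ji mulr0.
  by rewrite mulrA mulrACA !mulVf ?expf_neq0 ?mulr1.
(* Expand the nonnegative trace of |Y - t v_n|^2, using that v_n has squared 2-norm n and inner
   product n t with Y. Letting n grow forces t = 0. *)
have bessel n : n%:R * t ^+ 2 <= tr (Y * Y).
  have := @trR_ge0 _ _ _ _ vL L1 tL (star (Y - t%:C *: v n) * (Y - t%:C *: v n)).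
  have LYv : L (Y - t%:C *: v n) by apply: memB => //; exact: memZ.
  move=> /(_ (memM vL (mem_star vL LYv) LYv) (pos_star_mul _)).
  have -> : star (Y - t%:C *: v n) * (Y - t%:C *: v n) =
     (Y * Y + (t ^+ 2)%:C *: (v' n * v n)) - t%:C *: (Y * v n + v' n * Y).
    rewrite starB starZ hY star_v; op_expand.
    by op_linear_identity.
  have M1' : L (Y * Y) by exact: memM.
  have M2' : L (v' n * v n) by exact: memM.
  have M3' : L (Y * v n) by exact: memM.
  have M4' : L (v' n * Y) by exact: memM.
  rewrite (trRB vL tL) ?(trRD tL) ?trRZ ?(trRD tL) //; try by
    [apply: memZ|apply: memD => //; apply: memZ|apply: memZ => //; apply: memD|apply: memD].
  rewrite vv v'Y /trR (tauC tL) // -/(trR tau (v n * Y)) vY -/(trR tau _).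
  lra.
have t0 : t = 0.
  apply/eqP/negPn/negP => tn0.
  have t2 : 0 < t ^+ 2 by rewrite lt_def sqrf_eq0 tn0 sqr_ge0.
  have YY0 : 0 <= tr (Y * Y) / t ^+ 2.
    apply: le_trans (_ : 0 <= 0%:R) _ => //.
    by rewrite ler_pdivlMr // (le_trans _ (bessel 0%N)) // mul0r.
  have := archi_boundP YY0; move: (Num.bound _) => n.
  by rewrite ltr_pdivrMr // ltNge bessel.
have Y0 : Y = 0.
  by apply: (trR_eq0 vL L1 tL) => //; rewrite /Y -{1}[x]starK; exact: pos_star_mul.
by rewrite -[x]starK (@star_mul_eq0 _ _ (star x)) ?star0 // starK.
Qed.

End Bessel.

(** If (p + q - 1) x = 0 then p x = (1 - q) x, an operator fixed by the free projections p and 1 -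
    q, whose traces add up to 1; hence p x = 0. Exchanging roles, q x = 0. *)
Lemma free_projections_injective (A : bool -> set (H -> H)) p q :
  (forall c, von_neumann_algebra (A c)) -> (forall c, A c (1 : op)) ->
  (forall c, A c `<=` L) -> Defs.free A tau -> A true p -> A false q ->
  proj p -> proj q -> tr p = tr q ->
  forall x, L x -> (p + q - 1) * x = 0 -> x = 0.
Proof.
move=> vA A1 AL fA Ap Aq pp pq tpq x Lx bx.
have Lp := AL _ _ Ap; have Lq := AL _ _ Aq.
have compl a : proj a -> proj (1 - a).
  by move=> pa; apply: projB => //; [exact: proj_one|rewrite mul1r].
have trC a : L a -> tr (1 - a) = 1 - tr a by move=> La; rewrite (trRB vL tL) // (trR1 tL).
have pqx : p * x + q * x = x.
  by apply/eqP; rewrite -subr_eq0 -mulrDl -[X in _ - X]mul1r -mulrBl bx.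
have z1 : p * x = 0.
  apply: (free_projections_meet0 vA A1 AL fA (p := p) (r := 1 - q)) => //.
  - exact: (memB (vA false)).
  - exact: compl.
  - by rewrite trC // tpq addrC subrK.
  - exact: memM.
  - by rewrite mulrA (proj2 pp).
  - have -> : p * x = (1 - q) * x by apply/eqP; rewrite mulrBl mul1r eq_sym subr_eq pqx.
    by rewrite mulrA (proj2 (compl _ pq)).
have z2 : q * x = 0.
  apply: (free_projections_meet0 vA A1 AL fA (p := 1 - p) (r := q)) => //.
  - exact: (memB (vA true)).
  - exact: compl.
  - by rewrite trC // tpq subrK.
  - exact: memM.
  - have -> : q * x = (1 - p) * x by apply/eqP; rewrite mulrBl mul1r eq_sym subr_eq addrC pqx.
    by rewrite mulrA (proj2 (compl _ pp)).
  - by rewrite mulrA (proj2 pq).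
by rewrite -pqx z1 z2 addr0.
Qed.

End FreeProjections.

(** * Normality of isomorphisms *)

Section HermitianApproximation.
Context {R : realType} {H : hilbert R}.
Local Notation op := (op H).
Implicit Types (a b c s t : op) (A : set (H -> H)).

Lemma cvg_sum_seq (T : eqType) (r : seq T) (f : nat -> T -> R) (l : T -> R) :
  (forall v, v \in r -> f n v @[n --> \oo] --> l v) ->
  (\sum_(v <- r) f n v) @[n --> \oo] --> \sum_(v <- r) l v.
Proof.
elim: r => [|v r IH] h.
  by rewrite big_nil; under eq_fun do rewrite big_nil; exact: cvg_cst.
rewrite big_cons; under eq_fun do rewrite big_cons.
apply: cvgD; first by apply: h; exact: mem_head.
by apply: IH => w wr; apply: h; rewrite inE wr orbT.
Qed.

Lemma natSinv_cvg0 : (n.+1%:R^-1 : R) @[n --> \oo] --> (0 : R).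
Proof. exact: cvg_harmonic. Qed.

Lemma closure_seq A (T : H -> H) (r : seq H) : closure (A : set {ptws H -> H}) T ->
  exists c : nat -> (H -> H), (forall n, A (c n)) /\
    forall v, v \in r -> vcvg (fun n => c n v) (T v).
Proof.
move=> cT.
have h (n : nat) : exists C : H -> H, A C /\ forall v, v \in r -> sq (C v - T v) < n.+1%:R^-1.
  by have [|C AC hC] := @closure_approx _ _ A T r n.+1%:R^-1 cT; [rewrite invr_gt0|exists C].
have [c cP] := choice h; exists c; split=> [n|v vr]; first by case: (cP n).
apply: cvg0_le natSinv_cvg0 => n; rewrite sq_ge0 /= ltW //.
by have [_] := cP n; exact.
Qed.

Variable A : set (H -> H).
Hypothesis A0 : A (0 : op).
Hypothesis Aop : forall B, A B -> exists b : op, opf b = B.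
Hypothesis AD : forall a b, A a -> A b -> A (a + b).
Hypothesis AZ : forall (k : R) a, A a -> A (k%:C *: a).
Hypothesis Astar : forall a, A a -> A (star a).

(* Taking adjoints is not strongly continuous, only weakly: minimize
   [sum_(v <- r) |a v - s v|^2] over self-adjoint [a]; the minimizing sequence
   converges on [r], the error is orthogonal to every [a v], hence vanishes. *)
Lemma herm_closure_seq t (r : seq H) :
  (forall r' : seq H, exists c : nat -> (H -> H), (forall n, A (c n)) /\
    forall v, v \in r' -> vcvg (fun n => c n v) (t v)) ->
  exists a : nat -> op, (forall n, A (a n) /\ star (a n) = a n) /\
    forall v, v \in r -> vcvg (fun n => a n v) ((2^-1%:C *: (t + star t)) v).
Proof.
move=> ct; have [s sE] : exists s, s = 2^-1%:C *: (t + star t) by eexists.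
rewrite -sE.
pose J a : R := \sum_(v <- r) sq (a v - s v).
pose Ah a := A a /\ star a = a.
have Ah0 : Ah 0 by split; rewrite ?star0.
have AhD a b : Ah a -> Ah b -> Ah (a + b).
  by move=> [? ha] [? hb]; split; [exact: AD|rewrite starD ha hb].
have AhZ (k : R) a : Ah a -> Ah (k%:C *: a).
  by move=> [? ha]; split; [exact: AZ|rewrite starZ ha].
have J0 a : 0 <= J a by apply: sumr_ge0 => v _; exact: sq_ge0.
have [d [ubd nd]] : exists z : R, ubound [set - J a | a in Ah] z /\
    forall n : nat, exists2 y : R, [set - J a | a in Ah] y & z - n.+1%:R^-1 < y.
  apply: (@sup_seq _ _ 0); first by exists (- J 0); exists 0.
  by move=> _ [a _ <-]; rewrite oppr_le0.
have {}ubd a : Ah a -> - d <= J a.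
  by move=> ha; rewrite lerNl; apply: ubd; exists a.
have {}nd (n : nat) : exists a, Ah a /\ J a < - d + n.+1%:R^-1.
  have [_ [a ha <-] h] := nd n; exists a; split=> //.
  by move: h; rewrite ltrNr opprB addrC.
have [a aP] := choice nd.
have Aa n : Ah (a n) by case: (aP n).
exists a; split; first exact: Aa.
(* The midpoint of two self-adjoint candidates is a candidate, so the parallelogram law makes the
   minimizing sequence Cauchy on each vector of r. *)
have parallelogram (x y z : H) : sq (x - y) =
    sq (x - z) *+ 2 + sq (y - z) *+ 2 - sq (2^-1%:C *: (x + y) - z) *+ 4.
  by rewrite /sq !(ipBl, ipBr, ipDl, ipDr, ipZl, ipZr) (ipC y x) (ipC z x) (ipC z y); field.
have cauchy m n : \sum_(v <- r) sq (a m v - a n v) <= (m.+1%:R^-1 + n.+1%:R^-1) *+ 2.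
  have mid : Ah (2^-1%:C *: (a m + a n)) by apply/AhZ/AhD.
  have par : \sum_(v <- r) sq (a m v - a n v) =
      J (a m) *+ 2 + J (a n) *+ 2 - J (2^-1%:C *: (a m + a n)) *+ 4.
    rewrite /J -!sumrMnl -big_split -sumrB /=; apply: eq_bigr => v _.
    exact: parallelogram.
  have := ubd _ mid; have [_] := aP m; have [_] := aP n; rewrite par.
  move: (m.+1%:R^-1) (n.+1%:R^-1) => x y; lra.
have lim v : exists z, v \in r -> vcvg (fun n => a n v) z.
  have [vr|vr] := boolP (v \in r); last by exists 0.
  suff [z hz] : exists z, vcvg (fun n => a n v) z by exists z.
  apply: vcvg_complete => e e0.
  have e4 : 0 < e / 4 by rewrite divr_gt0.
  have [N _ hN] := near_infty_natSinv_lt (PosNum e4).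
  exists N => m n /hN /= hm /hN /= hn.
  apply: le_lt_trans (_ : _ <= (m.+1%:R^-1 + n.+1%:R^-1) *+ 2) _; last first.
    by move: hm hn; move: (m.+1%:R^-1) (n.+1%:R^-1) => x y; lra.
  apply: le_trans (cauchy m n).
  rewrite (big_rem v vr) /= lerDl; apply: sumr_ge0 => w _; exact: sq_ge0.
have [z zP] := choice lim.
pose h v := s v - z v.
have ortho b : Ah b -> \sum_(v <- r) ip (b v) (h v) = 0.
  move=> hb; pose q := \sum_(v <- r) sq (b v).
  have q0 : 0 <= q by apply: sumr_ge0 => v _; exact: sq_ge0.
  have expand (k : R) (x y w : H) : sq (x + k%:C *: y - w) =
      sq (x - w) + (k ^+ 2 * sq y + k * ip y (x - w) *+ 2).
    by rewrite /sq !(ipBl, ipBr, ipDl, ipDr, ipZl, ipZr) (ipC y x) (ipC w x) (ipC w y); ring.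
  have quad (k : R) : 0 <= q * k ^+ 2 + (- \sum_(v <- r) ip (b v) (h v)) *+ 2 * k + 0.
    have lower n : - n.+1%:R^-1 <=
        \sum_(v <- r) (k ^+ 2 * sq (b v) + k * ip (b v) (a n v - s v) *+ 2).
      have := ubd _ (AhD _ _ (Aa n) (AhZ k _ hb)); have [_] := aP n.
      have -> : J (a n + k%:C *: b) = J (a n) +
          \sum_(v <- r) (k ^+ 2 * sq (b v) + k * ip (b v) (a n v - s v) *+ 2).
        rewrite /J -big_split; apply: eq_bigr => v _.
        exact: expand.
      by move: (n.+1%:R^-1) (\sum_(v <- r) _) => x y; lra.
    have -> : q * k ^+ 2 + (- \sum_(v <- r) ip (b v) (h v)) *+ 2 * k + 0 =
        \sum_(v <- r) (k ^+ 2 * sq (b v) + k * ip (b v) (z v - s v) *+ 2).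
      rewrite big_split /= -!mulr_sumr -/q.
      have -> : \sum_(v <- r) k * ip (b v) (z v - s v) *+ 2 =
          - (k *+ 2 * \sum_(v <- r) ip (b v) (h v)).
        rewrite mulr_sumr -sumrN; apply: eq_bigr => v _.
        by rewrite /h !ipBr; ring.
      by ring.
    have c1 : (\sum_(v <- r) (k ^+ 2 * sq (b v) + k * ip (b v) (a n v - s v) *+ 2))
        @[n --> \oo] --> \sum_(v <- r) (k ^+ 2 * sq (b v) + k * ip (b v) (z v - s v) *+ 2).
      apply: cvg_sum_seq => v vr; apply: cvgD; first exact: cvg_cst.
      apply: cvgMn; apply: cvgM; first exact: cvg_cst.
      apply: cvg_ip; first exact: vcvg_cst.
      by apply: vcvgB; [exact: zP|exact: vcvg_cst].
    move: c1 lower; set F := fun n => \sum_(v <- r) _; move=> c1 lower.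
    have c2 : (F n + n.+1%:R^-1) @[n --> \oo] --> \sum_(v <- r)
        (k ^+ 2 * sq (b v) + k * ip (b v) (z v - s v) *+ 2) + 0.
      by apply: cvgD => //; exact: natSinv_cvg0.
    rewrite addr0 in c2; apply: (cvg_ge_cst c2) => n.
    by have := lower n; rewrite -subr_ge0 opprK.
  have := real_quad_disc q0 quad; rewrite mulr0 sqrrN => h2.
  by apply/eqP; rewrite -sqrf_eq0 eq_le h2 sqr_ge0.
have hs0 : \sum_(v <- r) ip (s v) (h v) = 0.
  (* The adjoints of the approximants are handled through <c^* v, h v> = <v, c (h v)>, which
     requires convergence on the error vectors as well; hence the hypothesis over all lists. *)
  have [c [Ac cP]] := ct (r ++ map h r).
  have [c' c'P] := choice (fun n => Aop (Ac n)).
  have Ac' n : A (c' n) by rewrite c'P.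
  have c't v : v \in r ++ map h r -> vcvg (fun n => c' n v) (t v).
    by move=> /cP; congr vcvg; apply/funext => n; rewrite c'P.
  have zero n : \sum_(v <- r) (ip (c' n v) (h v) + ip v (c' n (h v))) = 0.
    have hc : Ah (c' n + star (c' n)).
      by split; [apply: AD => //; exact: Astar|rewrite starD starK addrC].
    rewrite -[RHS](ortho _ hc); apply: eq_bigr => v _.
    by rewrite opDE ipDl; congr (_ + _); rewrite star_ip starK.
  have c1 : (\sum_(v <- r) (ip (c' n v) (h v) + ip v (c' n (h v)))) @[n --> \oo]
      --> \sum_(v <- r) (ip (t v) (h v) + ip v (t (h v))).
    apply: cvg_sum_seq => v vr; apply: cvgD; apply: cvg_ip; try exact: vcvg_cst.
      by apply: c't; rewrite mem_cat vr.
    by apply: c't; rewrite mem_cat map_f ?orbT.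
  have t0 : \sum_(v <- r) (ip (t v) (h v) + ip v (t (h v))) = 0.
    apply: (cvg_unique (@Rhausdorff R) c1).
    by rewrite (funext zero); exact: cvg_cst.
  transitivity (2^-1 * \sum_(v <- r) (ip (t v) (h v) + ip v (t (h v)))).
  2: by rewrite t0 mulr0.
  rewrite mulr_sumr; apply: eq_bigr => v _.
  by rewrite sE opZE opDE ipZl ipDl [ip (star t v) _]star_ip starK.
have zh0 : \sum_(v <- r) ip (z v) (h v) = 0.
  have c1 : (\sum_(v <- r) ip (a n v) (h v)) @[n --> \oo] --> \sum_(v <- r) ip (z v) (h v).
    by apply: cvg_sum_seq => v vr; apply: cvg_ip; [exact: zP|exact: vcvg_cst].
  apply: (cvg_unique (@Rhausdorff R) c1).
  by rewrite (funext (fun n => ortho _ (Aa n))); exact: cvg_cst.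
have hh0 : \sum_(v <- r) sq (h v) = 0.
  transitivity (\sum_(v <- r) ip (s v) (h v) - \sum_(v <- r) ip (z v) (h v)).
  2: by rewrite hs0 zh0 subrr.
  rewrite -sumrB; by apply: eq_bigr => v _; rewrite /sq {1}/h ipBl.
move=> v vr; have := zP v vr; suff -> : z v = s v by [].
apply/esym/eqP; rewrite -subr_eq0 -/(h v); apply/eqP/sq_eq0.
have /eqP := hh0; rewrite psumr_eq0 => [/allP/(_ v vr)/= /eqP //|w _]; exact: sq_ge0.
Qed.

End HermitianApproximation.

(** Purely algebraic data between operators; the continuity it entails is the subject of
    [iso_normal]. *)
Record star_iso (R : realType) (H K : hilbert R) (M : set (H -> H))
    (M0 : set (K -> K)) (f : op H -> op K) : Prop := {
  iso_dom : von_neumann_algebra M /\ M (1 : op H);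
  iso_cod : von_neumann_algebra M0;
  iso_mem : forall a : op H, M a -> M0 (f a);
  iso_add : forall a b : op H, M a -> M b -> f (a + b) = f a + f b;
  iso_scale : forall (k : R[i]) (a : op H), M a -> f (k *: a) = k *: f a;
  iso_mulr : forall a b : op H, M a -> M b -> f (a * b) = f a * f b;
  iso_star : forall a : op H, M a -> f (star a) = star (f a);
  iso_one : f 1 = 1;
  iso_inj : forall a b : op H, M a -> M b -> f a = f b -> a = b;
  iso_surj : forall b : op K, M0 b -> exists2 a : op H, M a & f a = b }.

Section Iso.
Context {R : realType} {H K : hilbert R}.
Local Notation "t %:O" := (t%:C *: (1 : op H)).
Variables (M : set (H -> H)) (M0 : set (K -> K)) (f : op H -> op K).
Hypothesis fP : star_iso M M0 f.

Let vM : von_neumann_algebra M. Proof. by case: (iso_dom fP). Qed.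
Let M1 : M (1 : op H). Proof. by case: (iso_dom fP). Qed.
Let vM0 : von_neumann_algebra M0. Proof. exact: iso_cod fP. Qed.
Let fM (a : op H) : M a -> M0 (f a). Proof. move=> Ma; exact: (iso_mem fP Ma). Qed.

Let M01 : M0 (1 : op K). Proof. by rewrite -(iso_one fP); exact: fM. Qed.

Lemma iso0 : f 0 = 0.
Proof. by rewrite -(scale0r (1 : op H)) (iso_scale fP) // scale0r. Qed.

Lemma isoB (a b : op H) : M a -> M b -> f (a - b) = f a - f b.
Proof.
move=> Ma Mb; rewrite (iso_add fP) //; last exact: (memN vM).
by rewrite -scaleN1r (iso_scale fP) // scaleN1r.
Qed.

Lemma iso_herm (a : op H) : M a -> (star (f a) = f a <-> star a = a).
Proof.
move=> Ma; rewrite -(iso_star fP) //; split=> [h|->] //.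
by apply: (iso_inj fP) => //; exact: (mem_star vM).
Qed.

(** Positivity is algebraic: the positive elements are the squares of self-adjoint ones, and the
    square root stays in the algebra. *)
Lemma iso_pos (a : op H) : M a -> (pos (f a) <-> pos a).
Proof.
move=> Ma; split=> pa.
  have [s Ms fs] := iso_surj fP (mem_sqrto pa vM0 M01 (fM Ma)).
  have -> : a = s * s.
    apply: (iso_inj fP) => //; first exact: memM.
    by rewrite (iso_mulr fP) // fs sqrtoK.
  apply: pos_sqr; apply/iso_herm => //; rewrite fs; exact: pos_herm (sqrto_pos pa).
have Ms := mem_sqrto pa vM M1 Ma.
rewrite -(sqrtoK pa) (iso_mulr fP) //; apply: pos_sqr; apply/iso_herm => //.
exact: pos_herm (sqrto_pos pa).
Qed.

Lemma iso_res (a : op H) : M a -> pos a -> f (res a) = res (f a).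
Proof.
move=> Ma pa; have Mr := mem_res pa vM M1 Ma.
apply: res_unique; first exact/iso_pos.
rewrite -(iso_one fP) -(iso_add fP) // -(iso_mulr fP) //; last exact: memD.
by rewrite mul_res.
Qed.

(** With h(a) = 1 - res a, this and [le_one_sub_res] say h(a) <= a <= (1 + t) h(a) for 0 <= a <= t.
    Passing to h costs a constant factor and bounds all sums by 1, so that their suprema exist. *)
Lemma one_sub_res_le (a : op H) : pos a -> pos (a - (1 - res a)).
Proof.
move=> pa; have e : a * res a = res a * a by apply: res_comm.
have -> : a - (1 - res a) = a * res a * a.
  by rewrite -(mul_resE pa) -{1}[a]mulr1 -mulrBr -(mul_resE pa) -[RHS]mulrA -e.
by apply: pos_sandwich; [exact: pos_herm|exact: res_pos].
Qed.

Lemma le_one_sub_res (t : R) (a : op H) : 0 < t -> pos a -> pos (t%:O - a) ->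
  pos ((1 + t)%:C *: (1 - res a) - a).
Proof.
move=> t0 pa pta; have e : a * res a = res a * a by apply: res_comm.
set r := res a in e *.
pose c := a * (t%:O - a).
have hr : star r = r := pos_herm (res_pos pa).
have -> : (1 + t)%:C *: (1 - r) - a = r * (c + a * c) * r.
  have -> : c + a * c = (1 + a) * c by rewrite mulrDl mul1r.
  have ar : a * r = 1 - r := mul_resE pa.
  rewrite mulrA (res_mul pa) mul1r /c -mulrA mulrBl -op_scalerAl mul1r ar.
  rewrite mulrBr -op_scalerAr ar mulrBr mulr1 ar.
  by op_linear_identity.
apply: pos_sandwich => //; have := posXB 1 t0 pa pta; have := posXB 2 t0 pa pta.
rewrite expr1 expr2 -mulrA => h1 h2; exact: posD.
Qed.

Lemma sum_half (m n : nat) :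
  \sum_(i < n) 2^-1 ^+ (m + i) <= 2^-1 ^+ m *+ 2 :> R.
Proof.
have -> : \sum_(i < n) 2^-1 ^+ (m + i) = 2^-1 ^+ m *+ 2 - 2^-1 ^+ (m + n) *+ 2 :> R.
  elim: n => [|n IH]; first by rewrite addn0 big_ord0 subrr.
  by rewrite big_ord_recr /= IH addnS exprS; field.
by rewrite gerBl mulrn_wge0 // exprn_ge0 // invr_ge0.
Qed.

(* The increasing suprema [b m] of [h (e m + ... + e (m + N))], with the operator
   monotone [h a = a / (1 + a)], dominate all [e n] with [n >= m] and decrease to [0];
   being an order isomorphism, [f] preserves this. *)
Lemma iso_normal (F : nat -> H) (t : R) (e : nat -> op H) :
  (forall a : op H, M a -> (forall i, a (F i) = 0) -> a = 0) ->
  0 < t -> (forall n, M (e n)) -> (forall n, pos (e n)) ->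
  (forall n, pos (t%:O - e n)) ->
  (forall i n, (i < n)%N -> ip (e n (F i)) (F i) <= 2^-1 ^+ n) ->
  forall v, ip (f (e n) v) v @[n --> \oo] --> (0 : R).
Proof.
move=> sepF t0 Me pe et eF.
pose S m N : op H := \sum_(i < N) e (m + i)%N.
have MS m N : M (S m N) by apply: mem_sum.
have pS m N : pos (S m N) by apply: pos_sum.
pose b m N : op H := 1 - res (S m N).
have Mb m N : M (b m N) by apply: memB => //; exact: mem_res.
have pb m N : pos (b m N) by exact: res_le1.
have b_mono m N m' N' : pos (S m' N' - S m N) -> pos (b m' N' - b m N).
  move=> h; have -> : b m' N' - b m N = res (S m N) - res (S m' N').
    by rewrite /b; op_linear_identity.
  exact: res_antitone.
have bS m N : pos (b m N.+1 - b m N).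
  apply: b_mono; rewrite /S big_ord_recr /= addrAC subrr add0r.
  exact: pe.
have b1 m N : pos (1%:O - b m N).
  by rewrite scale1r /b opprB addrC subrK; exact: res_pos.
have lim m : exists c, scvg (b m) c.
  by apply: (@vigier _ _ 1 (b m)) => // N; exact: pos_herm.
have [c cP] := choice lim.
have Mc m : M (c m) := mem_scvg vM (Mb m) (cP m).
have bc m N : pos (c m - b m N) := incr_le_lim N (cP m) (bS m).
have pc m : pos (c m) by have := posD (bc m 0%N) (pb m 0%N); rewrite subrK.
have c1 m : pos (1 - c m).
  apply: scvg_pos (scvgB (scvg_cst 1) (cP m)) _ => N.
  by have := b1 m N; rewrite scale1r.
have cdec m : pos (c m - c m.+1).
  apply: scvg_pos (scvgB (scvg_cst (c m)) (cP m.+1)) _ => N.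
  apply: pos_le_trans (bc m N.+1); apply: b_mono.
  rewrite /S big_ord_recl addn0 (eq_bigr (fun i : 'I_N => e (m.+1 + i)%N)).
    by rewrite addrK; exact: pe.
  by move=> i _; rewrite /= /bump /= addnA addn1.
have small i m : (i < m)%N -> ip (c m (F i)) (F i) <= 2^-1 ^+ m *+ 2.
  move=> im; apply: (cvg_le_cst (cvg_ip (cP m (F i)) (vcvg_cst (F i)))) => N.
  apply: le_trans (sum_half m N).
  have [_ /(_ (F i))] := one_sub_res_le (pS m N).
  rewrite opBE ipBl subr_ge0 => /le_trans; apply.
  rewrite /S op_sumE.
  elim: N => [|N IH]; first by rewrite !big_ord0 ip0l.
  rewrite !big_ord_recr /= ipDl; apply: lerD => //.
  by apply: eF; rewrite (leq_trans im) // leq_addr.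
have [d cd] : exists d, scvg c d.
  have [g hg] : exists g, scvg (fun m => 1 - c m) g.
    apply: (@vigier _ _ 1) => m.
    - by apply: pos_herm.
    - have -> : 1 - c m.+1 - (1 - c m) = c m - c m.+1 by op_linear_identity.
      exact: cdec.
    - by have -> : 1%:O - (1 - c m) = c m by op_linear_identity.
  exists (1 - g); have := scvgB (scvg_cst 1) hg.
  by congr scvg; apply/funext => m; rewrite opprB addrC subrK.
have pd : pos d := scvg_pos cd pc.
have d0 : d = 0.
  apply: sepF => [|i]; first exact: (mem_scvg vM Mc cd).
  apply: pos_kernel => //; apply/eqP; rewrite eq_le (proj2 pd) andbT.
  have h1 : (2^-1 ^+ m : R) @[m --> \oo] --> (0 : R).
    by apply: cvg_expr; rewrite ger0_norm ?invr_ge0 // invf_lt1 // ltr1n.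
  (* The shift by i + 1 puts the index beyond i, where the estimate [small] on F_i applies. *)
  have h2 : (2^-1 ^+ i.+1 * 2^-1 ^+ m *+ 2 : R) @[m --> \oo] --> 2^-1 ^+ i.+1 * (0 : R) *+ 2.
    by apply: cvgMn; apply: cvgM => //; exact: cvg_cst.
  rewrite mulr0 mul0rn in h2.
  apply: (cvg_ge_cst h2) => m.
  have decd k : pos (c k - d).
    apply: scvg_pos (scvgB (scvg_cst (c k)) (_ : scvg (fun n => c (n + k)%N) d)) _.
      move=> u; have /vcvg_norm := cd u; rewrite -(cvg_shiftn k) => h.
      exact/vcvg_norm.
    elim=> [|n IH]; first by rewrite add0n subrr; exact: pos0.
    by rewrite addSn; apply: pos_le_trans IH; exact: cdec.
  rewrite -exprD; have := small i (i.+1 + m)%N (leq_addr _ _); apply: le_trans.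
  have [_ /(_ (F i))] := decd (i.+1 + m)%N.
  by rewrite opBE ipBl subr_ge0.
have [g hg] : exists g, scvg (fun m => f (c m)) g.
  have [g hg] : exists g, scvg (fun m => 1 - f (c m)) g.
    have f1B m : 1 - f (c m) = f (1 - c m) by rewrite isoB // (iso_one fP).
    apply: (@vigier _ _ 1) => m.
    - rewrite f1B; apply: pos_herm; apply/iso_pos => //; exact: memB.
    - have -> : 1 - f (c m.+1) - (1 - f (c m)) = f (c m - c m.+1).
        by rewrite isoB //; op_linear_identity.
      by apply/iso_pos => //; exact: memB.
    - have -> : 1%:C *: (1 : op K) - (1 - f (c m)) = f (c m) by op_linear_identity.
      exact/iso_pos.
  exists (1 - g); have := scvgB (scvg_cst 1) hg.
  by congr scvg; apply/funext => m; rewrite opprB addrC subrK.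
have pg : pos g by apply: scvg_pos hg _ => m; exact/iso_pos.
(* Strong closedness of [M0] enters here: the limit g of the f (c m) is the image of some a, and a
   lies below every c m, hence below their limit 0. *)
have [a Ma fa] := iso_surj fP (mem_scvg vM0 (fun m => fM (Mc m)) hg).
have pa : pos a by apply/iso_pos; rewrite // fa.
have ac m : pos (c m - a).
  apply/iso_pos; first exact: memB.
  rewrite isoB // fa.
  apply: scvg_pos (scvgB (scvg_cst (f (c m))) (_ : scvg (fun n => f (c (n + m)%N)) g)) _.
    move=> u; have /vcvg_norm := hg u; rewrite -(cvg_shiftn m) => h.
    exact/vcvg_norm.
  move=> n; rewrite -isoB //; apply/iso_pos; first exact: memB.
  elim: n => [|n IH]; first by rewrite add0n subrr; exact: pos0.
  by rewrite addSn; apply: pos_le_trans IH; exact: cdec.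
have g0 : g = 0.
  rewrite -fa -iso0; congr f; apply: pos_eq0 => //.
  have := scvgB cd (scvg_cst a); rewrite d0 sub0r => h.
  exact: scvg_pos h ac.
(* In the domain, e n <= (1 + t) h(e n) = (1 + t) b n 1 <= (1 + t) c n. *)
have dom n : pos ((1 + t)%:C *: f (c n) - f (e n)).
  rewrite -(iso_scale fP) // -isoB //; last exact: memZ.
  apply/iso_pos; first by apply: memB => //; exact: memZ.
  have h1 := le_one_sub_res t0 (pe n) (et n).
  have h2 := bc n 1%N; have t1 : 0 <= 1 + t by rewrite addr_ge0 // ltW.
  have := posD (posZ t1 h2) h1.
  rewrite /b /S big_ord_recl big_ord0 addr0 addn0.
  by congr pos; move: (1 - res (e n)) => z; op_linear_identity.
move=> v.
have lim0 : ((1 + t) * ip (f (c n) v) v) @[n --> \oo] --> (0 : R).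
  rewrite -[X in _ --> X](mulr0 (1 + t)); apply: cvgM; first exact: cvg_cst.
  by have := cvg_ip (hg v) (vcvg_cst v); rewrite g0 op0E ip0l.
apply: cvg0_le lim0 => n; have pfe : pos (f (e n)) by exact/iso_pos.
rewrite (proj2 pfe) /=; have [_ /(_ v)] := dom n.
by rewrite opBE opZE ipBl ipZl subr_ge0.
Qed.

End Iso.

(** * Bounded resolvent functions of a self-adjoint operator *)

Section ResolventBounds.
Context {R : realType} {H : hilbert R}.
Implicit Types (a y s : op H).

Lemma vcvg_uniform (r : seq H) (a : nat -> op H) s (e : R) : 0 < e ->
  (forall v, v \in r -> vcvg (fun n => a n v) (s v)) ->
  exists n, forall v, v \in r -> sq ((a n - s) v) < e.
Proof.
move=> e0 h; suff [N hN] : exists N, forall n, (N <= n)%N ->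
    forall v, v \in r -> sq ((a n - s) v) < e by exists N; exact: hN.
elim: r h => [|v r IH] h; first by exists 0%N.
have [w wr|N hN] := IH; first by apply: h; rewrite inE wr orbT.
have /cvg0P h1 := h v (mem_head _ _).
have [N' hN'] := h1 (fun n => sq_ge0 _) e e0.
exists (maxn N N') => n; rewrite geq_max => /andP[Nn N'n] w.
by rewrite inE => /predU1P[->|/hN]; [exact: hN'|exact].
Qed.

Lemma res_contraction a v : pos a -> sq (res a v) <= sq v.
Proof.
move=> pa; rewrite -[leRHS]mul1r.
by apply: pos_contraction; [exact: res_pos|exact: res_le1].
Qed.

(** For r = res (l y^2) the left-hand side is <(1 - r) v, r v> = <v, r v> - |r v|^2, and r <= 1. *)
Lemma mul_res_bound (l : R) y v : 0 < l -> star y = y ->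
  l * sq ((y * res (l%:C *: (y * y))) v) <= sq v.
Proof.
move=> l0 hy; set r := res _.
have pl : pos (l%:C *: (y * y)) by apply: posZ; [exact: ltW|exact: pos_sqr].
have e : l * sq ((y * r) v) = ip ((l%:C *: (y * y) * r) v) (r v).
  by rewrite -op_scalerAl opZE ipZl /sq -mulrA !opME [ip (y (y _)) _](ip_herm _ _ hy).
rewrite e mul_resE // opBE op1E ipBl -/(sq (r v)).
have := sq_ge0 (r v); have [_ /(_ v)] := res_le1 pl.
rewrite opBE op1E ipBl -/(sq v) ipC -/r; lra.
Qed.

(** In each term the factor left of y - s is bounded independently of y, and the factor right of it
    does not involve y; so closeness of y to s on the corresponding vectors suffices. *)
Lemma mul_res_sub (l : R) y s : 0 < l -> star y = y -> star s = s ->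
  let ry := res (l%:C *: (y * y)) in let rs := res (l%:C *: (s * s)) in
  y * ry - s * rs =
  ry * (y - s) * rs - l%:C *: ((y * ry) * (y - s) * (s * rs)).
Proof.
move=> l0 hy hs ry rs.
have py : pos (l%:C *: (y * y)) by apply: posZ; [exact: ltW|exact: pos_sqr].
have ps : pos (l%:C *: (s * s)) by apply: posZ; [exact: ltW|exact: pos_sqr].
have yr : y * ry = ry * y.
  by apply: res_comm => //; rewrite -op_scalerAl -op_scalerAr mulrA.
have e : y * (1 + l%:C *: (s * s)) - (1 + l%:C *: (y * y)) * s =
    (y - s) - l%:C *: (y * (y - s) * s).
  by op_expand; op_linear_identity.
transitivity (ry * (y * (1 + l%:C *: (s * s)) - (1 + l%:C *: (y * y)) * s) * rs).
  rewrite mulrBr mulrBl -!mulrA (mul_res ps) mulr1 [ry * ((1 + _) * _)]mulrA.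
  by rewrite (res_mul py) mul1r yr.
by rewrite e mulrBr mulrBl -op_scalerAr -op_scalerAl yr !mulrA.
Qed.

End ResolventBounds.

(** * Preimages of von Neumann algebras under isomorphisms *)

Section IsoPreimage.
Context {R : realType} {H K : hilbert R}.
Variables (M : set (H -> H)) (M0 : set (K -> K)) (f : op H -> op K).
Variables (tau : (H -> H) -> R[i]) (B : set (K -> K)).
Hypothesis fP : star_iso M M0 f.
Hypothesis tM : faithful_normal_trace M tau.
Hypothesis vB : von_neumann_algebra B.

Let vM : von_neumann_algebra M. Proof. by case: (iso_dom fP). Qed.
Let M1 : M (1 : op H). Proof. by case: (iso_dom fP). Qed.

Definition iso_preimage : set (H -> H) :=
  [set A | exists a : op H, [/\ opf a = A, M a & B (f a)]].

Lemma iso_preimageP (a : op H) : iso_preimage a <-> M a /\ B (f a).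
Proof. by split=> [[b [/opf_inj -> Ma Ba]]//|[Ma Ba]]; exists a. Qed.

(* [y (1 + l y^2)^-1] is bounded uniformly in [y] and strongly continuous; choose
   [y n] close to [s] on the vectors that control it on a separating sequence. *)
Lemma resolvent_preimage (l : R) (s : op H) : 0 < l -> M s -> star s = s ->
  (forall r : seq H, exists a : nat -> op H,
     (forall n, iso_preimage (a n) /\ star (a n) = a n) /\
     forall v, v \in r -> vcvg (fun n => a n v) (s v)) ->
  B (f (s * res (l%:C *: (s * s)))).
Proof.
move=> l0 Ms hs apx.
have [F sepF] := separating_sequence vM M1 tM.
have l0' := ltW l0.
pose sl (y : op H) : op H := l%:C *: (y * y).
have psl (y : op H) : star y = y -> pos (sl y) by move=> hy; apply: posZ => //; exact: pos_sqr.
have Msl (y : op H) : M y -> M (sl y) by move=> My; apply: memZ => //; exact: memM.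
pose rs := res (sl s).
pose pts n := [seq rs (F i) | i <- iota 0 n] ++ [seq (s * rs) (F i) | i <- iota 0 n].
(* The error on F_i is at most 2 |w1|^2 + 2 l |w2|^2, where w1 and w2 are the values of y - s at the
   two control vectors. *)
pose k : R := 2 + l *+ 2.
have k0 : 0 < k by rewrite /k addr_gt0 // mulrn_wgt0.
have choose n : exists y : op H, [/\ M y, B (f y), star y = y &
    forall v, v \in pts n -> sq ((y - s) v) < 2^-1 ^+ n / k].
  have [a [aP as_]] := apx (pts n).
  have e0 : 0 < 2^-1 ^+ n / k :> R by rewrite divr_gt0 // exprn_gt0 // invr_gt0.
  have [N hN] := vcvg_uniform e0 as_.
  by exists (a N); have [/iso_preimageP[? ?] ?] := aP N; split.
have [y yP] := boolp.choice choose.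
have My n : M (y n) by case: (yP n).
have hy n : star (y n) = y n by case: (yP n).
pose ry n := res (sl (y n)).
pose d n := y n * ry n - s * rs.
have res_herm (z : op H) : star z = z -> star (z * res (sl z)) = z * res (sl z).
  move=> hz; rewrite starM hz (pos_herm (res_pos (psl _ hz))); apply/esym/res_comm.
    exact: psl.
  by rewrite /sl -op_scalerAl -op_scalerAr mulrA.
have hd n : star (d n) = d n by rewrite /d starB !res_herm.
have Mzr (z : op H) : M z -> star z = z -> M (z * res (sl z)).
  by move=> Mz hz; apply: (mem_mul_res (psl _ hz)) => //; exact: Msl.
have Md n : M (d n) by apply: memB => //; exact: Mzr.
have dd n v : sq (d n v) = ip ((d n * d n) v) v by rewrite opME (ip_herm _ _ (hd n)).
have bnd : forall v, (fun n => ip (f (d n * d n) v) v) @ \oo --> (0 : R).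
  (* Both terms of d n have squared norm at most 1 / l, so |d n v|^2 <= (2 / l + 2 / l) |v|^2. *)
  apply: (iso_normal fP sepF (t := 4 / l)) => [|n|n|n|i n im].
  - by rewrite divr_gt0.
  - exact: memM.
  - exact: pos_sqr.
  - split=> [|v]; first by rewrite starB starZ star1 starM hd.
    rewrite opBE ipBl opZE ipZl op1E -/(sq v) -dd subr_ge0.
    rewrite mulrAC ler_pdivlMr //.
    have := mul_res_bound v l0 (hy n); have := mul_res_bound v l0 hs.
    rewrite -/(sl s) -/(sl (y n)) -/rs -/(ry n).
    have := sqD_le ((y n * ry n) v) (- (s * rs) v); rewrite -opBE -/(d n).
    rewrite /sq ipNl ipNr opprK -!/(sq _); nra.
  - rewrite -dd /d mul_res_sub // -/(sl s) -/(sl (y n)) -/rs -/(ry n).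
    have [_ _ _ hpts] := yP n.
    pose w1 := (y n - s) (rs (F i)); pose w2 := (y n - s) ((s * rs) (F i)).
    have h1 : sq w1 < 2^-1 ^+ n / k.
      apply: hpts; rewrite mem_cat; apply/orP; left.
      by apply: (map_f (fun i => rs (F i))); rewrite mem_iota.
    have h2 : sq w2 < 2^-1 ^+ n / k.
      apply: hpts; rewrite mem_cat; apply/orP; right.
      by apply: (map_f (fun i => (s * rs) (F i))); rewrite mem_iota.
    have g1 := res_contraction w1 (psl _ (hy n)).
    have g2 := mul_res_bound w2 l0 (hy n).
    rewrite -/(sl (y n)) -/(ry n) in g1 g2.
    have g3 := sqD_le (ry n w1) (- (l%:C *: (y n * ry n) w2)).
    have g4 : sq (- (l%:C *: (y n * ry n) w2)) = l * (l * sq ((y n * ry n) w2)).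
      by rewrite /sq ipNl ipNr opprK -/(sq _) sqZ mulrA -expr2.
    apply: le_trans (_ : _ <= k * (2^-1 ^+ n / k)) _; last by rewrite mulrC divfK ?gt_eqF.
    apply: le_trans g3 _; rewrite g4.
    apply: le_trans (_ : _ <= sq w1 *+ 2 + l * sq w2 *+ 2) _.
      have := ler_wpM2l l0' g2; move: (l * (l * _)) (l * sq w2) => ? ?; lra.
    have := ler_wpM2l l0' (ltW h2); move: h1 (l * sq w2); rewrite /k mulrDl mulrnAl.
    move: (2^-1 ^+ n / k) => x h1 z h3; lra.
apply: (mem_scvg vB (a := fun n => f (y n * ry n))).
  move=> n; have Mr : M (ry n) by apply: (mem_res (psl _ (hy n))) => //; exact: Msl.
  rewrite (iso_mulr fP) // (iso_res fP) //; [|exact: Msl|exact: psl].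
  have [_ By _ _] := yP n.
  apply: mem_mul_res => //; first by apply/(iso_pos fP); [exact: Msl|exact: psl].
  rewrite /sl (iso_scale fP); last exact: memM.
  by rewrite (iso_mulr fP) //; apply: memZ => //; exact: memM.
move=> v; rewrite /vcvg.
have -> : (fun n => sq (f (y n * ry n) v - f (s * rs) v)) =
    (fun n => ip (f (d n * d n) v) v); last exact: bnd.
apply/funext => n; have hfd : star (f (d n)) = f (d n) by apply/(iso_herm fP).
rewrite [f (d n * d n)](iso_mulr fP) // opME (ip_herm _ _ hfd) -/(sq _) /d (isoB fP) //.
  exact: Mzr.
exact: Mzr.
Qed.

(** Let l tend to 0 in [resolvent_preimage]: with r = res (l z^2), z - z r = l z^3 r, and r is a
    contraction. *)
Lemma herm_preimage (s : op H) : M s -> star s = s ->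
  (forall r : seq H, exists a : nat -> op H,
     (forall n, iso_preimage (a n) /\ star (a n) = a n) /\
     forall v, v \in r -> vcvg (fun n => a n v) (s v)) ->
  B (f s).
Proof.
move=> Ms hs apx; set z := f s.
have hz : star z = z by apply/(iso_herm fP).
pose l n : R := n.+1%:R^-1.
have l0 n : 0 < l n by rewrite invr_gt0.
have ps n : pos ((l n)%:C *: (s * s)) by apply: posZ; [exact: ltW|exact: pos_sqr].
have pz n : pos ((l n)%:C *: (z * z)) by apply: posZ; [exact: ltW|exact: pos_sqr].
have Mss n : M ((l n)%:C *: (s * s)) by apply: memZ => //; exact: memM.
apply: (mem_scvg vB (a := fun n => z * res ((l n)%:C *: (z * z)))).
  move=> n; have := resolvent_preimage (l0 n) Ms hs apx.
  rewrite (iso_mulr fP) //; last exact: (mem_res (ps n)).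
  rewrite (iso_res fP) // (iso_scale fP); last exact: memM.
  by rewrite (iso_mulr fP).
move=> v; have [c c0 hc] := op_bound (z * (z * z)).
have lim0 : (l n * l n * (c * sq v)) @[n --> \oo] --> (0 * 0 * (c * sq v)).
  apply: cvgM; last exact: cvg_cst.
  by apply: cvgM; exact: natSinv_cvg0.
rewrite mulr0 mul0r in lim0.
apply: cvg0_le lim0 => n; rewrite sq_ge0 /=.
set r := res _.
have e0 : z * r - z = - ((l n)%:C *: (z * (z * z) * r)).
  have -> : z * r - z = - (z * (1 - r)) by rewrite mulrBr mulr1 opprB.
  by rewrite -(mul_resE (pz n)) -/r -op_scalerAl -op_scalerAr mulrA.
have e : (z * r) v - z v = - ((l n)%:C *: (z * (z * z)) (r v)).
  by rewrite -opBE e0.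
rewrite e /sq ipNl ipNr opprK -/(sq _) sqZ -expr2.
apply: ler_wpM2l; first exact: sqr_ge0.
by apply: le_trans (hc _) _; apply: ler_wpM2l => //; exact: res_contraction.
Qed.

(** Strong closedness is the substance. The self-adjoint parts of t and of i t are approximable by
    self-adjoint members, to which [herm_preimage] applies, and t = Re t - i Re (i t). *)
Lemma iso_preimage_vna : von_neumann_algebra iso_preimage.
Proof.
have AM A : iso_preimage A -> M A by move=> [a [<- Ma _]].
have AD (a b : op H) : iso_preimage a -> iso_preimage b -> iso_preimage (a + b).
  move=> /iso_preimageP[Ma Ba] /iso_preimageP[Mb Bb]; apply/iso_preimageP; split.
    exact: memD.
  by rewrite (iso_add fP) //; exact: memD.
have AZ (k : R[i]) (a : op H) : iso_preimage a -> iso_preimage (k *: a).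
  move=> /iso_preimageP[Ma Ba]; apply/iso_preimageP; split; first exact: memZ.
  by rewrite (iso_scale fP) //; exact: memZ.
have Astar (a : op H) : iso_preimage a -> iso_preimage (star a).
  move=> /iso_preimageP[Ma Ba]; apply/iso_preimageP; split; first exact: mem_star.
  by rewrite (iso_star fP) //; exact: mem_star.
have A0 : iso_preimage (0 : op H).
  by apply/iso_preimageP; split; [exact: mem0|rewrite (iso0 fP); exact: mem0].
split => //.
- by move=> A /AM; exact: vna_bounded.
- by move=> _ _ [a [<- ? ?]] [b [<- ? ?]]; apply: AD; apply/iso_preimageP.
- by move=> k _ [a [<- ? ?]]; apply: AZ; apply/iso_preimageP.
- move=> _ _ [a [<- Ma Ba]] [b [<- Mb Bb]].
  apply/(iso_preimageP (a * b)); split; first exact: memM.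
  by rewrite (iso_mulr fP) //; exact: memM.
- move=> _ [a [<- ? ?]]; exists (star a); last exact: star_adjoint.
  by apply: Astar; apply/iso_preimageP.
- move=> T [cT bT].
  have MT : M T by apply: (vna_closed vM); split=> //; exact: closureS cT.
  have [t tE] := vna_op vM MT; rewrite -tE in cT MT *.
  have Aop C : iso_preimage C -> exists c : op H, opf c = C.
    by move=> [c [<- _ _]]; exists c.
  pose approx (u : op H) := forall r : seq H, exists c : nat -> (H -> H),
    (forall n, iso_preimage (c n)) /\ forall v, v \in r -> vcvg (fun n => c n v) (u v).
  have re (u : op H) : M u -> approx u ->
      M (2^-1%:C *: (u + star u)) /\ B (f (2^-1%:C *: (u + star u))).
    move=> Mu cu; have Ms : M (2^-1%:C *: (u + star u)).
      by apply: memZ => //; apply: memD => //; exact: mem_star.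
    split=> //; apply: herm_preimage => //.
      by rewrite starZ starD starK addrC.
    by move=> r; exact: (herm_closure_seq A0 Aop AD (fun k => AZ k%:C) Astar r cu).
  have ct : approx t by move=> r; exact: closure_seq.
  have cit : approx ('i%C *: t).
    move=> r; have [c [Ac cP]] := ct r.
    have [c' c'P] := boolp.choice (fun n => Aop _ (Ac n)).
    exists (fun n => 'i%C *: c' n : op H); split=> [n|v vr].
      by apply: AZ; rewrite c'P.
    have := vcvgZ 'i%C (cP v vr); congr vcvg.
    by apply/funext => n; rewrite opZE c'P.
  have [M1' B1'] := re t MT ct.
  have [M2' B2'] := re ('i%C *: t) (memZ vM _ MT) cit.
  apply/iso_preimageP; split=> //.
  have -> : t = 2^-1%:C *: (t + star t) - 'i%C *: (2^-1%:C *: ('i%C *: t + star ('i%C *: t))).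
    have ii : 'i%C * 'i%C = -1 :> R[i] by rewrite -expr2 sqr_i.
    have -> : 'i%C *: (2^-1%:C *: ('i%C *: t + star ('i%C *: t))) =
        2^-1%:C *: (- t + star t).
      rewrite starZi scalerA mulrC -scalerA scalerDr !scalerA mulrN ii opprK.
      by rewrite scaleN1r scale1r.
    by op_linear_identity.
  rewrite (isoB fP) //; last exact: (memZ vM _ M2').
  by rewrite [f ('i%C *: _)](iso_scale fP) //; apply: (memB vB) => //; exact: (memZ vB _ B2').
Qed.

End IsoPreimage.

(** * Cutting and assembling *)

Section FiniteSums.
Context {R : realType}.

Lemma finite_enum (T : choiceType) (A : set T) : finite_set A ->
  exists s : seq T, uniq s /\ A = [set` s].
Proof.
move=> /finite_seqP[s ->]; exists (undup s); split; first exact: undup_uniq.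
by apply/seteqP; split=> x /=; rewrite mem_undup.
Qed.

(** The list may have repetitions, as when two formulas yield the same generator; the bound then
    overcounts harmlessly. *)
Lemma fsum_le_seq (T : choiceType) (s : seq T) (A : set T) (F : T -> R) :
  A `<=` [set` s] -> (forall x, x \in s -> 0 <= F x) ->
  \sum_(x \in A) F x <= \sum_(x <- s) F x.
Proof.
move=> As F0.
have [r [ur rE]] : exists r : seq T, uniq r /\ A = [set` r].
  apply: finite_enum; apply: sub_finite_set As _; apply/finite_seqP; by exists s.
have rs x : x \in r -> x \in s by move=> xr; apply: As; rewrite rE.
rewrite rE -fsbig_seq // {A As rE}.
elim: s r ur rs F0 => [|x s IH] r ur rs F0.
  by case: r {ur} rs => [|y r] rs; rewrite ?big_nil //; have := rs y (mem_head _ _).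
have F0' y : y \in s -> 0 <= F y by move=> ys; apply: F0; rewrite inE ys orbT.
rewrite big_cons; have [xr|xr] := boolP (x \in r).
  rewrite (big_rem x xr) /= lerD2l; apply: IH => //; first exact: rem_uniq.
  move=> y; rewrite mem_rem_uniq // inE => /andP[yx /rs].
  by rewrite inE (negbTE yx).
apply: le_trans (IH r ur _ F0') _.
  move=> y yr; have := rs y yr; rewrite inE => /predU1P[yx|//].
  by move: xr; rewrite -yx yr.
by rewrite lerDr; apply: F0; exact: mem_head.
Qed.

Lemma sum_pairs_le (I : finType) (T : choiceType) (s : seq (T * T)) (g : I -> T)
    (t : I -> R) (c : I -> I -> bool) :
  uniq s -> (forall i, 0 <= t i) -> (forall i j, c i j -> (g i, g j) \in s) ->
  \sum_i \sum_(j | c i j) t i * t j <=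
  \sum_(pq <- s) (\sum_(i | g i == pq.1) t i) * (\sum_(j | g j == pq.2) t j).
Proof.
move=> us t0 cs.
have -> : \sum_(pq <- s) (\sum_(i | g i == pq.1) t i) * (\sum_(j | g j == pq.2) t j)
    = \sum_i \sum_(j | (g i, g j) \in s) t i * t j.
  rewrite (eq_bigr (fun pq => \sum_i \sum_j
      (if (g i, g j) == pq then t i * t j else 0))); last first.
    move=> [p q] _; rewrite mulr_suml big_mkcond; apply: eq_bigr => i _ /=.
    case: eqP => [->|n1].
      rewrite mulr_sumr big_mkcond; apply: eq_bigr => j _.
      by rewrite xpair_eqE eqxx.
    by rewrite big1 // => j _; case: eqP => // -[].
  rewrite exchange_big; apply: eq_bigr => i _.
  rewrite exchange_big [RHS]big_mkcond; apply: eq_bigr => j _ /=.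
  have [ijs|ijs] := boolP (_ \in s).
    rewrite (bigD1_seq (g i, g j)) //= eqxx big1 ?addr0 // => pq.
    by rewrite eq_sym => /negbTE ->.
  rewrite big_seq big1 // => pq pqs; case: eqP => // h.
  by move: ijs; rewrite h pqs.
apply: ler_sum => i _; rewrite big_mkcond [leRHS]big_mkcond /=.
apply: ler_sum => j _; case: ifP => [/cs -> //|_].
by case: ifP => // _; exact: mulr_ge0.
Qed.

(** The upper and lower triangles have equal weight and together cover the square of total weight 1
    with the diagonal counted twice; the diagonal weighs at most e. *)
Lemma upper_triangle_sum n (t : 'I_n -> R) (e : R) : (forall i, 0 <= t i <= e) ->
  \sum_i t i = 1 ->
  \sum_(i < n) \sum_(j < n | (i <= j)%N) t i * t j <= (1 + e) / 2.
Proof.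
move=> te t1; set S := \sum_i _.
have S' : S = \sum_(i < n) \sum_(j < n | (j <= i)%N) t i * t j.
  rewrite /S (eq_bigr (fun i : 'I_n =>
    \sum_(j < n) if (i <= j)%N then t i * t j else 0)); last first.
    by move=> i _; rewrite big_mkcond.
  rewrite exchange_big; apply: eq_bigr => i _ /=; rewrite [RHS]big_mkcond.
  by apply: eq_bigr => j _; rewrite mulrC.
have SS : S + S = 1 + \sum_i t i * t i.
  rewrite {2}S' /S -big_split /=.
  transitivity (\sum_i (t i * 1 + t i * t i)); last first.
    by rewrite big_split /= -mulr_suml t1 mulr1.
  apply: eq_bigr => i _; rewrite -t1 mulr_sumr.
  rewrite [X in X + _]big_mkcond [X in _ + X]big_mkcond -big_split /=.
  rewrite (bigD1 i) //= [in RHS](bigD1 i) //= leqnn -addrA [RHS]addrAC -addrA; congr (_ + _).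
  congr (_ + _); apply: eq_bigr => j ji.
  have : (i != j :> nat) by rewrite eq_sym.
  by rewrite neq_ltn => /orP[h|h]; rewrite (ltnW h) leqNgt h /= ?addr0 ?add0r.
have : \sum_i t i * t i <= e.
  rewrite -[leRHS]mulr1 -t1 mulr_sumr; apply: ler_sum => i _.
  by have /andP[? ?] := te i; exact: ler_wpM2r.
lra.
Qed.

End FiniteSums.

Section CutIndex.
Context {R : realType} {H : hilbert R}.
Implicit Types (x : op H) (I : finType).
Variables (M : set (H -> H)) (tau : (H -> H) -> R[i]).
Hypotheses (vM : von_neumann_algebra M) (M1 : M (1 : op H)).
Hypothesis tM : faithful_normal_trace M tau.
Local Notation tr := (trR tau).

Lemma op_sum_fun (T : Type) (r : seq T) (F : T -> op H) :
  opf (\sum_(i <- r) F i) = \sum_(i <- r) opf (F i).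
Proof. by elim/big_rec2: _ => // i x y _ <-. Qed.

Lemma partition_seq P : projection_partition M P -> exists s : seq (op H),
  [/\ forall p, p \in s -> M p /\ proj p, forall p, p \in s -> P p & \sum_(p <- s) p = 1].
Proof.
move=> [finP subP _ sumP]; have [s [us sE]] := finite_enum finP.
have h A : exists a : op H, P A -> opf a = A.
  have [PA|nPA] := pselect (P A); last by exists 0.
  by have [a <-] := vna_op vM (proj1 (subP A PA)); exists a.
have [g gP] := boolp.choice h.
have gs A : A \in s -> opf (g A) = A by move=> As; apply: gP; rewrite sE.
exists (map g s); split.
- move=> p /mapP[A As ->]; have PA : P A by rewrite sE.
  have [MA pA] := subP _ PA; rewrite -(gs A As) in MA pA.
  by split=> //; exact: (proj1 (projectionP _) pA).
- by move=> p /mapP[A As ->]; rewrite gs // sE.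
- apply: opf_inj; transitivity (\sum_(p \in P) p); last exact: sumP.
  rewrite big_map op_sum_fun sE -fsbig_seq //.
  by rewrite big_seq [RHS]big_seq; apply: eq_bigr => A As; rewrite gs.
Qed.

Lemma cut_index_ge0 P (x : H -> H) : projection_partition M P ->
  0 <= cut_index tau x P.
Proof.
move=> [_ subP _ _]; apply: fsumr_ge0 => -[A B] [/= PA PB _].
have tr0 C : P C -> 0 <= complex.Re (tau C).
  move=> PC; have [MC pC] := subP _ PC; have [c cE] := vna_op vM MC.
  rewrite -cE in MC pC *; apply: (trR_ge0 vM M1 tM) => //.
  by apply: proj_pos; exact: (proj1 (projectionP _)).
by apply: mulr_ge0; exact: tr0.
Qed.

(** Refinement does not increase the index: a nonzero block of x lies inside a nonzero coarse block,
    whose weight is the sum over all its fine pairs. *)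
Lemma refined_cut_le I (p : I -> op H) (g : I -> op H) P x :
  (forall i, M (p i) /\ proj (p i)) -> \sum_i p i = 1 ->
  projection_partition M P -> (forall i, P (g i)) -> (forall i, g i * p i = p i) ->
  \sum_i \sum_(j | p i * x * p j != 0) tr (p i) * tr (p j) <= cut_index tau x P.
Proof.
move=> pP p1 PP Pg gp; have [finP subP orthP _] := PP.
have Mp i : M (p i) by case: (pP i).
rewrite /cut_index; set S := (X in \sum_(pq \in X) _).
have [s [us sE]] : exists s : seq ((H -> H) * (H -> H)), uniq s /\ S = [set` s].
  apply: finite_enum; apply: sub_finite_set (finite_setX finP finP).
  by move=> [A B] [/= ? ? _].
rewrite sE -fsbig_seq //.
have gproj i : M (g i) /\ proj (g i).
  by have [? pg] := subP _ (Pg i); split=> //; exact: (proj1 (projectionP _) pg).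
have tg (q : op H) : M q -> proj q -> P q -> \sum_(i | opf (g i) == opf q) tr (p i) = tr q.
  move=> Mq qq Pq; rewrite -(trR_sum vM tM) //; congr trR.
  rewrite -[RHS]mulr1 -p1 mulr_sumr [LHS]big_mkcond; apply: eq_bigr => i _.
  case: eqP => [/opf_inj <-|gq]; first by rewrite gp.
  have qg : q * g i = 0 by apply: opf_inj; apply: orthP => // h; exact/gq.
  by rewrite -(gp i) mulrA qg mul0r.
have cs i j : p i * x * p j != 0 -> (opf (g i), opf (g j)) \in s.
  move=> pxp; have : S (opf (g i), opf (g j)).
    split=> //= h; move: pxp; have gxg : g i * x * g j = 0 by apply: opf_inj.
    rewrite -(gp i) -(gp j) -(sub_projC (proj2 (pP i)) (proj2 (gproj i)) (gp i)).
    have -> : g i * (p i * g i) * x * (g j * p j) = g i * p i * (g i * x * g j) * p j.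
      by rewrite !mulrA.
    by rewrite gxg mulr0 mul0r eqxx.
  by rewrite sE.
have t0 i : 0 <= tr (p i).
  by have [? ?] := pP i; apply: (trR_ge0 vM M1 tM) => //; exact: proj_pos.
apply: le_trans (sum_pairs_le us t0 cs) _.
rewrite big_seq [leRHS]big_seq le_eqVlt; apply/orP; left; apply/eqP.
apply: eq_bigr => -[A B] ABs /=.
have [/= PA PB _] : S (A, B) by rewrite sE.
have [a aE] := vna_op vM (proj1 (subP A PA)); have [b bE] := vna_op vM (proj1 (subP B PB)).
rewrite -aE -bE in PA PB *.
have [Ma pa] := subP _ PA; have [Mb pb] := subP _ PB.
by rewrite !tg //; exact: (proj1 (projectionP _)).
Qed.

Section Family.
Variables (I : finType) (p : I -> op H).
Hypothesis pP : forall i, M (p i) /\ proj (p i).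
Hypothesis pn0 : forall i, p i <> 0.
Hypothesis p1 : \sum_i p i = 1.

Definition family_set : set (H -> H) := [set A | exists i, A = opf (p i)].

Lemma family_inj : injective (fun i => opf (p i)).
Proof.
move=> i j /opf_inj pij; apply/eqP; apply: contra_notT (pn0 (i := i)) => ij.
have := proj_sum1_orthogonal (fun k => proj2 (pP k)) p1 ij.
by rewrite -pij; case: (pP i) => _ [_ ->].
Qed.

Lemma family_partition : projection_partition M family_set.
Proof.
have sE : family_set = [set` [seq opf (p i) | i <- enum I]].
  apply/seteqP; split=> [_ [i ->]|A /= /mapP[i _ ->]]; last by exists i.
  by apply/mapP; exists i; rewrite ?mem_enum.
have us : uniq [seq opf (p i) | i <- enum I].
  by rewrite map_inj_uniq ?enum_uniq //; exact: family_inj.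
split.
- by rewrite sE; apply/finite_seqP; exists [seq opf (p i) | i <- enum I].
- by move=> _ [i ->]; have [? pi] := pP i; split=> //; exact: (proj2 (projectionP _)).
- move=> _ _ [i ->] [j ->] pij.
  have ij : i != j by apply/eqP => ij; apply: pij; rewrite ij.
  by have := proj_sum1_orthogonal (fun k => proj2 (pP k)) p1 ij => /(congr1 (@opf _ _)).
- rewrite sE -fsbig_seq // big_map -op_sum_fun.
  have -> : \sum_(j <- enum I) p j = \sum_j p j by rewrite big_enum.
  by rewrite p1.
Qed.

Lemma family_cut_le x :
  cut_index tau x family_set <=
  \sum_i \sum_(j | p i * x * p j != 0) tr (p i) * tr (p j).
Proof.
pose s := [seq (opf (p ij.1), opf (p ij.2)) |
           ij <- enum [pred ij : I * I | p ij.1 * x * p ij.2 != 0]].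
have t0 i : 0 <= tr (p i).
  by have [? ?] := pP i; apply: (trR_ge0 vM M1 tM) => //; exact: proj_pos.
apply: le_trans (fsum_le_seq (s := s) _ _) _.
- move=> [A B] [/= [i ->] [j ->] h].
  apply/mapP; exists (i, j) => //; rewrite mem_enum inE /=.
  by apply/eqP => h'; apply: h; move/(congr1 (@opf _ _)): h'.
- by move=> _ /mapP[[i j] _ ->] /=; apply: mulr_ge0; exact: t0.
- by rewrite big_map big_enum /= pair_big_dep /=.
Qed.

End Family.

End CutIndex.

Lemma star_iso_of_tracial_iso (R : realType) (M L : tracial_vna R)
    (M0 : set (vna_space L -> vna_space L))
    (phi : (vna_space M -> vna_space M) -> (vna_space L -> vna_space L)) :
  tracial_iso (M := M) M0 phi -> exists f : op (vna_space M) -> op (vna_space L),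
    star_iso (vna M) M0 f /\
    (forall a : op (vna_space M), vna M a -> trR (tr L) (f a) = trR (tr M) a).
Proof.
move=> iso; have [vM0 _] := iso_sub iso; have vM := vna_axiom M.
have [phi_fun phi_inj phi_surj] := iso_bij iso.
have lift (a : op (vna_space M)) :
    exists b : op (vna_space L), vna M a -> opf b = phi a.
  have [Ma|nMa] := pselect (vna M a); last by exists 0.
  by have [b <-] := vna_op vM0 (phi_fun _ Ma); exists b.
have [f fP] := boolp.choice lift; exists f; split; last first.
  by move=> a Ma; rewrite /trR fP // (iso_tr iso).
have fD (a b : op (vna_space M)) : vna M a -> vna M b -> f (a + b) = f a + f b.
  move=> Ma Mb; apply: opf_inj; rewrite fP; last exact: memD.
  have := iso_linear iso 1 Ma Mb; rewrite scale1r => ->.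
  by rewrite scale1r -(fP a) // -(fP b).
have M0' : vna M (0 : op (vna_space M)) := mem0 vM.
have f0 : f 0 = 0.
  by apply: (addrI (f 0)); rewrite -fD // !addr0.
split=> //.
- by split=> //; exact: vna_id.
- by move=> a Ma; rewrite fP //; exact: phi_fun.
- move=> k a Ma; apply: opf_inj; rewrite fP; last exact: memZ.
  have := iso_linear iso k Ma M0'; rewrite -(fP _ Ma) -(fP _ M0') f0 => h.
  have e1 : (k *: opf a + opf (0 : op (vna_space M))) = opf (k *: a).
    by rewrite -[k *: a]addr0.
  by rewrite -e1 h; apply/funext => u; rewrite !fctE addr0.
- move=> a b Ma Mb; apply: opf_inj; rewrite fP; last exact: memM.
  by rewrite (iso_mul iso) // -(fP a) // -(fP b).
- move=> a Ma; apply/esym/adjoint_star; rewrite !fP //; last exact: mem_star.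
  by apply: (iso_adjoint iso) => //; exact: star_adjoint.
- apply: opf_inj; rewrite fP; last exact: vna_id.
  exact: (iso_id iso).
- move=> a b Ma Mb /(congr1 (@opf _ _)); rewrite !fP // => ab.
  by apply: opf_inj; apply: phi_inj; rewrite ?inE.
- move=> b M0b; have [A MA Ab] := phi_surj _ M0b.
  have [a aE] := vna_op vM MA; rewrite -aE in MA Ab.
  by exists a => //; apply: opf_inj; rewrite fP.
Qed.

Section UnitaryConjugation.
Context {R : realType} {K : hilbert R}.
Variables (L : set (K -> K)) (u : op K).
Hypotheses (vL : von_neumann_algebra L) (L1 : L (1 : op K)) (Lu : L u).
Hypotheses (uu : star u * u = 1) (uu' : u * star u = 1).

(** Seen as an isomorphism, conjugation falls under [iso_preimage_vna]: the t in L with u t u^* in W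
    form a von Neumann algebra. *)
Lemma conj_star_iso : star_iso L L (fun t : op K => u * t * star u).
Proof.
have Lu' := mem_star vL Lu.
have conjK (t : op K) : star u * (u * t * star u) * u = t.
  by rewrite !mulrA uu mul1r -mulrA uu mulr1.
split=> //.
- by move=> t Lt; apply: memM => //; exact: memM.
- by move=> a b _ _; rewrite mulrDr mulrDl.
- by move=> k a _; rewrite -op_scalerAr -op_scalerAl.
- move=> a b _ _; have -> : u * a * star u * (u * b * star u) =
    u * a * (star u * u) * b * star u by rewrite !mulrA.
  by rewrite uu mulr1 -[u * a * b]mulrA.
- by move=> a _; rewrite !starM starK mulrA.
- by rewrite mulr1.
- by move=> a b _ _ ab; rewrite -(conjK a) ab conjK.
- move=> b Lb; exists (star u * b * u); first by apply: memM => //; exact: memM.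
  by rewrite !mulrA uu' mul1r -mulrA uu' mulr1.
Qed.

End UnitaryConjugation.

Section SpectralRecovery.
Context {R : realType} {K : hilbert R}.
Variables (n : nat) (q : 'I_n -> op K) (W : set (K -> K)).
Hypotheses (vW : von_neumann_algebra W) (W1 : W (1 : op K)).
Hypotheses (qq : forall i, q i * q i = q i) (q1 : \sum_i q i = 1).
Hypothesis qo : forall i j, i != j -> q i * q j = 0.

Let h : op K := \sum_(i < n) ((i : nat)%:R : R)%:C *: q i.

(* Lagrange interpolation at the eigenvalues of [h]. *)
Lemma mem_spectral_projection j : W h -> W (q j).
Proof.
move=> Wh.
have hq m : h * q m = ((m : nat)%:R : R)%:C *: q m.
  rewrite /h mulr_suml (bigD1 m) //= -op_scalerAl qq big1 ?addr0 // => i im.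
  by rewrite -op_scalerAl qo // scaler0.
pose c (k : 'I_n) : R := ((j : nat)%:R - (k : nat)%:R)^-1.
pose T k : op K := (c k)%:C *: (h - ((k : nat)%:R : R)%:C *: (1 : op K)).
have WT k : W (T k) by apply: memZ => //; apply: memB => //; exact: memZ.
pose l : op K := \prod_(k | k != j) T k.
have Wl : W l by apply: (big_ind (fun a : op K => W a)) => // a b; exact: memM.
have Tq k m : T k * q m = (c k * ((m : nat)%:R - (k : nat)%:R))%:C *: q m.
  rewrite /T -op_scalerAl mulrBl hq -op_scalerAl mul1r.
  by op_linear_identity.
have lq m : l * q m =
    (\prod_(k | k != j) (c k * ((m : nat)%:R - (k : nat)%:R)))%:C *: q m.
  rewrite /l; elim: (index_enum _) => [|k r IH].
    by rewrite !big_nil mul1r scale1r.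
  rewrite !big_cons; case: ifP => // _.
  by rewrite -mulrA IH -op_scalerAr Tq scalerA -rmorphM mulrC.
suff -> : q j = l by [].
rewrite -[RHS]mulr1 -q1 mulr_sumr (bigD1 j) //= big1 => [|m mj].
  rewrite addr0 lq big1 ?scale1r // => k kj.
  rewrite /c mulVf // subr_eq0 eqr_nat.
  by rewrite eq_sym in kj.
rewrite lq (bigD1 m) //= subrr mulr0 mul0r; exact: scale0r.
Qed.

End SpectralRecovery.

(** * Generators of the free product *)

Section FreeProduct.
Context {R : realType} {H1 H2 K : hilbert R}.
Variables (M : set (H1 -> H1)) (tM : (H1 -> H1) -> R[i]).
Variables (N : set (H2 -> H2)) (tN : (H2 -> H2) -> R[i]).
Variables (L : set (K -> K)) (tL : (K -> K) -> R[i]) (M0 N0 : set (K -> K)).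
Variables (f : op H1 -> op K) (g : op H2 -> op K).
Hypotheses (vM : von_neumann_algebra M) (M1 : M (1 : op H1)).
Hypotheses (vN : von_neumann_algebra N) (N1 : N (1 : op H2)).
Hypotheses (vL : von_neumann_algebra L) (L1 : L (1 : op K)).
Hypotheses (trM : faithful_normal_trace M tM) (trN : faithful_normal_trace N tN).
Hypothesis trL : faithful_normal_trace L tL.
Hypotheses (fM : type_II1_factor M) (fN : type_II1_factor N).
Hypotheses (fP : star_iso M M0 f) (gP : star_iso N N0 g).
Hypothesis ftr : forall a : op H1, M a -> trR tL (f a) = trR tM a.
Hypothesis gtr : forall a : op H2, N a -> trR tL (g a) = trR tN a.
Hypotheses (M0L : M0 `<=` L) (N0L : N0 `<=` L).
Hypothesis frMN : Defs.free (fun b => if b then M0 else N0) tL.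
Hypothesis genL : generated_vna (M0 `|` N0) = L.

Let A (b : bool) := if b then M0 else N0.

Let vA b : von_neumann_algebra (A b).
Proof. by case: b; [exact: iso_cod fP|exact: iso_cod gP]. Qed.

Let A1 b : A b (1 : op K).
Proof.
case: b; first by rewrite -(iso_one fP); exact: (iso_mem fP).
by rewrite -(iso_one gP); exact: (iso_mem gP).
Qed.

Let AL b : A b `<=` L. Proof. by case: b. Qed.

(** The preimage of W under k is a von Neumann algebra containing X, hence all of D. *)
Lemma mem_of_generators (H : hilbert R) (D : set (H -> H)) (D0 : set (K -> K))
    (tD : (H -> H) -> R[i]) (k : op H -> op K) (X : set (H -> H)) (W : set (K -> K)) :
  star_iso D D0 k -> faithful_normal_trace D tD -> von_neumann_algebra W ->
  generated_vna X = D -> X `<=` D -> (forall x : op H, X x -> W (k x)) ->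
  forall a : op H, D a -> W (k a).
Proof.
move=> kP trD vW gX XD XW a Da.
have vpre := iso_preimage_vna kP trD vW.
have : iso_preimage D k W a.
  rewrite -gX in Da; apply: Da => // x Xx.
  have [x' x'E] := vna_op (proj1 (iso_dom kP)) (XD x Xx); rewrite -x'E in Xx *.
  by apply/iso_preimageP; split; [exact: XD|exact: XW].
by case/iso_preimageP.
Qed.

(** For b = p + q - 1 one has b p = q p = q b and b q = p q = p b, so the polar part of b
    intertwines p and q as b does. *)
Lemma intertwining_symmetry (p q : op K) : M0 p -> N0 q -> proj p -> proj q ->
  trR tL p = trR tL q ->
  exists s : op K, [/\ star s = s, s * s = 1, s * p = q * s, s * q = p * s &
    forall W, von_neumann_algebra W -> W (1 : op K) -> W p -> W q -> W s].
Proof.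
move=> Mp Nq pp pq tpq; pose b : op K := p + q - 1.
have Lp := M0L Mp; have Lq := N0L Nq.
have Lb : L b by apply: memB => //; exact: memD.
have hb : star b = b by rewrite /b starB starD star1 (proj1 pp) (proj1 pq).
have injb (x : op K) : L x -> b * x = 0 -> x = 0.
  exact: (free_projections_injective vL L1 trL vA A1 AL frMN).
have [s [hs ss sint Ws]] := polar_symmetry vL L1 Lb hb injb.
have bp : b * p = q * p by rewrite /b mulrBl mulrDl (proj2 pp) mul1r addrAC subrr add0r.
have qb : q * b = q * p by rewrite /b mulrBr mulrDr (proj2 pq) mulr1 addrK.
have bq : b * q = p * q by rewrite /b mulrBl mulrDl (proj2 pq) mul1r addrK.
have pb : p * b = p * q by rewrite /b mulrBr mulrDr (proj2 pp) mulr1 addrAC subrr add0r.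
exists s; split=> //.
- by apply: sint; rewrite ?bp ?qb ?bq ?pb.
- by apply: sint; rewrite ?bp ?qb ?bq ?pb.
- by move=> W vW W1 Wp Wq; apply: Ws => //; apply: memB => //; exact: memD.
Qed.

Lemma free_product_generators (X P : set (H1 -> H1)) (Y Q : set (H2 -> H2)) (e : R) :
  0 < e ->
  finite_set X -> X `<=` M -> generated_vna X = M -> projection_partition M P ->
  finite_set Y -> Y `<=` N -> generated_vna Y = N -> projection_partition N Q ->
  exists Z P', [/\ finite_set Z, Z `<=` L, generated_vna Z = L,
    projection_partition L P' &
    \sum_(z \in Z) cut_index tL z P' <=
    \sum_(x \in X) cut_index tM x P + \sum_(y \in Y) cut_index tN y Q + (1 + e) / 2].
Proof.
move=> e0 finX XM gX PP finY YN gY PQ.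
have [ps [hps psP ps1]] := partition_seq vM PP.
have [qs [hqs qsQ qs1]] := partition_seq vN PQ.
have [l [hl l1 l2]] := common_refinement vM M1 vN N1 trM trN fM fN e0 hps hqs ps1 qs1.
pose n := size l.
pose r i := tnth (in_tuple l) i.
have rl (i : 'I_n) : r i \in l by exact: mem_tnth.
pose a (i : 'I_n) := (r i).1; pose b (i : 'I_n) := (r i).2.
have a1 : \sum_i a i = 1 by rewrite -l1 [RHS]big_tnth.
have b1 : \sum_i b i = 1 by rewrite -l2 [RHS]big_tnth.
have Ma i : M (a i) /\ proj (a i) by have [[]] := hl _ (rl i).
have Nb i : N (b i) /\ proj (b i) by have [[]] := hl _ (rl i).
have an0 i : a i <> 0 by have [_ x0 _ _] := hl _ (rl i); exact: x0.
have tab i : trR tM (a i) = trR tN (b i) by have [[]] := hl _ (rl i).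
have ta_le i : trR tM (a i) <= e by have [] := hl _ (rl i).
have h1 i : exists p, P (opf p) /\ p * a i = a i.
  by have [[_ _ _ [p pps pa] _] _ _ _] := hl _ (rl i); exists p; split=> //; exact: psP.
have [ga gaP] := boolp.choice h1.
have h2 i : exists q, Q (opf q) /\ q * b i = b i.
  by have [[_ _ _ _ [q qqs qb]] _ _ _] := hl _ (rl i); exists q; split=> //; exact: qsQ.
have [gb gbP] := boolp.choice h2.
pose p i := f (a i); pose q i := g (b i).
have iso_proj (H : hilbert R) (D : set (H -> H)) D0 (k : op H -> op K) (c : op H) :
    star_iso D D0 k -> D c -> proj c -> proj (k c).
  by move=> kP Dc [hc cc]; split; rewrite -1?(iso_star kP) -1?(iso_mulr kP) ?hc ?cc.
have Mp i : M0 (p i) by apply: (iso_mem fP); case: (Ma i).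
have Nq i : N0 (q i) by apply: (iso_mem gP); case: (Nb i).
have pp i : proj (p i) by have [? ?] := Ma i; exact: iso_proj fP _ _.
have pq i : proj (q i) by have [? ?] := Nb i; exact: iso_proj gP _ _.
have iso_sum (H : hilbert R) (D : set (H -> H)) D0 (k : op H -> op K) (c : 'I_n -> op H) :
    star_iso D D0 k -> (forall i, D (c i)) -> \sum_i c i = 1 -> \sum_i k (c i) = 1.
  move=> kP Dc c1; rewrite -(iso_one kP) -c1.
  have vD := proj1 (iso_dom kP).
  suff [] : D (\sum_i c i : op H) /\ k (\sum_i c i) = \sum_i k (c i) by [].
  elim/big_rec2: _ => [|i x y _ [Dx <-]]; first by split; [exact: mem0|exact: (iso0 kP)].
  by split; [exact: memD|rewrite (iso_add kP)].
have p1 : \sum_i p i = 1 by apply: (iso_sum _ _ _ _ _ fP) => // i; case: (Ma i).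
have q1 : \sum_i q i = 1 by apply: (iso_sum _ _ _ _ _ gP) => // i; case: (Nb i).
have Lp i : L (p i) /\ proj (p i) by split; [exact: M0L|].
have tp i : trR tL (p i) = trR tM (a i) by rewrite ftr //; case: (Ma i).
have tq i : trR tL (q i) = trR tN (b i) by rewrite gtr //; case: (Nb i).
have pn0 i : p i <> 0.
  rewrite -(iso0 fP) => h; apply: (an0 i); apply: (iso_inj fP) h; [by case: (Ma i)|].
  exact: mem0.
have po i j : i != j -> p i * p j = 0 := proj_sum1_orthogonal pp p1.
have qo i j : i != j -> q i * q j = 0 := proj_sum1_orthogonal pq q1.
have h3 i : exists s : op K, [/\ star s = s, s * s = 1, s * p i = q i * s,
    s * q i = p i * s &
    forall W, von_neumann_algebra W -> W (1 : op K) -> W (p i) -> W (q i) -> W s].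
  by apply: intertwining_symmetry => //; rewrite tp tq tab.
have [s sP] := boolp.choice h3.
have Ls i : L (s i).
  by have [_ _ _ _ h] := sP i; apply: h => //; [exact: M0L|exact: N0L].
have hs i : star (s i) = s i by case: (sP i).
have sq_ i : s i * q i = p i * s i by case: (sP i).
have ss i : s i * s i = 1 by case: (sP i).
pose u : op K := \sum_i s i * q i.
have Lu : L u by apply: mem_sum => // i _; apply: memM => //; exact: N0L.
have su : star u = \sum_i s i * p i.
  rewrite /u star_sum; apply: eq_bigr => i _.
  by rewrite starM hs (proj1 (pq i)); case: (sP i) => _ _ -> _ _.
(* Each s_i q_i = p_i s_i is a partial isometry from q_i to p_i; orthogonality on both sides makes
   their sum u unitary. *)
have pu i : p i * u = s i * q i.
  rewrite /u mulr_sumr (bigD1 i) //= sq_ mulrA (proj2 (pp i)) big1 ?addr0 //.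
  by move=> j ji; rewrite sq_ mulrA po 1?eq_sym // mul0r.
have up i : star u * p i = q i * s i.
  have := congr1 star (pu i); rewrite !starM hs (proj1 (pp i)) (proj1 (pq i)).
  by [].
have uu' : u * star u = 1.
  have -> : u * star u = \sum_i p i * u * star u by rewrite -!mulr_suml p1 mul1r.
  rewrite -[RHS]p1; apply: eq_bigr => i _.
  rewrite pu su mulr_sumr (bigD1 i) //= big1 => [|j ji].
    by rewrite addr0 sq_ -!mulrA [s i * (s i * _)]mulrA ss mul1r (proj2 (pp i)).
  have [_ _ -> _ _] := sP j.
  by rewrite -mulrA [q i * (q j * _)]mulrA qo 1?eq_sym // mul0r mulr0.
have uu : star u * u = 1.
  have -> : star u * u = \sum_i star u * p i * u by rewrite -mulr_suml -mulr_sumr p1 mulr1.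
  rewrite -[RHS]q1; apply: eq_bigr => i _.
  rewrite up /u mulr_sumr (bigD1 i) //= big1 => [|j ji].
    by rewrite addr0 -!mulrA [s i * (s i * _)]mulrA ss mul1r (proj2 (pq i)).
  have [_ _ spi _ _] := sP i; rewrite -spi sq_ mulrA -[s i * p i * p j]mulrA po 1?eq_sym //.
  by rewrite mulr0 mul0r.
pose h : op K := \sum_(i < n) ((i : nat)%:R : R)%:C *: q i.
have hh : star h = h.
  by rewrite /h star_sum; apply: eq_bigr => i _; rewrite starZ (proj1 (pq i)).
have Lh : L h by apply: mem_sum => // i _; apply: memZ => //; exact: N0L.
pose h' : op K := \sum_(i < n) \sum_(j < n | (i <= j)%N) p i * h * p j.
have Lh' : L h'.
  apply: mem_sum => // i _; apply: mem_sum => // j _.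
  by apply: memM; [| |exact: M0L] => //; apply: memM => //; exact: M0L.
have ph'p (i j : 'I_n) : p i * h' * p j = if (i <= j)%N then p i * h * p j else 0.
  rewrite /h' mulr_sumr mulr_suml (bigD1 i) //= [X in _ + X]big1 ?addr0 => [|k ki]; last first.
    rewrite mulr_sumr mulr_suml big1 // => m _.
    by rewrite !mulrA po 1?eq_sym // !mul0r.
  rewrite mulr_sumr mulr_suml big_mkcond (bigD1 j) //= big1 ?addr0 => [|k kj]; last first.
    by case: ifP => // _; rewrite -!mulrA po // !mulr0.
  by case: ifP => // _; rewrite -!mulrA (proj2 (pp j)) !mulrA (proj2 (pp i)).
have [xs [uxs xsE]] := finite_enum finX; have [ys [uys ysE]] := finite_enum finY.
(* Lifts of the generators to bundled operators; their values off [X] are arbitrary. *)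
have h4 B : exists c : op H1, X B -> opf c = B.
  have [XB|nXB] := pselect (X B); last by exists 0.
  by have [c <-] := vna_op vM (XM _ XB); exists c.
have [cx cxP] := boolp.choice h4.
have h5 B : exists c : op H2, Y B -> opf c = B.
  have [YB|nYB] := pselect (Y B); last by exists 0.
  by have [c <-] := vna_op vN (YN _ YB); exists c.
have [cy cyP] := boolp.choice h5.
have cxM B : B \in xs -> M (cx B).
  by move=> Bxs; have XB : X B by [rewrite xsE]; rewrite cxP //; exact: XM.
have cyN B : B \in ys -> N (cy B).
  by move=> Bys; have YB : Y B by [rewrite ysE]; rewrite cyP //; exact: YN.
pose zs : seq (op K) := [seq f (cx B) | B <- xs] ++
  [seq u * g (cy B) * star u | B <- ys] ++ [:: h'].
pose Z := [set` [seq opf z | z <- zs]].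
have Lzs (z : op K) : z \in zs -> L z.
  rewrite /zs !mem_cat => /orP[/mapP[B Bxs ->]|/orP[/mapP[B Bys ->]|]].
  - by apply: M0L; apply: (iso_mem fP); exact: cxM.
  - apply: memM; [by []|apply: memM => //|exact: mem_star].
    by apply: N0L; apply: (iso_mem gP); exact: cyN.
  - by rewrite inE => /eqP ->.
have ZL : Z `<=` L by move=> B /= /mapP[z zzs ->]; exact: Lzs.
have t0 i : 0 <= trR tM (a i).
  by have [? ?] := Ma i; apply: (trR_ge0 vM M1 trM) => //; exact: proj_pos.
exists Z, (family_set p); split.
- by apply/finite_seqP; exists [seq opf z | z <- zs].
- exact: ZL.
- apply/seteqP; split; first exact: generated_vna_sub.
  rewrite -genL => B gB W vW ZW; apply: gB => //.
  have zW (z : op K) : z \in zs -> W z by move=> zzs; apply: ZW; exact: map_f.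
  have M0W : M0 `<=` W.
    have fW : forall c : op H1, M c -> W (f c).
      apply: (mem_of_generators fP trM vW gX XM) => x Xx.
      have xxs : opf x \in xs by move: (Xx); rewrite xsE.
      have -> : x = cx x by apply: opf_inj; rewrite cxP.
      by apply: zW; rewrite mem_cat map_f.
    move=> C M0C; have [c cE] := vna_op (iso_cod fP) M0C; rewrite -cE in M0C *.
    by have [c' Mc' <-] := iso_surj fP M0C; exact: fW.
  have Wp i : W (p i) by exact: M0W.
  have W1 : W (1 : op K) by apply: M0W; exact: (A1 true).
  (* The blocks below the diagonal are adjoints of blocks above it, because h is self-adjoint. *)
  have Wh : W h.
    have -> : h = \sum_i \sum_j p i * h * p j.
      rewrite -[LHS]mulr1 -[LHS]mul1r -p1 mulrA mulr_suml mulr_suml.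
      by apply: eq_bigr => i _; rewrite mulr_sumr.
    have Wph (i j : 'I_n) : (i <= j)%N -> W (p i * h * p j).
      move=> ij; have <- : p i * h' * p j = p i * h * p j by rewrite ph'p ij.
      apply: memM => //; apply: memM => //; apply: zW.
      by rewrite !mem_cat mem_head !orbT.
    apply: mem_sum => // i _; apply: mem_sum => // j _.
    have [ij|/ltnW ji] := leqP i j; first exact: Wph.
    have <- : star (p j * h * p i) = p i * h * p j.
      by rewrite !starM hh (proj1 (pp i)) (proj1 (pp j)) mulrA.
    by apply: mem_star => //; exact: Wph.
  have Wq i : W (q i).
    exact: (mem_spectral_projection vW W1 (fun i => proj2 (pq i)) q1 qo i Wh).
  have Wu : W u.
    apply: mem_sum => // i _; apply: memM => //.
    by have [_ _ _ _ hW] := sP i; exact: hW.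
  have Wu' := mem_star vW Wu.
  have N0W : N0 `<=` W.
    have cP := conj_star_iso vL L1 Lu uu uu'.
    (* The generators Y of N are conjugated into W, hence so is all of N; since u is already in W,
       the conjugation can be undone there. *)
    have gW : forall c : op H2, N c -> iso_preimage L (fun t : op K => u * t * star u) W (g c).
      apply: (mem_of_generators gP trN (iso_preimage_vna cP trL vW) gY YN) => y Yy.
      have yys : opf y \in ys by move: (Yy); rewrite ysE.
      have -> : y = cy y by apply: opf_inj; rewrite cyP.
      apply/iso_preimageP; split.
        by apply: N0L; apply: (iso_mem gP); exact: cyN.
      by apply: zW; rewrite !mem_cat; apply/orP; right;
        rewrite (map_f (fun B => u * g (cy B) * star u)).
    move=> C N0C; have [c cE] := vna_op (iso_cod gP) N0C; rewrite -cE in N0C *.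
    have [c' Nc' <-] := iso_surj gP N0C.
    have /iso_preimageP[_ Wc] := gW _ Nc'.
    have -> : g c' = star u * (u * g c' * star u) * u.
      by rewrite !mulrA uu mul1r -mulrA uu mulr1.
    by apply: memM => //; exact: memM.
  by move=> C [/M0W|/N0W].
- exact: (family_partition Lp pn0 p1).
- have cut0 (z : K -> K) : L z -> 0 <= cut_index tL z (family_set p).
    by move=> _; apply: (cut_index_ge0 vL L1 trL); exact: (family_partition Lp pn0 p1).
  apply: le_trans (fsum_le_seq (s := [seq opf z | z <- zs]) _ _) _ => //.
    by move=> _ /mapP[z zzs ->]; apply: cut0; exact: Lzs.
  rewrite big_map /zs !big_cat /= big_seq1 !big_map addrA.
  have cutP := family_cut_le vL L1 trL Lp.
  apply: lerD; first apply: lerD.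
  + rewrite xsE -fsbig_seq // big_seq [leRHS]big_seq; apply: ler_sum => B Bxs.
    apply: le_trans (cutP _) _.
    have XB : X B by rewrite xsE.
    rewrite -[in leRHS](cxP _ XB).
    apply: le_trans (refined_cut_le vM M1 trM (cx B) Ma a1 PP
      (fun i => proj1 (gaP i)) (fun i => proj2 (gaP i))).
    apply: ler_sum => i _; rewrite big_mkcond [leRHS]big_mkcond; apply: ler_sum => j _.
    (* A block of f x that is nonzero comes from a nonzero block of x, and f preserves traces. *)
    rewrite !tp; case: ifP => [nz|_]; last by case: ifP => // _; rewrite mulr_ge0.
    suff -> : a i * cx B * a j != 0 by [].
    apply: contra_neq nz => z0; have [? _] := Ma i; have [? _] := Ma j.
    rewrite /p -!(iso_mulr fP) ?z0 ?(iso0 fP) //; try exact: cxM.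
    by apply: memM => //; exact: cxM.
  + rewrite ysE -fsbig_seq // big_seq [leRHS]big_seq; apply: ler_sum => B Bys.
    apply: le_trans (cutP _) _.
    have YB : Y B by rewrite ysE.
    rewrite -[in leRHS](cyP _ YB).
    apply: le_trans (refined_cut_le vN N1 trN (cy B) Nb b1 PQ
      (fun i => proj1 (gbP i)) (fun i => proj2 (gbP i))).
    apply: ler_sum => i _; rewrite big_mkcond [leRHS]big_mkcond; apply: ler_sum => j _.
    rewrite !tp -!tab; case: ifP => [nz|_]; last by case: ifP => // _; rewrite mulr_ge0.
    suff -> : b i * cy B * b j != 0 by [].
    apply: contra_neq nz => z0; have [? _] := Nb i; have [? _] := Nb j.
    (* The outer symmetries do not affect vanishing, so blocks of u y u^* along (p_i) correspond to
       blocks of y along (q_i), of the same traces. *)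
    have -> : p i * (u * g (cy B) * star u) * p j = s i * (q i * g (cy B) * q j) * s j.
      by rewrite !mulrA pu -!mulrA up !mulrA.
    rewrite /q -!(iso_mulr gP) ?z0 ?(iso0 gP) ?mulr0 ?mul0r //; try exact: cyN.
    by apply: memM => //; exact: cyN.
  + apply: le_trans (cutP _) _.
    apply: le_trans (upper_triangle_sum (t := fun i => trR tM (a i)) _ _) => [|i|]; last 2 first.
    * by rewrite t0 ta_le.
    * by rewrite -(trR1 trM) -a1 (trR_sum vM trM) // => i _; case: (Ma i).
    apply: ler_sum => i _; rewrite big_mkcond [leRHS]big_mkcond; apply: ler_sum => j _.
    rewrite !tp ph'p; case: (i <= j)%N; last by rewrite eqxx.
    by case: ifP => // _; rewrite mulr_ge0.
Qed.

End FreeProduct.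

Lemma generator_invariant_ge0 (R : realType) (M : tracial_vna R) :
  (0 <= generator_invariant M)%E.
Proof.
apply: le_ereal_inf_tmp => _ [X _ <-]; apply: le_ereal_inf_tmp => _ [P PP <-].
rewrite lee_fin; apply: fsumr_ge0 => x _.
exact: (cut_index_ge0 (vna_axiom M) (vna_id M) (tr_axiom M)).
Qed.

Lemma generator_invariant_lt (R : realType) (M : tracial_vna R) (t : R) :
  (generator_invariant M < t%:E)%E -> exists X P,
  [/\ finite_set X, X `<=` vna M, generated_vna X = vna M,
      projection_partition (vna M) P & \sum_(x \in X) cut_index (tr M) x P < t].
Proof.
move=> /ereal_inf_lt[_ [X [finX XM gX] <-]] /ereal_inf_lt[_ [P PP <-]].
by rewrite lte_fin => h; exists X, P.
Qed.

Theorem theorem7p5 (R : realType) (M N L : tracial_vna R)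
  (hM : II1_factor M) (hN : II1_factor N) (hL : free_product M N L) :
  (generator_invariant L <=
   generator_invariant M + generator_invariant N + (1 / 2 : R)%R%:E)%E.
Proof.
have M0 := generator_invariant_ge0 M; have N0 := generator_invariant_ge0 N.
case EM : (generator_invariant M) M0 => [m| |] // _; last first.
  have NN : generator_invariant N != -oo%E by case: (generator_invariant N) N0.
  by rewrite addye // addye // leey.
case EN : (generator_invariant N) N0 => [n| |] // _; last by rewrite addey // addye // leey.
apply/lee_addgt0Pr => e e0.
(* The slack e is spent as e / 4 for M, e / 4 for N and e / 2 on the triangle, whose cost is 1 / 2 +
   e / 2. *)
have [|X [P [finX XM gX PP hX]]] := @generator_invariant_lt _ M (m + e / 4).
  by rewrite EM lte_fin ltrDl divr_gt0.
have [|Y [Q [finY YN gY PQ hY]]] := @generator_invariant_lt _ N (n + e / 4).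
  by rewrite EN lte_fin ltrDl divr_gt0.
have [M0 [N0 [phi [psi [isoM isoN fr gen]]]]] := hL.
have [f [fP ftr]] := star_iso_of_tracial_iso isoM.
have [g [gP gtr]] := star_iso_of_tracial_iso isoN.
have [_ M0L] := iso_sub isoM; have [_ N0L] := iso_sub isoN.
have [Z [P' [finZ ZL gZ PP' hZ]]] := free_product_generators
  (vna_axiom M) (vna_id M) (vna_axiom N) (vna_id N) (vna_axiom L) (vna_id L)
  (tr_axiom M) (tr_axiom N) (tr_axiom L) hM hN fP gP ftr gtr M0L N0L fr gen
  e0 finX XM gX PP finY YN gY PQ.
apply: le_trans (_ : _ <= set_index (vna L) (tr L) Z)%E _.
  by apply: ereal_inf_lbound; exists Z.
apply: le_trans (_ : _ <= (\sum_(z \in Z) cut_index (tr L) z P')%:E)%E _.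
  by apply: ereal_inf_lbound; exists P'.
rewrite -!EFinD lee_fin; lra.
Qed.
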